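(* Let $N\ge1$ be an integer and let $x\in\mathbb{C}$ with $\mathrm{Re}(x)>0$. Then $$\bar\Gamma_N(x)=\exp\left(\sum_{k=0}^N(-1)^k\binom{N}{k}\log\Gamma_N\!\left(\frac{k+x}{2}\right)-2^{-N}\log2\right).$$ Equivalently, with the left-hand side understood as a zeta-regularized product, $$\prod_{n=0}^\infty(n+x)^{(-1)^{n+1}\binom{n+N-1}{N-1}}=2^{-2^{-N}}\prod_{k=0}^N\Gamma_N\!\left(\frac{k+x}{2}\right)^{(-1)^k\binom Nk}.$$ In particular, $$\bar\Gamma_2(1)=\prod_{n=0}^{\infty}(n+1)^{(-1)^{n+1}(n+1)}=\frac{\Gamma_2\left(\frac12\right)\Gamma_2\left(\frac32\right)}{2^{1/4}\,\Gamma_2(1)^2},$$ and $$\Gamma_2\left(\tfrac12\right)\Gamma_2\left(\tfrac32\right)=2^{-1/12}e^{-1/4}A^3\,\Gamma_2(1)^2,$$ where $A$ is the Glaisher–Kinkelin constant.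
   Context: Powers use the principal branch. For $\mathrm{Re}(x)>0$, let $\zeta_N(s,x)=\sum_{m_1,\ldots,m_N=0}^\infty(x+m_1+\cdots+m_N)^{-s}$ ($\mathrm{Re}(s)>N$), continued meromorphically to $s\in\mathbb{C}$ (holomorphic at $s=0$); the normalized Barnes multiple gamma function is $\Gamma_N(x)=\exp\left(\frac{\partial}{\partial s}\zeta_N(s,x)\big|_{s=0}\right)$, with $\log\Gamma_N(x):=\frac{\partial}{\partial s}\zeta_N(s,x)|_{s=0}$. Let $\zeta_{E,N}(s,x)=\sum_{m_1,\ldots,m_N=0}^\infty(-1)^{m_1+\cdots+m_N}(x+m_1+\cdots+m_N)^{-s}$ (absolutely convergent for $\mathrm{Re}(s)>N$), continued analytically in $s$ to a function holomorphic at $s=0$; the multiple alternating gamma function is $\bar\Gamma_N(x)=\exp\left(\frac{\partial}{\partial s}\zeta_{E,N}(s,x)\big|_{s=0}\right)$. The zeta-regularized product $\prod_{n=0}^\infty(n+x)^{(-1)^{n+1}\binom{n+N-1}{N-1}}$ is $\exp(G'(0))$, where $G$ is the analytic continuation to $s=0$ of $G(s)=\sum_{n=0}^\infty(-1)^n\binom{n+N-1}{N-1}(n+x)^{-s}$. The Glaisher–Kinkelin constant is $A=\lim_{n\to\infty}\frac{\prod_{k=1}^nk^k}{n^{n^2/2+n/2+1/12}}e^{n^2/4}=e^{1/12-\zeta'(-1)}$, with $\zeta$ the Riemann zeta function. *)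

(* Defs.v *)
From Stdlib Require Import Reals ZArith List ClassicalEpsilon.
From Coquelicot Require Import Coquelicot.
From mathcomp Require Import tuple binomial.

Open Scope R_scope.

Definition Cexp (z : C) : C := (exp (Re z) * cos (Im z), exp (Re z) * sin (Im z)).

(* Valued in (-PI, PI] for z <> 0. *)
Definition Carg (z : C) : R :=
  if Rle_dec 0 (Im z) then acos (Re z / Cmod z) else - acos (Re z / Cmod z).

Definition Cln (z : C) : C := (ln (Cmod z), Carg z).

Definition Cpower (z w : C) : C := Cexp (w * Cln z).

Definition CpowerZ (z : C) (n : Z) : C :=
  match n with
  | Z0 => RtoC 1
  | Zpos p => (z ^ Pos.to_nat p)%C
  | Zneg p => (/ z ^ Pos.to_nat p)%C
  end.

(* Unconditional (equivalently, absolute) summability: convergence along the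
   finite subsets of I ordered by inclusion. *)
Definition is_sum {I : Type} (f : I -> C) (l : C) : Prop :=
  forall eps : R, 0 < eps ->
  exists J0 : list I, forall J : list I, NoDup J -> incl J0 J ->
    Cmod (fold_right Cplus (RtoC 0) (map f J) - l) < eps.

(* The product of f 0, ..., f n, both ends included as in sum_n. *)
Fixpoint Cprod_n (f : nat -> C) (n : nat) : C :=
  match n with
  | O => f O
  | S p => (Cprod_n f p * f n)%C
  end.

Definition analytic_at (f : C -> C) (a : C) : Prop :=
  exists (c : nat -> C) (r : R), 0 < r /\
  forall s : C, Cmod (s - a) < r ->
    @is_pseries C_AbsRing C_NormedModule c (s - a)%C (f s).

(* A Laurent expansion with finite principal part on a punctured disc; the value
   f a is unconstrained, so a may be a pole. *)
Definition meromorphic_at (f : C -> C) (a : C) : Prop :=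
  exists (m : nat) (c : nat -> C) (r : R), 0 < r /\
  forall s : C, 0 < Cmod (s - a) < r ->
    @is_pseries C_AbsRing C_NormedModule c (s - a)%C ((s - a) ^ m * f s)%C.

(* D s v says that the defining series converges at s, with sum v. *)
Definition is_continuation (D : C -> C -> Prop) (sigma : R) (F : C -> C) : Prop :=
  (forall a : C, meromorphic_at F a) /\
  analytic_at F (RtoC 0) /\
  (forall s : C, sigma < Re s -> D s (F s)).

(* By the identity theorem, two such F agree near 0, so that the derivative of
   the chosen one at 0 does not depend on the choice. *)
Definition continuation (P : (C -> C) -> Prop) : C -> C :=
  epsilon (inhabits (fun _ : C => RtoC 0)) P.

Definition zeta_series (N : nat) (x s v : C) : Prop :=
  is_sum (fun m : N.-tuple nat => Cpower (x + INR (list_sum m)) (- s)) v.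

Definition zetaE_series (N : nat) (x s v : C) : Prop :=
  is_sum (fun m : N.-tuple nat =>
    ((- (1)) ^ list_sum m * Cpower (x + INR (list_sum m)) (- s))%C) v.

Definition zeta (N : nat) (x : C) : C -> C :=
  continuation (is_continuation (zeta_series N x) (INR N)).

Definition zetaE (N : nat) (x : C) : C -> C :=
  continuation (is_continuation (zetaE_series N x) (INR N)).

Definition logGamma (N : nat) (x : C) : C := C_derive (zeta N x) (RtoC 0).

Definition Gamma (N : nat) (x : C) : C := Cexp (logGamma N x).

Definition barGamma (N : nat) (x : C) : C := Cexp (C_derive (zetaE N x) (RtoC 0)).

(* The regularized product of the lam n ^ e n is exp (G' 0), where G continues
   the Dirichlet series of general term - e n * lam n ^ (- s) from some right
   half-plane; formally, the derivative of this term at 0 is e n * log (lam n). *)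
Definition zeta_prod (lam : nat -> C) (e : nat -> Z) : C :=
  let D (s v : C) :=
    @is_series C_AbsRing C_NormedModule
      (fun n => (IZR (- e n) * Cpower (lam n) (- s))%C) v in
  Cexp (C_derive
    (continuation (fun G => exists sigma : R, is_continuation D sigma G))
    (RtoC 0)).

(* The factor of index 0 in the product is 0 ^ 0 = 1. *)
Definition Glaisher : R :=
  real (Lim_seq (fun n =>
    prod_f_R0 (fun k => INR k ^ k) n
      / Rpower (INR n) (INR n ^ 2 / 2 + INR n / 2 + 1 / 12)
    * exp (INR n ^ 2 / 4))).

(* Main.v *)
(** Splitting every summation index by parity turns the alternating series into
    [zeta_E,N(s, x) = 2^(-s) sum_k (-1)^k C(N, k) zeta_N(s, (k + x) / 2)], first for
    [Re s > N] and then, by the identity theorem, for the continuations.  The product rule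
    at [s = 0] gives the formula once [zeta_E,N(0, x) = 2^(-N)] is known; this value follows
    by induction on [N] from [zeta_E,N(0, x) + zeta_E,N(0, x + 1) = zeta_E,N-1(0, x)],
    because [zeta_E,N(0, x)] is a polynomial in [x] and an antiperiodic polynomial is zero.

    The continuation of [zeta_N] reduces to that of the Hurwitz function, since
    [C(n + N - 1, N - 1)] is a polynomial in [n + x].  By Euler-Maclaurin summation,
    [(s - 1) zeta(s, x)] is the limit of the corrected partial sums
    [(s - 1) sum_(n < m) (x + n)^(-s) + sum_(k <= J) B_k / k! (d/dw)^k w^(1 - s) at w = x + m],
    whose increments are [O(m^(-s - J))].  Analyticity means having an absolutely convergent
    power series; it passes to sums that converge normally because Cauchy's estimate, proved by
    averaging over roots of unity, bounds the coefficients by the supremum on a disc.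

    For [N = 2] and [x = 1] the alternating function is [(1 - 2^(2 - s)) zeta(s - 1)], and
    [zeta'(-1)] is read off the same corrected partial sums, differentiated term by term: they
    contain the logarithm of the sequence defining the Glaisher constant. *)

Require Import Defs.
From Stdlib Require Import Reals ZArith List Lia Lra Permutation.
From Stdlib Require Import ClassicalEpsilon FunctionalExtensionality.
From Coquelicot Require Import Coquelicot.
From mathcomp Require Import tuple binomial.

Open Scope R_scope.

(** The functions behind [zeta], [zetaE] and [zeta_prod] are picked by [epsilon], so only their
    specification is known. Each derivative at 0 is therefore computed on an explicit continuation
    and transferred. Since [meromorphic_at] leaves the value at the centre free, the identity
    theorem gives equality on punctured discs only; analyticity at 0 is what recovers a full
    neighbourhood of 0. No contour integral occurs: products, changes of order and termwise
    differentiation all come from regrouping absolutely summable families, which is why sums are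
    accompanied by a bound on their finite absolute sums. Multiplying the Hurwitz function by
    [s - 1] removes its only pole and makes it a locally uniform limit of entire functions. The
    order of the Euler-Maclaurin correction must grow as [Re s] decreases; at a nonpositive integer
    [s] the correction terminates, and this is why the values there are polynomials in [x]. *)

Definition csum {I : Type} (f : I -> C) (J : list I) : C :=
  fold_right Cplus (RtoC 0) (map f J).
Definition rsum {I : Type} (f : I -> R) (J : list I) : R :=
  fold_right Rplus 0 (map f J).
(** Absolute summability in quantitative form: a bound passes through comparisons and double sums by
    estimates on finite lists alone, with no value of the sum of moduli to name. *)
Definition bsum {I : Type} (f : I -> C) (M : R) : Prop :=
  forall J, NoDup J -> rsum (fun i => Cmod (f i)) J <= M.
(** Index types carry no decidable equality, and equality of complex numbers is not decidable, so
    case distinctions rest on excluded middle. *)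
Definition prop_dec (P : Prop) : {P} + {~ P} := excluded_middle_informative P.

Ltac pose_rmin a b :=
  let h := fresh "hmin" in assert (h := Rmin_l a b);
  let h' := fresh "hmin" in assert (h' := Rmin_r a b).

(** * Estimates with the modulus and limits along filters *)

Lemma Ceq_eps (x y : C) : (forall eps, 0 < eps -> Cmod (x - y) <= eps) -> x = y.
Proof.
  intros H. apply Ceq_minus, Cmod_eq_0, Rle_antisym; [|apply Cmod_ge_0].
  apply le_epsilon; intros eps Heps. rewrite Rplus_0_l. auto.
Qed.

Lemma Cmod_via (u x y : C) e : Cmod (u - x) < e / 2 -> Cmod (u - y) < e / 2 -> Cmod (x - y) <= e.
Proof.
  intros H1 H2. replace (x - y)%C with (- (u - x) + (u - y))%C by ring.
  eapply Rle_trans; [apply Cmod_triangle|]. rewrite Cmod_opp. lra.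
Qed.

(** The balls of the product uniform structure are squares; the factor [sqrt 2] between a square and
    its circumscribed disc is rounded up to 2. *)
Lemma ball_Cmod (x y : C) (eps : posreal) : ball x eps y -> Cmod (y - x) < 2 * eps.
Proof.
  intros H. apply C_NormedModule_mixin_compat2 in H.
  change (Cmod (y - x) < sqrt 2 * eps) in H.
  assert (hs : sqrt 2 <= 2).
  { rewrite <- (sqrt_square 2) at 2 by lra. apply sqrt_le_1; lra. }
  assert (he := cond_pos eps). nra.
Qed.

Section FilterLimits.
Context {T : Type} {F : (T -> Prop) -> Prop}.
Implicit Types (u v : T -> C).

(** An arbitrary filter lets the same rules serve unconditional sums, through [fin_filter], and
    sequences, through [eventually]. *)
Definition flim u (l : C) : Prop := forall eps, 0 < eps -> F (fun t => Cmod (u t - l) < eps).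

Lemma flim_unique {FF : ProperFilter F} u l l' : flim u l -> flim u l' -> l = l'.
Proof.
  intros H H'. apply Ceq_eps; intros eps Heps.
  assert (HF := @filter_filter _ _ FF).
  destruct (filter_ex (F := F) (fun t => Cmod (u t - l) < eps / 2 /\ Cmod (u t - l') < eps / 2))
    as (t & h & h'); [apply filter_and; [apply H|apply H']; lra|].
  now apply (Cmod_via (u t)).
Qed.

Context {FF : Filter F}.

Lemma flim_ext u v l : (forall t, u t = v t) -> flim u l -> flim v l.
Proof.
  intros E H eps Heps. apply (filter_imp (fun t => Cmod (u t - l) < eps)); auto.
  intros t. now rewrite E.
Qed.

Lemma flim_const l : flim (fun _ => l) l.
Proof.
  intros eps Heps. apply filter_forall. intros _.
  replace (l - l)%C with (RtoC 0) by ring. now rewrite Cmod_0.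
Qed.

Lemma flim_plus u v l m : flim u l -> flim v m -> flim (fun t => u t + v t)%C (l + m)%C.
Proof.
  intros H H' eps Heps.
  apply (filter_imp (fun t => Cmod (u t - l) < eps / 2 /\ Cmod (v t - m) < eps / 2)).
  - intros t [h h']. replace (u t + v t - (l + m))%C with ((u t - l) + (v t - m))%C by ring.
    eapply Rle_lt_trans; [apply Cmod_triangle|]. lra.
  - apply filter_and; [apply H|apply H']; lra.
Qed.

Lemma flim_scal (a : C) u l : flim u l -> flim (fun t => a * u t)%C (a * l)%C.
Proof.
  intros H eps Heps. assert (Ha := Cmod_ge_0 a).
  apply (filter_imp (fun t => Cmod (u t - l) < eps / (Cmod a + 1))).
  - intros t h. replace (a * u t - a * l)%C with (a * (u t - l))%C by ring.
    rewrite Cmod_mult. assert (h0 := Cmod_ge_0 (u t - l)).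
    apply Rmult_lt_compat_l with (r := Cmod a + 1) in h; [|lra].
    replace ((Cmod a + 1) * (eps / (Cmod a + 1))) with eps in h by (field; lra). nra.
  - apply H. apply Rdiv_lt_0_compat; lra.
Qed.

End FilterLimits.

Arguments flim {T} F u l.

(** * Finite sums over lists *)

Section Lists.
Context {I : Type}.
Implicit Types (f g : I -> C) (J : list I).

Lemma csum_app f J1 J2 : csum f (J1 ++ J2) = (csum f J1 + csum f J2)%C.
Proof.
  unfold csum. induction J1 as [|i J1 IH]; simpl.
  - ring.
  - rewrite IH. ring.
Qed.

Lemma rsum_app (f : I -> R) J1 J2 : rsum f (J1 ++ J2) = rsum f J1 + rsum f J2.
Proof.
  unfold rsum. induction J1 as [|i J1 IH]; simpl; [|rewrite IH]; ring.
Qed.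

Lemma csum_perm f J1 J2 : Permutation J1 J2 -> csum f J1 = csum f J2.
Proof.
  unfold csum. induction 1; simpl; try congruence. ring.
Qed.

Lemma rsum_perm (f : I -> R) J1 J2 : Permutation J1 J2 -> rsum f J1 = rsum f J2.
Proof.
  unfold rsum. induction 1; simpl; try congruence. ring.
Qed.

Lemma csum_ext f g J : (forall i, In i J -> f i = g i) -> csum f J = csum g J.
Proof.
  unfold csum. induction J as [|i J IH]; simpl; intros H; [easy|].
  rewrite IH by auto. now rewrite H by auto.
Qed.

Lemma rsum_ext (f g : I -> R) J : (forall i, In i J -> f i = g i) -> rsum f J = rsum g J.
Proof.
  unfold rsum. induction J as [|i J IH]; simpl; intros H; [easy|].
  rewrite IH by auto. now rewrite H by auto.
Qed.

Lemma csum_plus f g J : csum (fun i => f i + g i)%C J = (csum f J + csum g J)%C.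
Proof. unfold csum. induction J as [|i J IH]; simpl; [|rewrite IH]; ring. Qed.

Lemma csum_scal (a : C) f J : csum (fun i => a * f i)%C J = (a * csum f J)%C.
Proof. unfold csum. induction J as [|i J IH]; simpl; [|rewrite IH]; ring. Qed.

Lemma rsum_scal (a : R) (f : I -> R) J : rsum (fun i => a * f i) J = a * rsum f J.
Proof. unfold rsum. induction J as [|i J IH]; simpl; [|rewrite IH]; ring. Qed.

Lemma rsum_plus (f g : I -> R) J : rsum (fun i => f i + g i) J = rsum f J + rsum g J.
Proof. unfold rsum. induction J as [|i J IH]; simpl; [|rewrite IH]; ring. Qed.

Lemma rsum_le (f g : I -> R) J :
  (forall i, In i J -> f i <= g i) -> rsum f J <= rsum g J.
Proof.
  unfold rsum. induction J as [|i J IH]; simpl; intros H; [lra|].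
  apply Rplus_le_compat; auto.
Qed.

Lemma rsum_ge0 (f : I -> R) J : (forall i, In i J -> 0 <= f i) -> 0 <= rsum f J.
Proof.
  unfold rsum. induction J as [|i J IH]; simpl; intros H; [lra|].
  apply Rplus_le_le_0_compat; auto.
Qed.

Lemma Cmod_csum_le f J : Cmod (csum f J) <= rsum (fun i => Cmod (f i)) J.
Proof.
  unfold csum, rsum. induction J as [|i J IH]; simpl.
  - rewrite Cmod_0. lra.
  - eapply Rle_trans; [apply Cmod_triangle|lra].
Qed.

Lemma rsum_incl (f : I -> R) J J' : (forall i, 0 <= f i) ->
  NoDup J -> incl J J' -> rsum f J <= rsum f J'.
Proof.
  intros Hf. revert J'. induction J as [|i J IH]; intros J' HJ Hi.
  - apply rsum_ge0; auto.
  - inversion HJ as [|? ? Hni HJ']; subst.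
    destruct (in_split i J') as (l1 & l2 & ->); [apply Hi; now left|].
    rewrite (rsum_perm _ (l1 ++ i :: l2) (i :: (l1 ++ l2)))
      by (symmetry; apply Permutation_middle).
    change (f i + rsum f J <= f i + rsum f (l1 ++ l2)).
    apply Rplus_le_compat_l, IH; auto.
    intros j Hj. assert (Hj' := Hi j (or_intror Hj)).
    apply in_app_or in Hj'. apply in_or_app. destruct Hj' as [|[->|]]; auto.
    contradiction.
Qed.

Definition inb (i : I) J : bool := if in_dec (fun x y : I => prop_dec (x = y)) i J then true else
  false.

Lemma inbP i J : inb i J = true <-> In i J.
Proof. unfold inb. destruct in_dec; split; intros; easy. Qed.

Definition without J0 J := filter (fun i => negb (inb i J0)) J.

Lemma without_In J0 J i : In i (without J0 J) <-> In i J /\ ~ In i J0.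
Proof.
  unfold without. rewrite filter_In. destruct (inb i J0) eqn:E; simpl; split; intros [h1 h2].
  - discriminate.
  - elim h2. now apply inbP.
  - split; auto. intros h. apply inbP in h. congruence.
  - auto.
Qed.

Definition ndup J := nodup (fun x y : I => prop_dec (x = y)) J.

Lemma NoDup_app_disj J1 J2 : NoDup J1 -> NoDup J2 ->
  (forall i, In i J2 -> ~ In i J1) -> NoDup (J1 ++ J2).
Proof. intros H1 H2 H. apply NoDup_app; auto. intros i Hi Hi2. exact (H i Hi2 Hi). Qed.

Lemma ndup_ok J : NoDup (ndup J) /\ (forall i, In i (ndup J) <-> In i J).
Proof. split; [apply NoDup_nodup|intros; apply nodup_In]. Qed.

Lemma Permutation_without J0 J : NoDup J0 -> NoDup J -> incl J0 J ->
  Permutation J (J0 ++ without J0 J).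
Proof.
  intros H0 HJ Hi. apply NoDup_Permutation; auto.
  - apply NoDup_app_disj; auto; [now apply NoDup_filter|].
    intros i h. now apply without_In in h.
  - intros i. rewrite in_app_iff, without_In. split; [|intros [h|[h _]]; auto].
    intros h. destruct (prop_dec (In i J0)); auto.
Qed.

Lemma rsum_split (P : I -> bool) J (f : I -> R) :
  rsum f J = rsum f (filter P J) + rsum f (filter (fun i => negb (P i)) J).
Proof.
  unfold rsum. induction J as [|i J IH]; simpl; [ring|].
  rewrite IH. destruct (P i); simpl; ring.
Qed.

Lemma rsum_without J0 J (f : I -> R) : (forall i, In i J0 -> f i = 0) ->
  rsum f J = rsum f (without J0 J).
Proof.
  intros H. unfold rsum, without. induction J as [|i J IH]; simpl; [easy|].
  rewrite IH. destruct (inb i J0) eqn:E; simpl; [|easy].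
  rewrite H by now apply inbP. ring.
Qed.

Lemma csum_0 (f : I -> C) J : (forall i, In i J -> f i = RtoC 0) -> csum f J = RtoC 0.
Proof.
  intros H. rewrite (csum_ext f (fun _ => 0 * 0)%C).
  - rewrite csum_scal. ring.
  - intros i Hi. rewrite H by auto. ring.
Qed.

End Lists.

(** * Unconditional sums over an arbitrary index type *)

Section Summable.
Context {I : Type}.
Implicit Types (f g : I -> C) (J : list I).

(* [is_sum f l] is convertible to [flim fin_filter (csum f) l]. *)
Definition fin_filter (P : list I -> Prop) : Prop :=
  exists J0, forall J, NoDup J -> incl J0 J -> P J.

#[local] Instance fin_filter_proper : ProperFilter fin_filter.
Proof.
  constructor.
  - intros P (J0 & H). destruct (ndup_ok J0) as [Hn Hi].
    exists (ndup J0). apply H; auto. intros i; apply Hi.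
  - constructor.
    + exists nil. easy.
    + intros P Q (J1 & H1) (J2 & H2). exists (J1 ++ J2). intros J Hn Hi.
      split; [apply H1|apply H2]; auto; intros i ?; apply Hi, in_or_app; auto.
    + intros P Q HPQ (J1 & H1). exists J1. auto.
Qed.

#[local] Instance fin_filter_filter : Filter fin_filter := filter_filter.

Lemma is_sum_ext f g l : (forall i, f i = g i) -> is_sum f l -> is_sum g l.
Proof.
  intros H Hf eps Heps. destruct (Hf eps Heps) as [J0 HJ0]. exists J0.
  intros J H1 H2. specialize (HJ0 J H1 H2).
  now rewrite <- (map_ext _ _ H).
Qed.

Lemma is_sum_unique f l1 l2 : is_sum f l1 -> is_sum f l2 -> l1 = l2.
Proof. exact (flim_unique (F := fin_filter) (csum f) l1 l2). Qed.

Lemma is_sum_plus f g l m :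
  is_sum f l -> is_sum g m -> is_sum (fun i => f i + g i)%C (l + m)%C.
Proof.
  intros H1 H2. apply (flim_ext (F := fin_filter) (fun J => csum f J + csum g J)%C).
  - intros J. symmetry. apply csum_plus.
  - now apply flim_plus.
Qed.

Lemma is_sum_scal (a : C) f l : is_sum f l -> is_sum (fun i => a * f i)%C (a * l)%C.
Proof.
  intros H. apply (flim_ext (F := fin_filter) (fun J => a * csum f J)%C).
  - intros J. symmetry. apply csum_scal.
  - now apply flim_scal.
Qed.

Lemma is_sum_0 : is_sum (fun _ : I => RtoC 0) (RtoC 0).
Proof.
  apply (flim_ext (F := fin_filter) (fun _ => RtoC 0)); [|apply flim_const].
  intros J. symmetry. now apply csum_0.
Qed.

Lemma is_sum_minus f g l m :
  is_sum f l -> is_sum g m -> is_sum (fun i => f i - g i)%C (l - m)%C.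
Proof.
  intros H1 H2. apply (is_sum_scal (- (1))%C) in H2.
  apply (is_sum_ext (fun i => f i + - (1) * g i)%C); [intros; ring|].
  replace (l - m)%C with (l + - (1) * m)%C by ring. now apply is_sum_plus.
Qed.

Lemma bsum_le f g M : (forall i, Cmod (f i) <= Cmod (g i)) -> bsum g M -> bsum f M.
Proof.
  intros H Hg J HJ. eapply Rle_trans; [|apply (Hg J HJ)].
  apply rsum_le; auto.
Qed.

Lemma bsum_ge0 f M : bsum f M -> 0 <= M.
Proof. intros H. apply (H nil). constructor. Qed.

Lemma bsum_plus f g M M' : bsum f M -> bsum g M' -> bsum (fun i => f i + g i)%C (M + M').
Proof.
  intros Hf Hg J HJ. specialize (Hf J HJ). specialize (Hg J HJ).
  eapply Rle_trans; [|apply Rplus_le_compat; [exact Hf|exact Hg]].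
  rewrite <- rsum_plus. apply rsum_le. intros; apply Cmod_triangle.
Qed.

Lemma bsum_scal a f M : bsum f M -> bsum (fun i => a * f i)%C (Cmod a * M).
Proof.
  intros Hf J HJ. specialize (Hf J HJ).
  rewrite (rsum_ext _ (fun i => Cmod a * Cmod (f i))) by (intros; apply Cmod_mult).
  rewrite rsum_scal. apply Rmult_le_compat_l; [apply Cmod_ge_0|exact Hf].
Qed.

Lemma is_sum_le f l M : is_sum f l -> bsum f M -> Cmod l <= M.
Proof.
  intros H Hb. apply le_epsilon; intros eps Heps.
  destruct (H eps Heps) as [J0 HJ0].
  destruct (ndup_ok J0) as [Hn Hi].
  specialize (HJ0 _ Hn (fun i h => proj2 (Hi i) h)).
  change (Cmod (csum f (ndup J0) - l) < eps) in HJ0.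
  replace l with (csum f (ndup J0) + - (csum f (ndup J0) - l))%C by ring.
  eapply Rle_trans; [apply Cmod_triangle|]. rewrite Cmod_opp.
  assert (h := Hb _ Hn). assert (h' := Cmod_csum_le f (ndup J0)). lra.
Qed.

Lemma bsum_tail f M : bsum f M -> forall eps, 0 < eps -> exists J0, NoDup J0 /\
  forall J, NoDup J -> (forall i, In i J -> ~ In i J0) ->
    rsum (fun i => Cmod (f i)) J <= eps.
Proof.
  intros Hb eps Heps.
  set (E := fun y => exists J, NoDup J /\ y = rsum (fun i => Cmod (f i)) J).
  destruct (completeness E) as [m [Hm1 Hm2]].
  - exists M. intros y (J & HJ & ->). auto.
  - exists 0, nil. split; [constructor|reflexivity].
  - assert (HJ0 : exists J0, NoDup J0 /\ m - eps < rsum (fun i => Cmod (f i)) J0).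
    { apply Classical_Prop.NNPP. intros Hn.
      assert (m <= m - eps); [|lra]. apply Hm2.
      intros y (J & HJ & ->). apply Rnot_lt_le. intros ?. apply Hn. now exists J. }
    destruct HJ0 as (J0 & HJ0 & Hlt). exists J0. split; [easy|].
    intros J HJ Hd.
    assert (h : rsum (fun i => Cmod (f i)) (J0 ++ J) <= m).
    { apply Hm1. eexists; split; [|reflexivity]. now apply NoDup_app_disj. }
    rewrite rsum_app in h. lra.
Qed.

Lemma csum_tail f M : bsum f M -> forall eps, 0 < eps -> exists J0, NoDup J0 /\
  forall J, NoDup J -> incl J0 J -> Cmod (csum f J - csum f J0) <= eps.
Proof.
  intros Hb eps Heps. destruct (bsum_tail f M Hb eps Heps) as (J0 & Hn0 & H0).
  exists J0. split; [easy|]. intros J Hn Hi.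
  rewrite (csum_perm _ _ _ (Permutation_without J0 J Hn0 Hn Hi)), csum_app.
  replace (csum f J0 + csum f (without J0 J) - csum f J0)%C with (csum f (without J0 J)) by ring.
  eapply Rle_trans; [apply Cmod_csum_le|]. apply H0; [now apply NoDup_filter|].
  intros i h. now apply without_In in h.
Qed.

Lemma is_sum_exists f M : bsum f M -> exists l, is_sum f l.
Proof.
  intros Hb.
  destruct (proj1 (@filterlim_locally_cauchy _ C_CompleteNormedModule fin_filter
     fin_filter_proper (csum f))) as [l Hl].
  - intros eps. destruct (csum_tail f M Hb (eps / 4)) as (J0 & Hn0 & H0).
    { destruct eps; simpl; lra. }
    exists (fun J => NoDup J /\ incl J0 J). split.
    + exists J0. auto.
    + intros u v [Hu1 Hu2] [Hv1 Hv2]. apply C_NormedModule_mixin_compat1.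
      assert (hu := H0 u Hu1 Hu2). assert (hv := H0 v Hv1 Hv2).
      change (Cmod (csum f v - csum f u) < eps).
      replace (csum f v - csum f u)%C
        with ((csum f v - csum f J0) + - (csum f u - csum f J0))%C by ring.
      eapply Rle_lt_trans; [apply Cmod_triangle|]. rewrite Cmod_opp.
      destruct eps; simpl in *; lra.
  - exists l. intros eps Heps.
    assert (Heps2 : 0 < eps / 2) by lra.
    destruct (proj1 (filterlim_locally _ _) Hl (mkposreal _ Heps2)) as (J0 & H0).
    exists J0. intros J Hn Hi. specialize (H0 J Hn Hi).
    apply ball_Cmod in H0. simpl in H0.
    change (Cmod (csum f J - l) < 2 * (eps / 2)) in H0.
    change (Cmod (csum f J - l) < eps). lra.
Qed.

Lemma is_sum_csum {K : Type} (h : K -> I -> C) (g : K -> C) (L : list K) :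
  (forall k, In k L -> is_sum (h k) (g k)) ->
  is_sum (fun i => csum (fun k => h k i) L) (csum g L).
Proof.
  induction L as [|k L IH]; intros H.
  - apply is_sum_0.
  - apply (is_sum_plus (h k) (fun i => csum (fun k => h k i) L)).
    + apply H; now left.
    + apply IH. intros; apply H; now right.
Qed.

End Summable.

Lemma csum_single {K : Type} (k0 : K) (c : C) (L : list K) : NoDup L ->
  csum (fun k => if prop_dec (k0 = k) then c else RtoC 0) L
  = if prop_dec (In k0 L) then c else RtoC 0.
Proof.
  intros HL. induction HL as [|k L Hk HL IH].
  - destruct (prop_dec (In k0 nil)) as [[]|]; reflexivity.
  - change (csum (fun k => if prop_dec (k0 = k) then c else RtoC 0) (k :: L))
      with ((if prop_dec (k0 = k) then c else RtoC 0)
            + csum (fun k => if prop_dec (k0 = k) then c else RtoC 0) L)%C.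
    rewrite IH. simpl.
    destruct (prop_dec (k0 = k)) as [->|h1], (prop_dec (In _ L)) as [h2|h2],
      (prop_dec (_ \/ _)) as [h3|h3];
      try ring; exfalso; try tauto.
    destruct h3; auto.
Qed.

(** Regrouping along the fibres of [p]. Fubini's theorem, Cauchy products, the count of tuples with
    a given total and the parity splitting are all instances. *)
Lemma is_sum_partition {I K : Type} (p : I -> K) (f : I -> C) (g : K -> C) l M :
  bsum f M -> is_sum f l ->
  (forall k, is_sum (fun i => if prop_dec (p i = k) then f i else RtoC 0) (g k)) ->
  is_sum g l /\ bsum g M.
Proof.
  intros Hb Hl Hg.
  (* The weights [u] are needed twice: constant 1 for the value of the sum, unimodular phases for
     the absolute bound. *)
  assert (HL : forall (u : K -> C) L, NoDup L ->
     is_sum (fun i => if prop_dec (In (p i) L) then u (p i) * f i else RtoC 0)%C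
            (csum (fun k => u k * g k)%C L)).
  { intros u L HL.
    eapply is_sum_ext; [|apply (is_sum_csum
       (fun k i => u k * (if prop_dec (p i = k) then f i else RtoC 0))%C);
       intros; apply is_sum_scal, Hg].
    intros i. simpl.
    rewrite <- (csum_single (p i) (u (p i) * f i)%C L HL).
    apply csum_ext. intros k _. destruct (prop_dec (p i = k)) as [<-|]; ring. }
  split.
  - intros eps Heps.
    destruct (bsum_tail f M Hb (eps / 2)) as (J0 & Hn0 & H0); [lra|].
    (* Once [L] contains the image of [J0], only indices outside [J0] contribute to the difference,
       and these form a small tail. *)
    exists (map p J0). intros L HnL HiL.
    change (Cmod (csum g L - l) < eps).
    assert (h := HL (fun _ => RtoC 1) L HnL).
    replace (csum g L) with (csum (fun k => 1 * g k)%C L)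
      by (apply csum_ext; intros; ring).
    assert (h2 := is_sum_minus _ _ _ _ h Hl).
    apply Rle_lt_trans with (eps / 2); [|lra].
    eapply is_sum_le; [exact h2|]. intros J HJ.
    rewrite (rsum_without J0).
    + eapply Rle_trans; [apply rsum_le|apply (H0 (without J0 J))].
      * intros i _. cbv beta. destruct (prop_dec _).
        -- replace (1 * f i - f i)%C with (RtoC 0) by ring. rewrite Cmod_0. apply Cmod_ge_0.
        -- replace (0 - f i)%C with (- f i)%C by ring. rewrite Cmod_opp. lra.
      * now apply NoDup_filter.
      * intros i hi. now apply without_In in hi.
    + intros i Hi. destruct (prop_dec _) as [_|n].
      * replace (1 * f i - f i)%C with (RtoC 0) by ring. apply Cmod_0.
      * elim n. apply HiL. now apply in_map.
  - intros L HnL.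
    (* The phase [u k] turns [g k] into its modulus, so the sum of moduli over [L] is itself the
       value of a sum dominated by [f]. *)
    set (u := fun k => if prop_dec (g k = 0) then RtoC 1 else (RtoC (Cmod (g k)) / g k)%C).
    assert (Hu : forall k, (u k * g k)%C = RtoC (Cmod (g k))).
    { intros k. unfold u. destruct (prop_dec _) as [e|e].
      - rewrite e, Cmod_0. ring.
      - field. exact e. }
    assert (Hu1 : forall k, Cmod (u k) <= 1).
    { intros k. unfold u. destruct (prop_dec _) as [e|e].
      - rewrite Cmod_1. lra.
      - rewrite Cmod_div by exact e. rewrite Cmod_R, Rabs_pos_eq by apply Cmod_ge_0.
        assert (0 < Cmod (g k)) by now apply Cmod_gt_0.
        apply Req_le. field. lra. }
    assert (h := HL u L HnL).
    assert (E : csum (fun k => u k * g k)%C L = RtoC (rsum (fun k => Cmod (g k)) L)).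
    { unfold csum, rsum. clear - Hu. induction L as [|k L IH]; simpl; [easy|].
      rewrite IH, Hu. now rewrite RtoC_plus. }
    rewrite E in h.
    assert (Hm : Cmod (RtoC (rsum (fun k => Cmod (g k)) L)) <= M).
    { eapply is_sum_le; [exact h|]. eapply bsum_le; [|exact Hb].
      intros i. simpl. destruct (prop_dec _).
      - rewrite Cmod_mult. assert (h1 := Hu1 (p i)). assert (h2 := Cmod_ge_0 (f i)). nra.
      - rewrite Cmod_0. apply Cmod_ge_0. }
    rewrite Cmod_R in Hm. eapply Rle_trans; [apply Rle_abs|exact Hm].
Qed.

(** Transports finite sums along an injection: a list in [I] is cut down to its part in the image of
    [sg], which is harmless for functions vanishing off that image. *)
Lemma preimage_list {A I : Type} (sg : A -> I) (J : list I) :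
  (forall a b, sg a = sg b -> a = b) -> NoDup J ->
  exists J', NoDup J' /\ (forall a, In a J' <-> In (sg a) J) /\
    (forall f : I -> C, (forall i, (forall a, sg a <> i) -> f i = RtoC 0) ->
       csum f J = csum (fun a => f (sg a)) J') /\
    (forall f : I -> R, (forall i, (forall a, sg a <> i) -> f i = 0) ->
       rsum f J = rsum (fun a => f (sg a)) J').
Proof.
  intros Hinj HJ. induction HJ as [|i J Hi HJ (J' & Hn & Ha & Hf & Hr)].
  - exists nil. repeat split; try easy; constructor.
  - destruct (prop_dec (exists a, sg a = i)) as [[a <-]|h].
    + exists (a :: J'). repeat split.
      * constructor; auto. rewrite Ha. exact Hi.
      * intros [->|h]; [now left|right; now apply Ha].
      * intros [h|h]; [left; now apply Hinj|right; now apply Ha].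
      * intros f H0. unfold csum in *. simpl. now rewrite Hf.
      * intros f H0. unfold rsum in *. simpl. now rewrite Hr.
    + exists J'. repeat split; auto.
      * intros ?. right. now apply Ha.
      * intros [e|?]; [exfalso; apply h; now exists a|now apply Ha].
      * intros f H0. unfold csum in *. simpl. rewrite Hf by auto.
        rewrite H0; [ring|]. intros a e. apply h. now exists a.
      * intros f H0. unfold rsum in *. simpl. rewrite Hr by auto.
        rewrite H0; [ring|]. intros a e. apply h. now exists a.
Qed.

Lemma is_sum_image {A I : Type} (sg : A -> I) (f : I -> C) l :
  (forall a b, sg a = sg b -> a = b) -> (forall i, (forall a, sg a <> i) -> f i = RtoC 0) ->
  is_sum (fun a => f (sg a)) l -> is_sum f l.
Proof.
  intros Hinj Hz H eps Heps. destruct (H eps Heps) as [J0 HJ0].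
  exists (map sg J0). intros J HJ Hi.
  destruct (preimage_list sg J Hinj HJ) as (J' & Hn & Ha & Hf & _).
  change (Cmod (csum f J - l) < eps). rewrite (Hf f Hz).
  apply HJ0; auto. intros a Haa. apply Ha, Hi. now apply in_map.
Qed.

Lemma bsum_comp {A I : Type} (sg : A -> I) (f : I -> C) M :
  (forall a b, sg a = sg b -> a = b) -> bsum f M -> bsum (fun a => f (sg a)) M.
Proof.
  intros Hinj H J HJ.
  replace (rsum (fun a => Cmod (f (sg a))) J) with (rsum (fun i => Cmod (f i)) (map sg J)).
  - apply H. apply FinFun.Injective_map_NoDup; auto.
  - unfold rsum. now rewrite map_map.
Qed.

(** The form of [is_sum_partition] in which the fibre over [k] is parametrised by [sg k], as happens
    for products. *)
Lemma is_sum_fibre {I K A : Type} (p : I -> K) (sg : K -> A -> I) (f : I -> C) (g : K -> C) l M :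
  (forall k a b, sg k a = sg k b -> a = b) ->
  (forall k a, p (sg k a) = k) -> (forall i, exists a, sg (p i) a = i) ->
  bsum f M -> is_sum f l ->
  (forall k, is_sum (fun a => f (sg k a)) (g k)) ->
  is_sum g l /\ bsum g M.
Proof.
  intros Hi Hp Hs Hb Hl Hg. apply (is_sum_partition p f g l M Hb Hl).
  intros k. apply (is_sum_image (sg k)); [apply Hi| |].
  - intros i h. destruct (prop_dec _) as [<-|]; auto.
    destruct (Hs i) as [a e]. now elim (h a).
  - eapply is_sum_ext; [|apply (Hg k)]. intros a. simpl.
    destruct (prop_dec _) as [|n]; auto. now elim n.
Qed.

(** Tonelli's bound. The induction runs over the list of first coordinates and splits off one row at
    a time. *)
Lemma bsum_prod {A B : Type} (f : A * B -> C) (m : A -> R) M :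
  (forall a, bsum (fun b => f (a, b)) (m a)) ->
  (forall L, NoDup L -> rsum m L <= M) -> bsum f M.
Proof.
  intros Hf Hm J HJ.
  assert (H : forall L, NoDup L -> forall J, NoDup J -> (forall q, In q J -> In (fst q) L) ->
     rsum (fun q => Cmod (f q)) J <= rsum m L).
  { clear J HJ. induction L as [|a L IH]; intros HL J HJ Hin.
    - destruct J as [|q J]; [apply Rle_refl|]. elim (Hin q). now left.
    - inversion HL as [|? ? Ha HL']; subst.
      rewrite (rsum_split (fun q => if prop_dec (fst q = a) then true else false)).
      change (rsum m (a :: L)) with (m a + rsum m L). apply Rplus_le_compat.
      + assert (HJ1 : NoDup (filter (fun q => if prop_dec (fst q = a) then true else false) J))
          by now apply NoDup_filter.
        destruct (preimage_list (fun b : B => (a, b)) _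
          (fun b b' e => f_equal snd e) HJ1) as (J' & Hn & Ha' & _ & Hr).
        rewrite (rsum_ext _ (fun q => if prop_dec (fst q = a) then Cmod (f q) else 0)).
        * rewrite Hr.
          -- rewrite (rsum_ext _ (fun b => Cmod (f (a, b)))); [now apply Hf|].
             intros b _. simpl. destruct (prop_dec _); auto. contradiction.
          -- intros [a' b] h. destruct (prop_dec _) as [e|]; auto. simpl in e. subst a'.
             now elim (h b).
        * intros q Hq. apply filter_In in Hq. destruct Hq as [_ Hq].
          destruct (prop_dec _); auto. discriminate.
      + apply IH; auto.
        * now apply NoDup_filter.
        * intros q Hq. apply filter_In in Hq. destruct Hq as [Hq Hq'].
          destruct (Hin q Hq) as [e|]; auto.
          destruct (prop_dec _); [discriminate|]. congruence. }
  destruct (ndup_ok (map fst J)) as [Hn Hi].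
  eapply Rle_trans; [|apply (Hm _ Hn)]. apply H; auto.
  intros q Hq. apply Hi. now apply in_map.
Qed.

Lemma is_sum_prod {A B : Type} (f : A * B -> C) (g : A -> C) l M :
  bsum f M -> is_sum f l -> (forall a, is_sum (fun b => f (a, b)) (g a)) ->
  is_sum g l /\ bsum g M.
Proof.
  intros Hb Hl Hg. apply (is_sum_fibre fst (fun a b => (a, b)) f g l M); auto.
  - intros k a b e. congruence.
  - intros [a b]. now exists b.
Qed.

(** Both iterated sums equal the sum over pairs. *)
Lemma is_sum_swap {A B : Type} (f : A * B -> C) (g : A -> C) (h : B -> C) M l :
  bsum f M -> (forall a, is_sum (fun b => f (a, b)) (g a)) ->
  (forall b, is_sum (fun a => f (a, b)) (h b)) ->
  is_sum g l -> is_sum h l /\ bsum h M.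
Proof.
  intros Hb Hg Hh Hl. destruct (is_sum_exists f M Hb) as [l' Hl'].
  destruct (is_sum_prod f g l' M Hb Hl' Hg) as [h1 _].
  rewrite (is_sum_unique _ _ _ Hl h1).
  apply (is_sum_fibre snd (fun b a => (a, b)) f h l' M); auto.
  - intros k a b e. congruence.
  - intros [a b]. now exists a.
Qed.

Lemma is_sum_mult {A B : Type} (f : A -> C) (g : B -> C) l m M M' :
  bsum f M -> bsum g M' -> is_sum f l -> is_sum g m ->
  is_sum (fun q => f (fst q) * g (snd q))%C (l * m)%C /\
  bsum (fun q => f (fst q) * g (snd q))%C (M * M').
Proof.
  intros Hf Hg Hl Hm.
  assert (Hb : bsum (fun q => f (fst q) * g (snd q))%C (M * M')).
  { apply (bsum_prod _ (fun a => Cmod (f a) * M')).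
    - intros a. exact (bsum_scal (f a) g M' Hg).
    - intros L HL. rewrite (rsum_ext _ (fun a => M' * Cmod (f a))) by (intros; ring).
      rewrite rsum_scal, Rmult_comm. apply Rmult_le_compat_r; auto.
      eapply bsum_ge0; eauto. }
  split; auto.
  destruct (is_sum_exists _ _ Hb) as [k Hk].
  destruct (is_sum_prod _ (fun a => m * f a)%C k _ Hb Hk) as [h _].
  - intros a. simpl. replace (m * f a)%C with (f a * m)%C by ring. now apply is_sum_scal.
  - assert (h' := is_sum_scal m _ _ Hl). rewrite Cmult_comm.
    now rewrite (is_sum_unique _ _ _ h' h).
Qed.

(** * Sequences and sums over the natural numbers *)

Definition clim : (nat -> C) -> C -> Prop := flim eventually.

Definition clim_unique u l l' : clim u l -> clim u l' -> l = l' := flim_unique u l l'.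

Definition clim_plus u v l m : clim u l -> clim v m -> clim (fun n => u n + v n)%C (l + m)%C :=
  flim_plus u v l m.

Definition clim_scal a u l : clim u l -> clim (fun n => a * u n)%C (a * l)%C := flim_scal a u l.

Definition clim_const l : clim (fun _ => l) l := flim_const l.

Definition clim_ext u v l : (forall n, u n = v n) -> clim u l -> clim v l := flim_ext u v l.

Lemma clim_csum {I : Type} (f : I -> nat -> C) (l : I -> C) (L : list I) :
  (forall i, In i L -> clim (f i) (l i)) ->
  clim (fun n => csum (fun i => f i n) L) (csum l L).
Proof.
  induction L as [|i L IH]; intros H.
  - apply (clim_const (RtoC 0)).
  - apply (clim_plus (f i) (fun n => csum (fun i => f i n) L)); [apply H; now left|].
    apply IH. intros; apply H; now right.
Qed.

Lemma sum_n_csum (f : nat -> C) n : sum_n f n = csum f (seq 0 (S n)).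
Proof.
  induction n as [|n IH].
  - rewrite sum_O. unfold csum; simpl. change (f O = f O + 0)%C. ring.
  - rewrite sum_Sn, IH. rewrite (seq_S (S n)), csum_app. unfold csum at 3. simpl.
    change (csum f (seq 0 (S n)) + f (S n) = csum f (seq 0 (S n)) + (f (S n) + 0))%C. ring.
Qed.

Lemma incl_seq_max J : incl J (seq 0 (S (list_max J))).
Proof.
  intros i Hi. apply in_seq. split; [lia|].
  assert (h := proj1 (list_max_le J (list_max J)) (le_n _)).
  rewrite Forall_forall in h. specialize (h i Hi). lia.
Qed.

Lemma is_sum_nat (f : nat -> C) l : is_sum f l -> clim (fun n => csum f (seq 0 n)) l.
Proof.
  intros H eps Heps. destruct (H eps Heps) as [J0 HJ0].
  exists (S (list_max J0)). intros n Hn. apply HJ0; [apply seq_NoDup|].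
  intros i Hi. apply incl_seq_max in Hi. rewrite in_seq in *. lia.
Qed.

Lemma rsum_nat_bound (f : nat -> R) M : (forall k, 0 <= f k) ->
  (forall n, rsum f (seq 0 n) <= M) -> forall L, NoDup L -> rsum f L <= M.
Proof.
  intros H0 H L HL. eapply Rle_trans; [|apply (H (S (list_max L)))].
  apply rsum_incl; auto. apply incl_seq_max.
Qed.

Lemma bsum_nat (f : nat -> C) M :
  (forall n, rsum (fun i => Cmod (f i)) (seq 0 n) <= M) -> bsum f M.
Proof. intros H J. apply rsum_nat_bound; auto. intros; apply Cmod_ge_0. Qed.

Lemma is_sum_nat_bsum (f : nat -> C) l M : bsum f M ->
  clim (fun n => csum f (seq 0 n)) l -> is_sum f l.
Proof.
  intros Hb H. destruct (is_sum_exists f M Hb) as [l' Hl'].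
  now rewrite (clim_unique _ _ _ H (is_sum_nat f l' Hl')).
Qed.

Lemma is_sum_shift (f : nat -> C) l : is_sum f l -> is_sum (fun m => f (S m)) (l - f O)%C.
Proof.
  intros H eps Heps. destruct (H eps Heps) as [J0 HJ0].
  exists (map pred J0). intros J HJ Hi.
  specialize (HJ0 (O :: map S J)).
  assert (E : fold_right Cplus (RtoC 0) (map f (O :: map S J))
    = (f O + csum (fun m => f (S m)) J)%C).
  { simpl. rewrite map_map. reflexivity. }
  rewrite E in HJ0.
  change (Cmod (csum (fun m => f (S m)) J - (l - f O))%C < eps).
  replace (csum (fun m => f (S m)) J - (l - f O))%C
    with (f O + csum (fun m => f (S m)) J - l)%C by ring.
  apply HJ0.
  - constructor.
    + intros h. apply in_map_iff in h. destruct h as (a & e & _). discriminate.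
    + apply FinFun.Injective_map_NoDup; auto. intros a b e. congruence.
  - intros [|i] Hi0; [now left|]. right. apply in_map, Hi.
    now apply (in_map pred J0 (S i)).
Qed.

Lemma is_sum_series (f : nat -> C) l : is_sum f l ->
  @is_series C_AbsRing C_NormedModule f l.
Proof.
  intros H. apply filterlim_locally. intros eps.
  destruct (is_sum_nat f l H eps (cond_pos eps)) as [N HN].
  exists N. intros n Hn. apply C_NormedModule_mixin_compat1.
  change (Cmod (sum_n f n - l) < eps).
  replace (sum_n f n) with (csum f (seq 0 (S n))) by (symmetry; apply sum_n_csum).
  apply HN. lia.
Qed.

Lemma is_series_clim (f : nat -> C) l : @is_series C_AbsRing C_NormedModule f l ->
  clim (fun n => csum f (seq 0 n)) l.
Proof.
  intros H eps Heps. assert (Heps2 : 0 < eps / 2) by lra.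
  destruct (proj1 (filterlim_locally _ _) H (mkposreal _ Heps2)) as (N & HN).
  exists (S N). intros [|n] Hn; [lia|]. specialize (HN n ltac:(lia)).
  apply ball_Cmod in HN. rewrite <- sum_n_csum. simpl in HN.
  change (Cmod (sum_n f n - l) < 2 * (eps / 2)) in HN. change (Cmod (sum_n f n - l) < eps). lra.
Qed.

Lemma is_sum_finite {I : Type} (f : I -> C) (L : list I) : NoDup L ->
  (forall i, ~ In i L -> f i = RtoC 0) -> is_sum f (csum f L).
Proof.
  intros HL H0 eps Heps. exists L. intros J HJ Hi.
  change (Cmod (csum f J - csum f L) < eps).
  rewrite (csum_perm _ _ _ (Permutation_without L J HL HJ Hi)), csum_app, (csum_0 f (without L J)).
  - replace (csum f L + 0 - csum f L)%C with (RtoC 0) by ring. now rewrite Cmod_0.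
  - intros i h. apply H0. now apply without_In in h.
Qed.

Lemma is_sum_single {I : Type} (f : I -> C) (k : I) :
  (forall i, i <> k -> f i = RtoC 0) -> is_sum f (f k).
Proof.
  intros H. replace (f k) with (csum f (k :: nil)) by (unfold csum; simpl; ring).
  apply is_sum_finite; [constructor; [easy|constructor]|].
  intros i Hi. apply H. intros ->. apply Hi. now left.
Qed.

Lemma bsum_finite {I : Type} (f : I -> C) (L : list I) : NoDup L ->
  (forall i, ~ In i L -> f i = RtoC 0) -> bsum f (rsum (fun i => Cmod (f i)) L).
Proof.
  intros HL H0 J HJ.
  rewrite (rsum_without (without L J) J).
  - apply rsum_incl; [intros; apply Cmod_ge_0|now apply NoDup_filter|].
    intros i h. apply without_In in h. rewrite without_In in h.
    destruct (prop_dec (In i L)); tauto.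
  - intros i h. apply without_In in h. rewrite H0 by easy. apply Cmod_0.
Qed.

Lemma Cpow_0 (z : C) : (z ^ 0)%C = RtoC 1.
Proof. reflexivity. Qed.

Lemma C0_pow n : (RtoC 0 ^ S n)%C = RtoC 0.
Proof. rewrite Cpow_S. ring. Qed.

Lemma Cmod_RtoC_pow r n : 0 <= r -> Cmod (RtoC r ^ n) = r ^ n.
Proof. intros. rewrite Cmod_pow, Cmod_R, Rabs_pos_eq; auto. Qed.

(** * Absolutely convergent power series *)

(** Absolute summability is required on the boundary circle itself, with bound [M]. Sums, products
    and interchanges then keep the same radius, and [M] also bounds the function on the closed
    disc. *)
Definition pser (a : C) (r : R) (c : nat -> C) (M : R) (f : C -> C) : Prop :=
  bsum (fun k => c k * RtoC r ^ k)%C M /\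
  forall s, Cmod (s - a) <= r -> is_sum (fun k => c k * (s - a) ^ k)%C (f s).

Lemma pow_le' x y n : 0 <= x <= y -> x ^ n <= y ^ n.
Proof. intros. now apply pow_incr. Qed.

Lemma pser_bsum a r c M f s : pser a r c M f -> Cmod (s - a) <= r ->
  bsum (fun k => c k * (s - a) ^ k)%C M.
Proof.
  intros [Hb _] Hs. assert (h := Cmod_ge_0 (s - a)). eapply bsum_le; [|exact Hb].
  intros k. rewrite !Cmod_mult, Cmod_RtoC_pow, Cmod_pow by lra.
  apply Rmult_le_compat_l; [apply Cmod_ge_0|]. now apply pow_le'.
Qed.

Lemma pser_mono a r r' c M f : 0 <= r' <= r -> pser a r c M f -> pser a r' c M f.
Proof.
  intros Hr [Hb H]. split.
  - eapply bsum_le; [|exact Hb]. intros k.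
    rewrite !Cmod_mult, !Cmod_RtoC_pow by lra.
    apply Rmult_le_compat_l; [apply Cmod_ge_0|]. now apply pow_le'.
  - intros s Hs. apply H. lra.
Qed.

Lemma pser_ext a r c M f g : (forall s, Cmod (s - a) <= r -> f s = g s) ->
  pser a r c M f -> pser a r c M g.
Proof. intros He [Hb H]. split; auto. intros s Hs. rewrite <- He; auto. Qed.

Lemma pser_plus a r c c' M M' f g : pser a r c M f -> pser a r c' M' g ->
  pser a r (fun k => c k + c' k)%C (M + M') (fun s => f s + g s)%C.
Proof.
  intros [Hb H] [Hb' H']. split.
  - eapply bsum_le; [|exact (bsum_plus _ _ _ _ Hb Hb')].
    intros k. apply Req_le. f_equal. ring.
  - intros s Hs. eapply is_sum_ext; [|exact (is_sum_plus _ _ _ _ (H s Hs) (H' s Hs))].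
    intros k. simpl. ring.
Qed.

Lemma pser_finite a r (c : nat -> C) n : (forall k, (n <= k)%nat -> c k = RtoC 0) ->
  pser a r c (rsum (fun k => Cmod (c k * RtoC r ^ k)) (seq 0 n))
    (fun s => csum (fun k => c k * (s - a) ^ k)%C (seq 0 n)).
Proof.
  intros H. split.
  - apply (bsum_finite (fun k => c k * RtoC r ^ k)%C); [apply seq_NoDup|].
    intros k Hk. rewrite H; [ring|]. rewrite in_seq in Hk. lia.
  - intros s _. apply (is_sum_finite (fun k => c k * (s - a) ^ k)%C); [apply seq_NoDup|].
    intros k Hk. rewrite H; [ring|]. rewrite in_seq in Hk. lia.
Qed.

(** The Cauchy product: the family on pairs of exponents is regrouped by their sum. *)
Lemma pser_mult a r c c' M M' f g : 0 <= r -> pser a r c M f -> pser a r c' M' g ->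
  pser a r (fun k => csum (fun i => c i * c' (k - i)%nat)%C (seq 0 (S k)))
    (M * M') (fun s => f s * g s)%C.
Proof.
  intros Hr Hf Hg.
  set (d := fun k => csum (fun i => c i * c' (k - i)%nat)%C (seq 0 (S k))).
  assert (H : forall s, Cmod (s - a) <= r ->
    is_sum (fun k => d k * (s - a) ^ k)%C (f s * g s)%C /\
    bsum (fun k => d k * (s - a) ^ k)%C (M * M')).
  { intros s Hs.
    destruct (is_sum_mult _ _ _ _ _ _ (pser_bsum _ _ _ _ _ _ Hf Hs)
       (pser_bsum _ _ _ _ _ _ Hg Hs) (proj2 Hf s Hs) (proj2 Hg s Hs)) as [h1 h2].
    apply (is_sum_partition (fun q => (fst q + snd q)%nat) _ _ _ _ h2 h1).
    intros k. simpl.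
    set (F := fun q : nat * nat => if prop_dec ((fst q + snd q)%nat = k)
       then (c (fst q) * (s - a) ^ fst q * (c' (snd q) * (s - a) ^ snd q))%C else RtoC 0).
    set (L := map (fun i => (i, (k - i)%nat)) (seq 0 (S k))).
    replace (d k * (s - a) ^ k)%C with (csum F L).
    - apply (is_sum_finite F).
      + apply FinFun.Injective_map_NoDup; [|apply seq_NoDup]. intros i j e. congruence.
      + intros [i j] Hij. unfold F. destruct (prop_dec _) as [e|]; auto. elim Hij.
        simpl in e. apply in_map_iff. exists i. split; [f_equal; lia|]. apply in_seq. lia.
    - unfold L, d. rewrite Cmult_comm, <- csum_scal. unfold csum at 1. rewrite map_map.
      apply csum_ext. intros i Hi. apply in_seq in Hi. unfold F. simpl.
      destruct (prop_dec _) as [_|n]; [|elim n; simpl; lia].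
      replace ((s - a) ^ k)%C with ((s - a) ^ i * (s - a) ^ (k - i))%C; [ring|].
      rewrite <- Cpow_add_r. f_equal. lia. }
  split.
  (* At [s = a + r] the bound on the regrouped family is the bound on the product coefficients. *)
  - destruct (H (a + RtoC r)%C) as [_ h].
    + replace (a + r - a)%C with (RtoC r) by ring. rewrite Cmod_R, Rabs_pos_eq; lra.
    + replace (a + r - a)%C with (RtoC r) in h by ring. exact h.
  - intros s Hs. now apply H.
Qed.

Lemma csum_geom (z : C) n : z <> RtoC 1 ->
  csum (fun j => z ^ j)%C (seq 0 n) = ((1 - z ^ n) / (1 - z))%C.
Proof.
  intros Hz.
  assert (Hn1 : (1 - z)%C <> RtoC 0).
  { intros e. apply Hz. symmetry. now apply Ceq_minus. }
  induction n as [|n IH]; [unfold csum; simpl; field; auto|].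
  rewrite seq_S, csum_app, IH. unfold csum; simpl. field. auto.
Qed.

Lemma is_sum_geom (z : C) : Cmod z < 1 ->
  is_sum (fun k => z ^ k)%C (/ (1 - z))%C /\ bsum (fun k => z ^ k)%C (/ (1 - Cmod z)).
Proof.
  intros Hz. assert (H0 := Cmod_ge_0 z).
  assert (Hr : forall n, rsum (fun k => Cmod (z ^ k)) (seq 0 n) * (1 - Cmod z) = 1 - Cmod z ^ n).
  { induction n as [|n IH]; [unfold rsum; simpl; ring|].
    rewrite seq_S, rsum_app, Rmult_plus_distr_r, IH. unfold rsum; simpl.
    rewrite Cmod_pow. ring. }
  assert (Hz1 : z <> RtoC 1) by (intros ->; rewrite Cmod_1 in Hz; lra).
  assert (Hn1 : (1 - z)%C <> RtoC 0).
  { intros e. apply Hz1. symmetry. now apply Ceq_minus. }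
  assert (Hb : bsum (fun k => z ^ k)%C (/ (1 - Cmod z))).
  { apply bsum_nat. intros n. apply Rmult_le_reg_r with (1 - Cmod z); [lra|].
    rewrite Hr. rewrite Rinv_l by lra. assert (0 <= Cmod z ^ n) by now apply pow_le. lra. }
  split; auto. eapply is_sum_nat_bsum; [exact Hb|].
  intros eps Heps.
  assert (Hm : 0 < Cmod (1 - z)) by now apply Cmod_gt_0.
  destruct (pow_lt_1_zero (Cmod z)) with (y := eps * Cmod (1 - z)) as [N HN].
  - rewrite Rabs_pos_eq; auto.
  - now apply Rmult_lt_0_compat.
  - exists N. intros n Hn. specialize (HN n Hn). rewrite csum_geom by auto.
    replace ((1 - z ^ n) / (1 - z) - / (1 - z))%C with (- (z ^ n / (1 - z)))%C by (field; auto).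
    rewrite Cmod_opp, Cmod_div, Cmod_pow by auto.
    rewrite Rabs_pos_eq in HN by now apply pow_le.
    apply Rmult_lt_reg_r with (Cmod (1 - z)); auto.
    replace (Cmod z ^ n / Cmod (1 - z) * Cmod (1 - z)) with (Cmod z ^ n) by (field; lra). exact HN.
Qed.

(** Geometric series of ratio [(s - a) / (p - a)]. *)
Lemma pser_inv a p r : 0 <= r < Cmod (p - a) ->
  exists M, pser a r (fun k => - / (p - a) * (/ (p - a)) ^ k)%C M (fun s => / (s - p))%C.
Proof.
  intros Hr. assert (Hd : (p - a)%C <> RtoC 0) by (apply Cmod_gt_0; lra).
  exists (Cmod (- / (p - a)) * / (1 - r / Cmod (p - a))).
  assert (Hq : Cmod (RtoC r / (p - a)) = r / Cmod (p - a)).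
  { rewrite Cmod_div by auto. rewrite Cmod_R, Rabs_pos_eq; lra. }
  assert (Hlt : forall t, t <= r -> t / Cmod (p - a) < 1).
  { intros t Ht. apply Rmult_lt_reg_r with (Cmod (p - a)); [lra|].
    unfold Rdiv. rewrite Rmult_assoc, Rinv_l by lra. lra. }
  split.
  - destruct (is_sum_geom (RtoC r / (p - a))) as [_ h]; [rewrite Hq; apply Hlt; lra|].
    rewrite Hq in h. apply (bsum_scal (- / (p - a))%C) in h.
    eapply bsum_le; [|exact h]. intros k. apply Req_le. f_equal.
    unfold Cdiv. rewrite Cpow_mult_l. ring.
  - intros s Hs.
    destruct (is_sum_geom ((s - a) / (p - a))) as [h _].
    { rewrite Cmod_div by auto. now apply Hlt. }
    apply (is_sum_scal (- / (p - a))%C) in h.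
    assert (Hsp : (s - p)%C <> RtoC 0).
    { intros e. assert (s = p) by (replace s with (s - p + p)%C by ring; rewrite e; ring).
      subst s. lra. }
    replace (/ (s - p))%C with (- / (p - a) * / (1 - (s - a) / (p - a)))%C.
    + eapply is_sum_ext; [|exact h]. intros k. simpl.
      unfold Cdiv. rewrite Cpow_mult_l. ring.
    + assert (Hsp' : (p - a - (s - a))%C <> RtoC 0).
      { replace (p - a - (s - a))%C with (- (s - p))%C by ring.
        intros e. apply Hsp. replace (s - p)%C with (- - (s - p))%C by ring. rewrite e. ring. }
      field. repeat split; auto.
Qed.

Lemma pser_shift a r c M f j : pser (a - j)%C r c M f -> pser a r c M (fun s => f (s - j)%C).
Proof.
  intros [Hb H]. split; auto. intros s Hs.
  replace (s - a)%C with (s - j - (a - j))%C in * by ring. now apply H.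
Qed.

(** The bounds [m n] make the family over pairs [(n, k)] absolutely summable. Evaluated at
    [s = a + r], its columns give the coefficients of the sum after division by [r ^ k]; the rest is
    an exchange of the two summations. *)
Lemma weierstrass_double_series a r (c : nat -> nat -> C) (m : nat -> R) (f : nat -> C -> C)
  (F : C -> C) M :
  0 < r -> (forall n, pser a r (c n) (m n) (f n)) ->
  (forall L, NoDup L -> rsum m L <= M) ->
  (forall s, Cmod (s - a) <= r -> is_sum (fun n => f n s) (F s)) ->
  exists c', pser a r c' M F /\ forall k, is_sum (fun n => c n k) (c' k).
Proof.
  intros Hr Hf Hm HF.
  assert (Hb : forall s, Cmod (s - a) <= r ->
    bsum (fun q : nat * nat => c (fst q) (snd q) * (s - a) ^ snd q)%C M).
  { intros s Hs. apply (bsum_prod _ m); auto. intros n.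
    exact (pser_bsum _ _ _ _ _ s (Hf n) Hs). }
  assert (Har : Cmod (a + r - a) <= r).
  { replace (a + r - a)%C with (RtoC r) by ring. rewrite Cmod_R, Rabs_pos_eq; lra. }
  assert (Hc : forall k, exists l, is_sum (fun n => c n k) l).
  { intros k.
    assert (h := bsum_comp (fun n : nat => (n, k)) _ _
      (fun x y (e : (x, k) = (y, k)) => f_equal fst e) (Hb _ Har)). simpl in h.
    destruct (is_sum_exists _ _ h) as [l Hl]. exists (/ (a + r - a) ^ k * l)%C.
    eapply is_sum_ext; [|exact (is_sum_scal _ _ _ Hl)].
    intros n. simpl. field. apply Cpow_nz.
    replace (a + r - a)%C with (RtoC r) by ring.
    intros e. apply RtoC_inj in e. lra. }
  set (c' := fun k => proj1_sig (constructive_indefinite_description _ (Hc k))).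
  assert (Hc' : forall k, is_sum (fun n => c n k) (c' k)).
  { intros k. unfold c'. now destruct constructive_indefinite_description. }
  exists c'. split; auto.
  assert (H : forall s, Cmod (s - a) <= r ->
    is_sum (fun k => c' k * (s - a) ^ k)%C (F s) /\ bsum (fun k => c' k * (s - a) ^ k)%C M).
  { intros s Hs. apply (is_sum_swap _ (fun n => f n s) _ M (F s) (Hb s Hs)); auto.
    - intros n. simpl. now apply (Hf n).
    - intros k. simpl. replace (c' k * (s - a) ^ k)%C with ((s - a) ^ k * c' k)%C by ring.
      eapply is_sum_ext; [|exact (is_sum_scal ((s - a) ^ k)%C _ _ (Hc' k))].
      intros n. simpl. ring. }
  split.
  - destruct (H _ Har) as [_ h]. replace (a + r - a)%C with (RtoC r) in h by ring. exact h.
  - intros s Hs. now apply H.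
Qed.

(** * Complex derivatives *)

(** Without a quotient, the condition also makes sense at [s = a], and sums and limits of
    derivatives need no punctured neighbourhoods. *)
Definition has_deriv (f : C -> C) (a d : C) : Prop :=
  forall eps, 0 < eps -> exists delta, 0 < delta /\
    forall s, Cmod (s - a) < delta -> Cmod (f s - f a - d * (s - a)) <= eps * Cmod (s - a).

Lemma pser_at a r c M f : 0 <= r -> pser a r c M f -> f a = c O.
Proof.
  intros Hr [_ H]. specialize (H a). replace (a - a)%C with (RtoC 0) in H by ring.
  rewrite Cmod_0 in H. specialize (H Hr). eapply is_sum_unique; [exact H|].
  replace (c O) with (c O * RtoC 0 ^ 0)%C by (simpl; ring).
  apply (is_sum_single (fun k => c k * RtoC 0 ^ k)%C O).
  intros [|k] Hk; [easy|]. rewrite C0_pow. ring.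
Qed.

(** With [q = Cmod (s - a) / r <= 1], a term of index [k >= 2] is at most [q ^ 2] times its size on
    the boundary circle. *)
Lemma pser_remainder a r c M f s : 0 < r -> pser a r c M f -> Cmod (s - a) <= r ->
  Cmod (f s - f a - c 1%nat * (s - a)) <= M * (Cmod (s - a) / r) ^ 2.
Proof.
  intros Hr Hf Hs. rewrite (pser_at a r c M f) by (auto; lra).
  destruct Hf as [Hb H]. specialize (H s Hs).
  set (h := fun k => match k with 0%nat | 1%nat => (c k * (s - a) ^ k)%C | _ => RtoC 0 end).
  assert (Hh : is_sum h (csum h (seq 0 2))).
  { apply is_sum_finite; [apply seq_NoDup|]. intros [|[|k]] Hk; auto; elim Hk; simpl; auto. }
  assert (H2 := is_sum_minus _ _ _ _ H Hh).
  replace (f s - c 0%nat - c 1%nat * (s - a))%C with (f s - csum h (seq 0 2))%C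
    by (unfold csum, h; simpl; ring).
  eapply is_sum_le; [exact H2|].
  set (q := Cmod (s - a) / r).
  assert (Hq : 0 <= q <= 1).
  { assert (h1 := Cmod_ge_0 (s - a)). unfold q. split.
    - apply Rmult_le_pos; auto. left. now apply Rinv_0_lt_compat.
    - apply Rmult_le_reg_r with r; auto. unfold Rdiv. rewrite Rmult_assoc, Rinv_l; lra. }
  assert (Hb2 := bsum_scal (RtoC (q ^ 2)) _ _ Hb).
  rewrite Cmod_R, Rabs_pos_eq in Hb2 by (apply pow_le; lra). rewrite Rmult_comm.
  eapply bsum_le; [|exact Hb2]. intros k. simpl.
  rewrite !Cmod_mult, Cmod_RtoC_pow, Cmod_R by lra.
  assert (hq2 : 0 <= q * (q * 1)) by nra. rewrite Rabs_pos_eq by auto.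
  assert (hck := Cmod_ge_0 (c k)). assert (hrk : 0 <= r ^ k) by (apply pow_le; lra).
  destruct k as [|[|k]].
  - unfold h. replace (c 0%nat * (s - a) ^ 0 - c 0%nat * (s - a) ^ 0)%C with (RtoC 0) by ring.
    rewrite Cmod_0. apply Rmult_le_pos; auto. now apply Rmult_le_pos.
  - unfold h. replace (c 1%nat * (s - a) ^ 1 - c 1%nat * (s - a) ^ 1)%C with (RtoC 0) by ring.
    rewrite Cmod_0. apply Rmult_le_pos; auto. now apply Rmult_le_pos.
  - unfold h. replace (c (S (S k)) * (s - a) ^ S (S k) - 0)%C
      with (c (S (S k)) * (s - a) ^ S (S k))%C by ring.
    rewrite Cmod_mult, Cmod_pow.
    replace (Cmod (s - a)) with (q * r) by (unfold q; field; lra).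
    rewrite Rpow_mult_distr. simpl.
    assert (0 <= q ^ k <= 1).
    { split; [apply pow_le; lra|]. rewrite <- (pow1 k). apply pow_incr. lra. }
    assert (0 <= r * (r * r ^ k)) by (simpl in hrk; lra).
    replace (Cmod (c (S (S k))) * (q * (q * q ^ k) * (r * (r * r ^ k))))
      with (q * (q * 1) * (Cmod (c (S (S k))) * (r * (r * r ^ k))) * q ^ k) by ring.
    rewrite <- (Rmult_1_r (q * (q * 1) * _)) at 2.
    apply Rmult_le_compat_l; [|lra]. apply Rmult_le_pos; auto. now apply Rmult_le_pos.
Qed.

Lemma pser_has_deriv a r c M f : 0 < r -> pser a r c M f -> has_deriv f a (c 1%nat).
Proof.
  intros Hr Hf eps Heps.
  assert (HM : 0 <= M) by (eapply bsum_ge0; apply Hf).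
  assert (Hr2 : 0 < r ^ 2) by now apply pow_lt.
  (* The remainder is at most [M / r ^ 2] times the squared distance; [M + 1] keeps the quotient
     defined when [M = 0]. *)
  exists (Rmin r (eps * r ^ 2 / (M + 1))). split.
  - apply Rmin_case; auto. apply Rdiv_lt_0_compat; [|lra]. now apply Rmult_lt_0_compat.
  - intros s Hs. pose_rmin r (eps * r ^ 2 / (M + 1)).
    eapply Rle_trans; [eapply (pser_remainder a r c M f s); auto; lra|].
    set (y := Cmod (s - a)) in *. assert (0 <= y) by apply Cmod_ge_0.
    replace (M * (y / r) ^ 2) with (M * y / r ^ 2 * y) by (field; lra).
    apply Rmult_le_compat_r; auto.
    apply Rmult_le_reg_r with (r ^ 2); auto.
    replace (M * y / r ^ 2 * r ^ 2) with (M * y) by (field; lra).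
    assert (y * (M + 1) < eps * r ^ 2).
    { replace (eps * r ^ 2) with (eps * r ^ 2 / (M + 1) * (M + 1)) by (field; lra).
      apply Rmult_lt_compat_r; lra. }
    nra.
Qed.

Lemma has_deriv_unique f a d d' : has_deriv f a d -> has_deriv f a d' -> d = d'.
Proof.
  intros H H'. apply Ceq_eps; intros eps Heps.
  destruct (H (eps / 2)) as (e1 & He1 & H1); [lra|].
  destruct (H' (eps / 2)) as (e2 & He2 & H2); [lra|].
  set (t := Rmin e1 e2 / 2).
  assert (Ht : 0 < t < e1 /\ t < e2).
  { unfold t. pose_rmin e1 e2.
    assert (0 < Rmin e1 e2) by (apply Rmin_case; auto). lra. }
  specialize (H1 (a + RtoC t)%C). specialize (H2 (a + RtoC t)%C).
  replace (a + t - a)%C with (RtoC t) in * by ring.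
  rewrite Cmod_R, Rabs_pos_eq in * by lra.
  specialize (H1 ltac:(lra)). specialize (H2 ltac:(lra)).
  apply Rmult_le_reg_r with t; [lra|].
  rewrite <- (Rabs_pos_eq t), <- Cmod_R, <- Cmod_mult at 1 by lra.
  replace ((d - d') * t)%C with ((f (a + t) - f a - d' * t) + - (f (a + t) - f a - d * t))%C by
    ring.
  eapply Rle_trans; [apply Cmod_triangle|]. rewrite Cmod_opp. lra.
Qed.

Lemma has_deriv_local f g a d : (exists r, 0 < r /\ forall s, Cmod (s - a) < r -> f s = g s) ->
  has_deriv f a d -> has_deriv g a d.
Proof.
  intros (r & Hr & He) H eps Heps. destruct (H eps Heps) as (e & Hpe & H1).
  exists (Rmin r e). split; [apply Rmin_case; auto|].
  intros s Hs. pose_rmin r e.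
  rewrite <- !He.
  - apply H1. lra.
  - replace (a - a)%C with (RtoC 0) by ring. now rewrite Cmod_0.
  - lra.
Qed.

Lemma has_deriv_C_derive f a d : has_deriv f a d -> C_derive f a = d.
Proof.
  intros H. apply is_C_lim_unique. apply filterlim_locally. intros eps.
  assert (Heps : 0 < eps / 2) by (destruct eps; simpl; lra).
  destruct (H (eps / 2) Heps) as (e & He & H1).
  assert (He2 : 0 < e / 2) by lra.
  exists (mkposreal _ He2). intros s Hs Hn.
  apply ball_Cmod in Hs. simpl in Hs. change (Cmod (s - a) < 2 * (e / 2)) in Hs.
  apply C_NormedModule_mixin_compat1.
  change (Cmod ((f s - f a) / (s - a) - d) < eps).
  assert (Hsa : (s - a)%C <> RtoC 0).
  { intros e0. apply Hn. now apply Ceq_minus. }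
  replace ((f s - f a) / (s - a) - d)%C with ((f s - f a - d * (s - a)) / (s - a))%C by
    (field; auto).
  rewrite Cmod_div by auto.
  assert (h := Cmod_gt_0 (s - a)%C). apply h in Hsa.
  specialize (H1 s ltac:(lra)).
  apply Rle_lt_trans with (eps / 2); [|destruct eps; simpl; lra].
  apply Rmult_le_reg_r with (Cmod (s - a)); auto.
  unfold Rdiv at 1. rewrite Rmult_assoc, Rinv_l by lra. rewrite Rmult_1_r. exact H1.
Qed.

(** * Functions analytic at a point *)

Definition hol (f : C -> C) (a : C) : Prop :=
  exists r c M, 0 < r /\ pser a r c M f.

Lemma hol_plus f g a : hol f a -> hol g a -> hol (fun s => f s + g s)%C a.
Proof.
  intros (r & c & M & Hr & H) (r' & c' & M' & Hr' & H').
  exists (Rmin r r'), (fun k => c k + c' k)%C, (M + M').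
  pose_rmin r r'.
  assert (0 < Rmin r r') by (apply Rmin_case; lra).
  split; [easy|]. apply pser_plus; eapply pser_mono; eauto; lra.
Qed.

Lemma hol_mult f g a : hol f a -> hol g a -> hol (fun s => f s * g s)%C a.
Proof.
  intros (r & c & M & Hr & H) (r' & c' & M' & Hr' & H').
  exists (Rmin r r'), (fun k => csum (fun i => c i * c' (k - i)%nat)%C (seq 0 (S k))), (M * M').
  pose_rmin r r'.
  assert (0 < Rmin r r') by (apply Rmin_case; lra).
  split; [easy|]. apply pser_mult; [lra| |]; eapply pser_mono; eauto; lra.
Qed.

Lemma hol_shift f a j : hol f (a - j)%C -> hol (fun s => f (s - j)%C) a.
Proof.
  intros (r & c & M & Hr & H). exists r, c, M. split; auto. now apply pser_shift.
Qed.

Lemma hol_inv p a : p <> a -> hol (fun s => / (s - p))%C a.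
Proof.
  intros Hp.
  assert (H : 0 < Cmod (p - a)).
  { apply Cmod_gt_0. intros e. apply Hp. replace p with (p - a + a)%C by ring. rewrite e. ring. }
  destruct (pser_inv a p (Cmod (p - a) / 2)) as (M & h); [lra|].
  exists (Cmod (p - a) / 2), (fun k => - / (p - a) * (/ (p - a)) ^ k)%C, M. split; auto. lra.
Qed.

(** Every centre and every radius are included, so an expansion on a prescribed disc is available
    without a theorem extending radii of convergence. *)
Definition entire (f : C -> C) : Prop :=
  forall a r, 0 < r -> exists c M, pser a r c M f.

Lemma entire_hol f a : entire f -> hol f a.
Proof. intros H. destruct (H a 1 Rlt_0_1) as (c & M & h). exists 1, c, M. split; auto. lra. Qed.

Lemma entire_ext f g : (forall s, f s = g s) -> entire f -> entire g.
Proof.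
  intros He H a r Hr. destruct (H a r Hr) as (c & M & h). exists c, M.
  eapply pser_ext; [|exact h]. auto.
Qed.

Lemma entire_plus f g : entire f -> entire g -> entire (fun s => f s + g s)%C.
Proof.
  intros H H' a r Hr. destruct (H a r Hr) as (c & M & h). destruct (H' a r Hr) as (c' & M' & h').
  eexists _, _. eapply pser_plus; eauto.
Qed.

Lemma entire_mult f g : entire f -> entire g -> entire (fun s => f s * g s)%C.
Proof.
  intros H H' a r Hr. destruct (H a r Hr) as (c & M & h). destruct (H' a r Hr) as (c' & M' & h').
  eexists _, _. eapply pser_mult; eauto. lra.
Qed.

Lemma entire_const u : entire (fun _ => u).
Proof.
  intros a r Hr.
  exists (fun k => match k with O => u | _ => RtoC 0 end).
  eexists. eapply pser_ext; [|apply (pser_finite a r _ 1)].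
  - intros s _. unfold csum. simpl. ring.
  - intros [|k] Hk; [lia|reflexivity].
Qed.

Lemma entire_id : entire (fun s => s).
Proof.
  intros a r Hr.
  exists (fun k => match k with O => a | 1%nat => RtoC 1 | _ => RtoC 0 end).
  eexists. eapply pser_ext; [|apply (pser_finite a r _ 2)].
  - intros s _. unfold csum. simpl. ring.
  - intros [|[|k]] Hk; [lia|lia|reflexivity].
Qed.

Lemma entire_csum {I : Type} (f : I -> C -> C) (L : list I) : (forall i, entire (f i)) ->
  entire (fun s => csum (fun i => f i s) L).
Proof.
  intros H. induction L as [|i L IH].
  - apply (entire_const (RtoC 0)).
  - apply (entire_plus (f i) (fun s => csum (fun i => f i s) L)); auto.
Qed.

Lemma pow_n_Cpow (z : C) k : pow_n (K := C_AbsRing) z k = (z ^ k)%C.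
Proof. induction k as [|k IH]; [reflexivity|]. simpl. rewrite IH. reflexivity. Qed.

Lemma pser_is_pseries a r c M f s : pser a r c M f -> Cmod (s - a) <= r ->
  @is_pseries C_AbsRing C_NormedModule c (s - a)%C (f s).
Proof.
  intros [_ H] Hs. apply is_sum_series.
  eapply is_sum_ext; [|exact (H s Hs)].
  intros k. rewrite pow_n_Cpow.
  change (c k * (s - a) ^ k = (s - a) ^ k * c k)%C. ring.
Qed.

Lemma hol_analytic f a : hol f a -> analytic_at f a.
Proof.
  intros (r & c & M & Hr & H). exists c, r. split; auto.
  intros s Hs. eapply pser_is_pseries; eauto. lra.
Qed.

(** Mere convergence at radius [r] bounds the terms there; at half the radius they are dominated by
    a geometric series of ratio 1/2. *)
Lemma pseries_pser c r : 0 < r -> (exists l, @is_pseries C_AbsRing C_NormedModule c (RtoC r) l) ->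
  exists M, bsum (fun k => c k * RtoC (r / 2) ^ k)%C M.
Proof.
  intros Hr [l Hl].
  destruct (is_series_clim _ _ Hl 1 Rlt_0_1) as [N HN].
  set (t := fun k => (c k * RtoC r ^ k)%C).
  assert (Ht : forall k, scal (pow_n (K := C_AbsRing) (RtoC r) k) (c k) = t k).
  { intros k. rewrite pow_n_Cpow. unfold t.
    change (RtoC r ^ k * c k = c k * RtoC r ^ k)%C. ring. }
  assert (HN' : forall n, (N <= n)%nat -> Cmod (csum t (seq 0 n) - l) < 1).
  { intros n Hn. specialize (HN n Hn).
    now rewrite (csum_ext _ t) in HN by (intros; apply Ht). }
  assert (Hb : exists B, 0 <= B /\ forall k, Cmod (t k) <= B).
  { exists (2 + rsum (fun k => Cmod (t k)) (seq 0 N)).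
    assert (h0 : 0 <= rsum (fun k => Cmod (t k)) (seq 0 N))
      by (apply rsum_ge0; intros; apply Cmod_ge_0).
    split; [lra|]. intros k. destruct (le_lt_dec N k) as [h|h].
    - assert (h1 := HN' k h). assert (h2 := HN' (S k) ltac:(lia)).
      rewrite seq_S, csum_app in h2. simpl in h2. unfold csum at 2 in h2. simpl in h2.
      replace (t k) with ((csum t (seq 0 k) + (t k + 0) - l) + - (csum t (seq 0 k) - l))%C by ring.
      eapply Rle_trans; [apply Cmod_triangle|]. rewrite Cmod_opp. lra.
    - assert (h1 : rsum (fun k => Cmod (t k)) (k :: nil) <= rsum (fun k => Cmod (t k)) (seq 0 N)).
      { apply rsum_incl; [intros; apply Cmod_ge_0| |].
        - constructor; [easy|constructor].
        - intros i [<-|[]]. apply in_seq. lia. }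
      unfold rsum at 1 in h1. simpl in h1. lra. }
  destruct Hb as (B & HB0 & HB).
  destruct (is_sum_geom (RtoC (1 / 2))) as [_ hg].
  { rewrite Cmod_R, Rabs_pos_eq; lra. }
  exists (Cmod (RtoC B) * / (1 - Cmod (RtoC (1 / 2)))).
  eapply bsum_le; [|exact (bsum_scal (RtoC B) _ _ hg)].
  intros k. simpl.
  replace (RtoC (r / 2)) with (RtoC r * RtoC (1 / 2))%C by (rewrite <- RtoC_mult; f_equal; field).
  rewrite Cpow_mult_l, Cmult_assoc, !Cmod_mult. apply Rmult_le_compat_r; [apply Cmod_ge_0|].
  rewrite (Cmod_R B), Rabs_pos_eq by auto. rewrite <- Cmod_mult. apply HB.
Qed.

Lemma is_pseries_pser a r (c : nat -> C) M s l : bsum (fun k => c k * RtoC r ^ k)%C M ->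
  Cmod (s - a) <= r -> @is_pseries C_AbsRing C_NormedModule c (s - a)%C l ->
  is_sum (fun k => c k * (s - a) ^ k)%C l.
Proof.
  intros Hb Hs Hl.
  assert (h := Cmod_ge_0 (s - a)).
  apply (is_sum_nat_bsum _ _ M).
  - eapply bsum_le; [|exact Hb].
    intros k. rewrite !Cmod_mult, Cmod_RtoC_pow, Cmod_pow by lra.
    apply Rmult_le_compat_l; [apply Cmod_ge_0|]. now apply pow_le'.
  - intros eps Heps. destruct (is_series_clim _ _ Hl eps Heps) as [N HN].
    exists N. intros n Hn. specialize (HN n Hn).
    rewrite (csum_ext _ (fun k => c k * (s - a) ^ k)%C) in HN; auto.
    intros k _. rewrite pow_n_Cpow. change ((s - a) ^ k * c k = c k * (s - a) ^ k)%C. ring.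
Qed.

Lemma analytic_hol f a : analytic_at f a -> hol f a.
Proof.
  intros (c & r & Hr & H).
  (* [analytic_at] concerns an open disc, so convergence is used at radius [r / 2]; absolute
     convergence costs a second halving. *)
  destruct (pseries_pser c (r / 2)) as [M HM]; [lra| |].
  - exists (f (a + RtoC (r / 2))%C). specialize (H (a + RtoC (r / 2))%C).
    replace (a + (r / 2)%R - a)%C with (RtoC (r / 2)) in H by ring.
    apply H. rewrite Cmod_R, Rabs_pos_eq; lra.
  - exists (r / 2 / 2), c, M. split; [lra|]. split; auto.
    intros s Hs. eapply is_pseries_pser; eauto. apply H. lra.
Qed.

(* [a] may be a pole: the value [f a] plays no role. *)
Definition mer (f : C -> C) (a : C) : Prop :=
  exists m h r, 0 < r /\ hol h a /\
    forall s, 0 < Cmod (s - a) < r -> ((s - a) ^ m * f s)%C = h s.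

Lemma mer_meromorphic f a : mer f a -> meromorphic_at f a.
Proof.
  intros (m & h & r & Hr & (r' & c & M & Hr' & H) & He).
  exists m, c, (Rmin r r'). split; [apply Rmin_case; auto|].
  intros s Hs. pose_rmin r r'.
  rewrite He by lra. eapply pser_is_pseries; eauto. lra.
Qed.

Lemma meromorphic_mer f a : meromorphic_at f a -> mer f a.
Proof.
  intros (m & c & r & Hr & H).
  destruct (pseries_pser c (r / 2)) as [M HM]; [lra| |].
  - eexists. specialize (H (a + RtoC (r / 2))%C).
    replace (a + (r / 2)%R - a)%C with (RtoC (r / 2)) in H by ring.
    apply H. rewrite Cmod_R, Rabs_pos_eq; lra.
  - set (R2 := r / 2 / 2) in *. assert (HR2 : 0 < R2) by (unfold R2; lra).
    (* The power series prescribes the value [c O] at [a], where nothing is known about [f]. *)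
    set (g := fun s => if prop_dec (s = a) then c O else ((s - a) ^ m * f s)%C).
    exists m, g, R2. split; auto. split.
    + exists R2, c, M. split; auto. split; auto. intros s Hs. unfold g.
      destruct (prop_dec (s = a)) as [->|n].
      * replace (a - a)%C with (RtoC 0) by ring.
        replace (c O) with (c O * RtoC 0 ^ 0)%C by (simpl; ring).
        apply (is_sum_single (fun k => c k * RtoC 0 ^ k)%C O).
        intros [|k] Hk; [easy|]. rewrite C0_pow. ring.
      * eapply is_pseries_pser; eauto. apply H. split; [|unfold R2 in *; lra].
        apply Cmod_gt_0. intros e. apply n. replace s with (s - a + a)%C by ring.
        rewrite e. ring.
    + intros s Hs. unfold g. destruct (prop_dec (s = a)) as [->|n]; auto.
      replace (a - a)%C with (RtoC 0) in Hs by ring. rewrite Cmod_0 in Hs. lra.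
Qed.

Lemma hol_mer f a : hol f a -> mer f a.
Proof.
  intros H. exists O, f, 1. split; [lra|]. split; auto.
  intros s _. simpl. ring.
Qed.

Lemma hol_pow a m : hol (fun s => (s - a) ^ m)%C a.
Proof.
  apply entire_hol. induction m as [|m IH].
  - apply (entire_const (RtoC 1)).
  - apply (entire_ext (fun s => (s + - a) * (s - a) ^ m)%C); [reflexivity|].
    apply entire_mult; auto. apply entire_plus; [apply entire_id|apply entire_const].
Qed.

Lemma mer_plus f g a : mer f a -> mer g a -> mer (fun s => f s + g s)%C a.
Proof.
  intros (m & h & r & Hr & Hh & He) (m' & h' & r' & Hr' & Hh' & He').
  exists (m + m')%nat, (fun s => (s - a) ^ m' * h s + (s - a) ^ m * h' s)%C, (Rmin r r').
  split; [apply Rmin_case; auto|]. split.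
  - apply hol_plus; apply hol_mult; auto; apply hol_pow.
  - intros s Hs. pose_rmin r r'.
    rewrite <- He, <- He' by lra. rewrite Cpow_add_r. ring.
Qed.

Lemma mer_mult f g a : mer f a -> mer g a -> mer (fun s => f s * g s)%C a.
Proof.
  intros (m & h & r & Hr & Hh & He) (m' & h' & r' & Hr' & Hh' & He').
  exists (m + m')%nat, (fun s => h s * h' s)%C, (Rmin r r').
  split; [apply Rmin_case; auto|]. split.
  - now apply hol_mult.
  - intros s Hs. pose_rmin r r'.
    rewrite <- He, <- He' by lra. rewrite Cpow_add_r. ring.
Qed.

Lemma mer_shift f a j : mer f (a - j)%C -> mer (fun s => f (s - j)%C) a.
Proof.
  intros (m & h & r & Hr & Hh & He).
  exists m, (fun s => h (s - j)%C), r. split; auto. split.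
  - now apply hol_shift.
  - intros s Hs. replace (s - a)%C with (s - j - (a - j))%C in * by ring. auto.
Qed.

(** * The identity theorem *)

Definition zeros_near (h : C -> C) (a : C) : Prop :=
  forall d, 0 < d -> exists s, 0 < Cmod (s - a) < d /\ h s = RtoC 0.

Lemma pser_zero_at a r c M h : 0 < r -> pser a r c M h -> zeros_near h a -> h a = RtoC 0.
Proof.
  intros Hr H Hz. apply Ceq_eps; intros eps Heps.
  set (d1 := c 1%nat). assert (Hd := Cmod_ge_0 d1).
  destruct (pser_has_deriv a r c M h Hr H 1 Rlt_0_1) as (e & He & H1).
  destruct (Hz (Rmin e (eps / (Cmod d1 + 1)))) as (s & Hs & Hhs).
  { apply Rmin_case; auto. apply Rdiv_lt_0_compat; lra. }
  pose_rmin e (eps / (Cmod d1 + 1)).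
  specialize (H1 s ltac:(lra)). rewrite Hhs in H1. fold d1 in H1.
  replace (h a - 0)%C with (- ((0 - h a - d1 * (s - a)) + d1 * (s - a)))%C by ring.
  rewrite Cmod_opp. eapply Rle_trans; [apply Cmod_triangle|]. rewrite Cmod_mult.
  assert (h3 : Cmod (s - a) * (Cmod d1 + 1) < eps / (Cmod d1 + 1) * (Cmod d1 + 1))
    by (apply Rmult_lt_compat_r; lra).
  replace (eps / (Cmod d1 + 1) * (Cmod d1 + 1)) with eps in h3 by (field; lra). lra.
Qed.

(** Division by [s - a] shifts the coefficients; at [a] the difference quotient is completed by the
    first coefficient. *)
Lemma pser_tail a r c M h : 0 < r -> pser a r c M h -> exists M' g,
  pser a r (fun k => c (S k)) M' g /\
  forall s, Cmod (s - a) <= r -> (h s - h a)%C = ((s - a) * g s)%C.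
Proof.
  intros Hr H.
  set (g := fun s => if prop_dec (s = a) then c 1%nat else ((h s - h a) / (s - a))%C).
  exists (Cmod (/ r)%C * M), g. split; [split|].
  - eapply bsum_le; [|exact (bsum_scal (/ r)%C _ _ (bsum_comp S _ _ eq_add_S (proj1 H)))].
    intros k. apply Req_le. f_equal. rewrite Cpow_S. field.
    intros e. apply RtoC_inj in e. lra.
  - intros s Hs. unfold g. destruct (prop_dec (s = a)) as [->|ne].
    + replace (c 1%nat) with (c 1%nat * (a - a) ^ 0)%C by (simpl; ring).
      apply (is_sum_single (fun k => c (S k) * (a - a) ^ k)%C O). intros [|k] Hk; [easy|].
      replace (a - a)%C with (RtoC 0) by ring. rewrite C0_pow. ring.
    + assert (Hn : (s - a)%C <> RtoC 0) by (intros e; apply ne; now apply Ceq_minus).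
      rewrite (pser_at a r c M h) by (auto; lra).
      replace ((h s - c O) / (s - a))%C with (/ (s - a) * (h s - c O * (s - a) ^ 0))%C
        by (simpl; field; auto).
      eapply is_sum_ext; [|exact (is_sum_scal _ _ _ (is_sum_shift _ _ (proj2 H s Hs)))].
      intros k. cbv beta. rewrite Cpow_S. field. auto.
  - intros s _. unfold g. destruct (prop_dec (s = a)) as [->|ne]; [ring|]. field.
    intros e. apply ne. now apply Ceq_minus.
Qed.

(** By continuity [h a = 0]. Dividing by [s - a] leaves a function with the same nearby zeros and
    shifted coefficients, to which the induction applies. *)
Lemma pser_zeros k : forall a r c M h, 0 < r -> pser a r c M h -> zeros_near h a -> c k = RtoC 0.
Proof.
  induction k as [|k IH]; intros a r c M h Hr H Hz; assert (H0 := pser_zero_at a r c M h Hr H Hz).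
  - now rewrite <- (pser_at a r c M h) by (auto; lra).
  - destruct (pser_tail a r c M h Hr H) as (M' & g & Hg & E).
    apply (IH a r (fun k => c (S k)) M' g); auto.
    intros d Hd. destruct (Hz (Rmin r d)) as (s & Hs & Hhs); [apply Rmin_case; auto|].
    pose_rmin r d.
    exists s. split; [lra|]. specialize (E s ltac:(lra)). rewrite H0, Hhs in E.
    assert (Hn : (s - a)%C <> RtoC 0) by (apply Cmod_gt_0; lra).
    replace (g s) with (/ (s - a) * ((s - a) * g s))%C by (field; auto). rewrite <- E. ring.
Qed.

Lemma hol_zeros h a : hol h a -> zeros_near h a ->
  exists r, 0 < r /\ forall s, Cmod (s - a) < r -> h s = RtoC 0.
Proof.
  intros (r & c & M & Hr & H) Hz. exists r. split; auto. intros s Hs.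
  eapply is_sum_unique; [apply H; lra|]. eapply is_sum_ext; [|apply is_sum_0].
  intros k. simpl. rewrite (pser_zeros k a r c M h Hr H Hz). ring.
Qed.

Lemma mer_zeros f a : mer f a -> zeros_near f a ->
  exists r, 0 < r /\ forall s, 0 < Cmod (s - a) < r -> f s = RtoC 0.
Proof.
  intros (m & h & r & Hr & Hh & He) Hz.
  destruct (hol_zeros h a Hh) as (r' & Hr' & H).
  - intros d Hd. destruct (Hz (Rmin r d)) as (s & Hs & Hfs); [apply Rmin_case; auto|].
    exists s. pose_rmin r d.
    split; [lra|]. rewrite <- He by lra. rewrite Hfs. ring.
  - exists (Rmin r r'). split; [apply Rmin_case; auto|]. intros s Hs.
    pose_rmin r r'.
    specialize (He s ltac:(lra)). rewrite H in He by lra.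
    assert (Hn : ((s - a) ^ m)%C <> RtoC 0) by (apply Cpow_nz, Cmod_gt_0; lra).
    replace (f s) with (/ (s - a) ^ m * ((s - a) ^ m * f s))%C by (field; auto).
    rewrite He. ring.
Qed.

(* A sweep to the left along the real axis: the zeros on the part already covered
   accumulate at its left end point. *)
Lemma mer_identity f sigma : (forall a, mer f a) ->
  (forall s, sigma < Re s -> f s = RtoC 0) ->
  exists r, 0 < r /\ forall s, 0 < Cmod s < r -> f s = RtoC 0.
Proof.
  intros Hm H0.
  (* The disc is punctured because the value at [t] itself is unconstrained. *)
  set (good := fun t : R => exists r, 0 < r /\
     forall s, 0 < Cmod (s - RtoC t) < r -> f s = RtoC 0).
  assert (Hre : forall s : C, Rabs (Re s) <= Cmod s) by apply re_le_Cmod.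
  assert (Hbig : forall t, sigma < t -> good t).
  { intros t Ht. exists (t - sigma). split; [lra|]. intros s Hs. apply H0.
    assert (h := Hre (s - RtoC t)%C). unfold Re in *. simpl in h.
    assert (h2 := Rle_abs (- (fst s + - t))). rewrite Rabs_Ropp in h2. lra. }
  set (T := Rmax sigma 0 + 1).
  assert (HT1 := Rmax_l sigma 0). assert (HT2 := Rmax_r sigma 0).
  set (E := fun u => 0 <= u <= T /\ forall t, T - u <= t <= T -> good t).
  assert (HE0 : E 0).
  { split; [unfold T; lra|]. intros t Ht. apply Hbig. unfold T in *. lra. }
  destruct (completeness E) as [u0 [Hu1 Hu2]].
  { exists T. intros u [Hu _]. lra. }
  { now exists 0. }
  assert (Hu00 : 0 <= u0) by now apply Hu1.
  assert (Hu0T : u0 <= T) by (apply Hu2; intros u [Hu _]; lra).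
  assert (Hab : forall t, T - u0 < t <= T -> good t).
  { intros t Ht.
    destruct (Classical_Prop.classic (exists u, E u /\ T - t < u)) as [(u & [Hu3 Hu4] & Hu5)|Hn].
    - apply Hu4. lra.
    - assert (u0 <= T - t); [|lra]. apply Hu2. intros u Hu. apply Rnot_lt_le.
      intros ?. apply Hn. now exists u. }
  assert (Ha : good (T - u0)).
  { destruct (Rle_lt_or_eq_dec 0 u0 Hu00) as [Hp|<-].
    - apply mer_zeros; [apply Hm|]. intros d Hd.
      (* The zero sought is [t + e]: [t] is good and close to the end point, and the shift by [e]
         avoids [t], where [f] need not vanish. *)
      set (t := T - u0 + Rmin (d / 2) u0 / 2).
      pose_rmin (d / 2) u0.
      assert (h3 : 0 < Rmin (d / 2) u0) by (apply Rmin_case; lra).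
      destruct (Hab t) as (r & Hr & H); [unfold t; lra|].
      set (e := Rmin r (Rmin (d / 2) u0 / 4) / 2).
      pose_rmin r (Rmin (d / 2) u0 / 4).
      assert (h6 : 0 < Rmin r (Rmin (d / 2) u0 / 4)) by (apply Rmin_case; lra).
      exists (RtoC (t + e)). split.
      + rewrite <- RtoC_minus, Cmod_R. rewrite Rabs_pos_eq; unfold e, t in *; lra.
      + apply H. rewrite <- RtoC_minus, Cmod_R. rewrite Rabs_pos_eq; unfold e, t in *; lra.
    - apply Hbig. unfold T. lra. }
  assert (HuT : u0 = T).
  (* If the sweep stopped before 0, the punctured disc at the end point would make the real points
     just to its left good as well. *)
  { apply Rle_antisym; auto. apply Rnot_lt_le. intros Hlt.
    destruct Ha as (r & Hr & H).
    set (e := Rmin (r / 2) (T - u0)).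
    assert (h1 : e <= r / 2) by apply Rmin_l. assert (h2 : e <= T - u0) by apply Rmin_r.
    assert (h3 : 0 < e) by (apply Rmin_case; lra).
    assert (HEe : E (u0 + e)).
    { split; [lra|]. intros t Ht.
      destruct (Rlt_le_dec (T - u0) t) as [h|h]; [apply Hab; lra|].
      destruct (Rle_lt_or_eq_dec _ _ h) as [h'| ->]; [|now exists r].
      exists (Rmin (T - u0 - t) (r / 2)). split; [apply Rmin_case; lra|].
      intros s Hs. pose_rmin (T - u0 - t) (r / 2).
      apply H. split.
      - apply Cmod_gt_0. intros e0.
        assert (s = RtoC (T - u0)).
        { replace s with (s - RtoC (T - u0) + RtoC (T - u0))%C by ring. rewrite e0. ring. }
        subst s. rewrite <- RtoC_minus, Cmod_R in Hs. rewrite Rabs_pos_eq in Hs; lra.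
      - replace (s - RtoC (T - u0))%C with ((s - RtoC t) + RtoC (t - (T - u0)))%C
          by (rewrite !RtoC_minus; ring).
        eapply Rle_lt_trans; [apply Cmod_triangle|].
        rewrite Cmod_R, (Rabs_left (t - (T - u0))); lra. }
    assert (h := Hu1 _ HEe). lra. }
  rewrite HuT in Ha. replace (T - T) with 0 in Ha by ring.
  destruct Ha as (r & Hr & H). exists r. split; auto. intros s Hs. apply H.
  now replace (s - 0)%C with s by ring.
Qed.

Lemma hol_csum {I : Type} (f : I -> C -> C) (L : list I) a : (forall i, hol (f i) a) ->
  hol (fun s => csum (fun i => f i s) L) a.
Proof.
  intros H. induction L as [|i L IH]; [apply entire_hol, (entire_const (RtoC 0))|].
  apply (hol_plus (f i) (fun s => csum (fun i => f i s) L)); auto.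
Qed.

Lemma mer_csum {I : Type} (f : I -> C -> C) (L : list I) a : (forall i, mer (f i) a) ->
  mer (fun s => csum (fun i => f i s) L) a.
Proof.
  intros H. induction L as [|i L IH]; [apply hol_mer, entire_hol, (entire_const (RtoC 0))|].
  apply (mer_plus (f i) (fun s => csum (fun i => f i s) L)); auto.
Qed.

(** [mer_identity] controls the difference on a punctured disc; since the difference is analytic at
    0, these zeros force it to vanish at 0 too. *)
Lemma identity_near_0 (F G : C -> C) sigma : (forall a, mer F a) -> hol F 0 ->
  (forall a, mer G a) -> hol G 0 -> (forall s, sigma < Re s -> F s = G s) ->
  exists r, 0 < r /\ forall s, Cmod s < r -> F s = G s.
Proof.
  intros F1 F2 G1 G2 H.
  destruct (mer_identity (fun s => F s + - (1) * G s)%C sigma) as (r & Hr & E).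
  - intros a. apply mer_plus; auto. apply mer_mult; auto. apply hol_mer, entire_hol, entire_const.
  - intros s Hs. rewrite H by auto. ring.
  - destruct (hol_zeros (fun s => F s + - (1) * G s)%C 0) as (r' & Hr' & E').
    + apply hol_plus; auto. apply hol_mult; auto. apply entire_hol, entire_const.
    + intros d Hd. exists (RtoC (Rmin r d / 2)).
      pose_rmin r d.
      assert (h3 : 0 < Rmin r d) by (apply Rmin_case; auto).
      rewrite <- RtoC_minus, Cmod_R, Rabs_pos_eq by lra. split; [lra|].
      apply E. rewrite Cmod_R, Rabs_pos_eq; lra.
    + exists r'. split; auto. intros s Hs. specialize (E' s).
      replace (s - 0)%C with s in E' by ring. specialize (E' Hs).
      replace (F s) with (F s + - (1) * G s + G s)%C by ring. rewrite E'. ring.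
Qed.

(** The two half-planes may differ, because [zeta_prod] does not fix the abscissa. *)
Lemma is_continuation_unique (D : C -> C -> Prop) sigma tau F G :
  (forall s v w, D s v -> D s w -> v = w) ->
  is_continuation D sigma F -> is_continuation D tau G ->
  exists r, 0 < r /\ forall s, Cmod s < r -> F s = G s.
Proof.
  intros HD (F1 & F2 & F3) (G1 & G2 & G3).
  apply (identity_near_0 F G (Rmax sigma tau));
    auto using meromorphic_mer, analytic_hol.
  intros s Hs. assert (h1 := Rmax_l sigma tau). assert (h2 := Rmax_r sigma tau).
  apply (HD s); [apply F3|apply G3]; lra.
Qed.

Lemma C_ext (z w : C) : Re z = Re w -> Im z = Im w -> z = w.
Proof. destruct z, w. unfold Re, Im. simpl. congruence. Qed.

Lemma Cmod_le_Re_Im (z : C) : Cmod z <= Rabs (Re z) + Rabs (Im z).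
Proof.
  replace z with (RtoC (Re z) + Ci * RtoC (Im z))%C at 1.
  - eapply Rle_trans; [apply Cmod_triangle|].
    rewrite Cmod_mult, Cmod_Ci, !Cmod_R. lra.
  - apply C_ext; unfold Re, Im; simpl; ring.
Qed.

(** * The complex exponential *)

Lemma Cexp_plus z w : Cexp (z + w) = (Cexp z * Cexp w)%C.
Proof.
  unfold Cexp. apply C_ext; unfold Re, Im; simpl; rewrite exp_plus, ?cos_plus, ?sin_plus; ring.
Qed.

Lemma Cexp_0 : Cexp 0 = RtoC 1.
Proof. unfold Cexp. apply C_ext; unfold Re, Im; simpl; rewrite exp_0, ?cos_0, ?sin_0; ring. Qed.

Lemma Cmod_Cexp z : Cmod (Cexp z) = exp (Re z).
Proof.
  assert (h := exp_pos (Re z)).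
  replace (Cexp z) with (RtoC (exp (Re z)) * (cos (Im z), sin (Im z)))%C.
  - rewrite Cmod_mult, Cmod_R, Rabs_pos_eq by lra. unfold Cmod. simpl.
    replace (cos (Im z) * (cos (Im z) * 1) + sin (Im z) * (sin (Im z) * 1)) with 1.
    + rewrite sqrt_1. ring.
    + assert (h2 := sin2_cos2 (Im z)). unfold Rsqr in h2. lra.
  - unfold Cexp. apply C_ext; unfold Re, Im; simpl; ring.
Qed.

Lemma Cexp_neq_0 z : Cexp z <> RtoC 0.
Proof. apply Cmod_gt_0. rewrite Cmod_Cexp. apply exp_pos. Qed.

Lemma Cexp_R (x : R) : Cexp (RtoC x) = RtoC (exp x).
Proof. unfold Cexp. apply C_ext; unfold Re, Im; simpl; rewrite ?cos_0, ?sin_0; ring. Qed.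

Lemma Cexp_opp z : Cexp (- z) = (/ Cexp z)%C.
Proof.
  assert (h : (Cexp z * Cexp (- z))%C = RtoC 1).
  { rewrite <- Cexp_plus. replace (z + - z)%C with (RtoC 0) by ring. apply Cexp_0. }
  replace (Cexp (- z)) with (/ Cexp z * (Cexp z * Cexp (- z)))%C.
  - rewrite h. ring.
  - field. apply Cexp_neq_0.
Qed.

Lemma Cexp_INR z n : Cexp (INR n * z) = (Cexp z ^ n)%C.
Proof.
  induction n as [|n IH].
  - replace (INR 0 * z)%C with (RtoC 0) by (simpl; ring). apply Cexp_0.
  - rewrite S_INR, Cpow_S, <- IH, <- Cexp_plus. f_equal. rewrite RtoC_plus. ring.
Qed.

(** * Paths in the complex plane and Taylor's formula *)

(** Taylor's formula is needed only along horizontal unit segments and rays through 0, where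
    componentwise real derivatives suffice. *)
Definition path_deriv (phi : R -> C) (t : R) (d : C) : Prop :=
  is_derive (fun u => Re (phi u)) t (Re d) /\ is_derive (fun u => Im (phi u)) t (Im d).

Lemma path_deriv_ext phi t d d' : d = d' -> path_deriv phi t d -> path_deriv phi t d'.
Proof. now intros <-. Qed.

Lemma path_deriv_scal (u : C) phi t d : path_deriv phi t d ->
  path_deriv (fun v => u * phi v)%C t (u * d)%C.
Proof.
  intros [H1 H2]. split.
  - change (is_derive (fun v => Re u * Re (phi v) - Im u * Im (phi v)) t
      (Re u * Re d - Im u * Im d)).
    apply (is_derive_minus (V := R_NormedModule));
      apply is_derive_scal; assumption.
  - change (is_derive (fun v => Re u * Im (phi v) + Im u * Re (phi v)) t
      (Re u * Im d + Im u * Re d)).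
    apply (is_derive_plus (V := R_NormedModule));
      apply is_derive_scal; assumption.
Qed.

Lemma path_deriv_exp L t d : path_deriv L t d ->
  path_deriv (fun v => Cexp (L v)) t (d * Cexp (L t))%C.
Proof.
  intros [H1 H2].
  set (a := fun v => Re (L v)). set (b := fun v => Im (L v)).
  change (is_derive a t (Re d)) in H1. change (is_derive b t (Im d)) in H2.
  assert (Ea : ex_derive a t) by (eexists; apply H1).
  assert (Eb : ex_derive b t) by (eexists; apply H2).
  assert (Da : Derive (fun v => a v) t = Re d) by exact (is_derive_unique _ _ _ H1).
  assert (Db : Derive (fun v => b v) t = Im d) by exact (is_derive_unique _ _ _ H2).
  split.
  - change (is_derive (fun v => exp (a v) * cos (b v)) t
      (Re d * (exp (a t) * cos (b t)) - Im d * (exp (a t) * sin (b t)))).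
    auto_derive; [tauto|]. rewrite Da, Db. ring.
  - change (is_derive (fun v => exp (a v) * sin (b v)) t
      (Re d * (exp (a t) * sin (b t)) + Im d * (exp (a t) * cos (b t)))).
    auto_derive; [tauto|]. rewrite Da, Db. ring.
Qed.

Lemma rsum_sum_f_R0 (f : nat -> R) n : sum_f_R0 f n = rsum f (seq 0 (S n)).
Proof.
  induction n as [|n IH]; [unfold rsum; simpl; ring|].
  simpl sum_f_R0. rewrite IH, (seq_S (S n)), rsum_app. unfold rsum at 3. simpl. ring.
Qed.

Lemma Re_csum {I : Type} (f : I -> C) J : Re (csum f J) = rsum (fun i => Re (f i)) J.
Proof.
  unfold csum, rsum. induction J as [|i J IH]; simpl; [reflexivity|].
  rewrite <- IH. reflexivity.
Qed.

Lemma Im_csum {I : Type} (f : I -> C) J : Im (csum f J) = rsum (fun i => Im (f i)) J.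
Proof.
  unfold csum, rsum. induction J as [|i J IH]; simpl; [reflexivity|].
  rewrite <- IH. reflexivity.
Qed.

(** The derivatives are assumed slightly to the left of 0 as well, since [Derive_n] at 0 depends on
    a two-sided neighbourhood. *)
Lemma real_taylor (f : nat -> R -> R) delta J B : 0 < delta ->
  (forall j t, - delta < t -> is_derive (f j) t (f (S j) t)) ->
  (forall t, 0 <= t <= 1 -> Rabs (f (S J) t) <= B) ->
  Rabs (f O 1 - rsum (fun j => f j 0 / INR (fact j)) (seq 0 (S J))) <= B / INR (fact (S J)).
Proof.
  intros Hd Hder HB.
  assert (Hloc : forall t, - delta < t -> locally t (fun u => - delta < u)).
  { intros t Ht. apply (open_gt (- delta)). exact Ht. }
  assert (HD : forall k t, - delta < t -> Derive_n (f O) k t = f k t).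
  { intros k. induction k as [|k IH]; intros t Ht; [reflexivity|].
    simpl. rewrite (Derive_ext_loc _ (f k)).
    - apply is_derive_unique, Hder, Ht.
    - apply (filter_imp (fun u => - delta < u)); auto. }
  destruct (Taylor_Lagrange (f O) J 0 1) as (z & Hz & E); [lra| |].
  - intros t Ht [|k] _; [exact I|]. simpl.
    apply (ex_derive_ext_loc (f k)).
    + apply (filter_imp (fun u => - delta < u)).
      * intros u Hu. symmetry. auto.
      * apply Hloc. lra.
    + eexists. apply Hder. lra.
  - rewrite E, rsum_sum_f_R0.
    rewrite (rsum_ext _ (fun j => f j 0 / INR (fact j))).
    + rewrite (HD (S J) z) by lra. replace (1 - 0) with 1 by ring. rewrite pow1.
      set (v := rsum _ _).
      replace (v + 1 / INR (fact (S J)) * f (S J) z - v) with (f (S J) z / INR (fact (S J)))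
        by (unfold Rdiv; ring).
      assert (hf := INR_fact_lt_0 (S J)).
      unfold Rdiv. rewrite Rabs_mult, (Rabs_pos_eq (/ _)) by (left; now apply Rinv_0_lt_compat).
      apply Rmult_le_compat_r; [left; now apply Rinv_0_lt_compat|]. apply HB. lra.
    + intros j _. rewrite HD by lra. replace (1 - 0) with 1 by ring. rewrite pow1.
      unfold Rdiv. ring.
Qed.

(** Lagrange's intermediate point differs for the real and the imaginary part, so the two remainders
    are added; hence the factor 2. *)
Lemma path_taylor (phi : nat -> R -> C) delta J B : 0 < delta ->
  (forall j t, - delta < t -> path_deriv (phi j) t (phi (S j) t)) ->
  (forall t, 0 <= t <= 1 -> Cmod (phi (S J) t) <= B) ->
  Cmod (phi O 1 - csum (fun j => / INR (fact j) * phi j 0)%C (seq 0 (S J)))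
    <= 2 * B / INR (fact (S J)).
Proof.
  intros Hd Hder HB.
  assert (E1 : forall r z, Re (/ RtoC (INR (fact r)) * z)%C = Re z / INR (fact r)).
  { intros r z. rewrite <- RtoC_inv by apply INR_fact_neq_0. rewrite re_scal_l. unfold Rdiv. ring. }
  assert (E2 : forall r z, Im (/ RtoC (INR (fact r)) * z)%C = Im z / INR (fact r)).
  { intros r z. rewrite <- RtoC_inv by apply INR_fact_neq_0. rewrite im_scal_l. unfold Rdiv. ring. }
  eapply Rle_trans; [apply Cmod_le_Re_Im|].
  assert (H1 := real_taylor (fun j t => Re (phi j t)) delta J B Hd
    (fun j t Ht => proj1 (Hder j t Ht))
    (fun t Ht => Rle_trans _ _ _ (re_le_Cmod _) (HB t Ht))).
  assert (H2 := real_taylor (fun j t => Im (phi j t)) delta J B Hd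
    (fun j t Ht => proj2 (Hder j t Ht))
    (fun t Ht => Rle_trans _ _ _ (Rle_trans _ _ _ (Rmax_r _ _) (Rmax_Cmod _)) (HB t Ht))).
  assert (F1 : Re (phi O 1 - csum (fun j => / INR (fact j) * phi j 0)%C (seq 0 (S J)))%C
    = Re (phi O 1) - rsum (fun j => Re (phi j 0) / INR (fact j)) (seq 0 (S J))).
  { rewrite (rsum_ext _ (fun j => Re (/ INR (fact j) * phi j 0)%C)).
    - rewrite <- Re_csum. reflexivity.
    - intros j _. now rewrite E1. }
  assert (F2 : Im (phi O 1 - csum (fun j => / INR (fact j) * phi j 0)%C (seq 0 (S J)))%C
    = Im (phi O 1) - rsum (fun j => Im (phi j 0) / INR (fact j)) (seq 0 (S J))).
  { rewrite (rsum_ext _ (fun j => Im (/ INR (fact j) * phi j 0)%C)).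
    - rewrite <- Im_csum. reflexivity.
    - intros j _. now rewrite E2. }
  rewrite F1, F2. unfold Rdiv in *. lra.
Qed.

Lemma exp_partial_sum x n : 0 <= x -> rsum (fun k => x ^ k / INR (fact k)) (seq 0 n) <= exp x.
Proof.
  intros Hx. assert (Hp : forall k, 0 <= x ^ k / INR (fact k)).
  { intros k. apply Rmult_le_pos; [now apply pow_le|]. left. apply Rinv_0_lt_compat,
      INR_fact_lt_0. }
  destruct n as [|n]; [unfold rsum; simpl; left; apply exp_pos|].
  rewrite <- rsum_sum_f_R0. apply sum_incr; auto.
  unfold exp. destruct (exist_exp x) as [l Hl]. simpl.
  unfold exp_in, infinite_sum in Hl. intros eps Heps.
  destruct (Hl eps Heps) as [N HN]. exists N. intros m Hm.
  rewrite (sum_eq _ (fun i => / INR (fact i) * x ^ i)); [now apply HN|].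
  intros i _. unfold Rdiv. ring.
Qed.

(** Taylor's formula for [Cexp (t * z)] on [0 <= t <= 1]: the remainder is controlled by
    [Cmod z ^ n / n!], which tends to 0. *)
Lemma is_sum_Cexp z : is_sum (fun k => z ^ k / INR (fact k))%C (Cexp z) /\
  bsum (fun k => z ^ k / INR (fact k))%C (exp (Cmod z)).
Proof.
  assert (Hb : bsum (fun k => z ^ k / INR (fact k))%C (exp (Cmod z))).
  { apply bsum_nat. intros n. eapply Rle_trans; [|apply (exp_partial_sum _ n), Cmod_ge_0].
    apply rsum_le. intros k _. rewrite Cmod_div, Cmod_pow, Cmod_R, Rabs_pos_eq.
    - lra.
    - left. apply INR_fact_lt_0.
    - intros e. apply RtoC_inj in e. now apply INR_fact_neq_0 in e. }
  split; auto. apply (is_sum_nat_bsum _ _ _ Hb). intros eps Heps.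
  assert (Hn : forall n, Cmod (csum (fun k => z ^ k / INR (fact k))%C (seq 0 (S n)) - Cexp z)
     <= 2 * exp (Cmod z) * (Cmod z ^ S n / INR (fact (S n)))).
  { intros n.
    assert (h := path_taylor (fun j t => z ^ j * Cexp (RtoC t * z))%C 1 n
      (Cmod z ^ S n * exp (Cmod z)) Rlt_0_1).
    rewrite <- Cmod_opp.
    replace (- (csum (fun k => z ^ k / INR (fact k))%C (seq 0 (S n)) - Cexp z))%C
      with (z ^ 0 * Cexp (1 * z)
        - csum (fun j => / INR (fact j) * (z ^ j * Cexp (0 * z)))%C (seq 0 (S n)))%C.
    - replace (2 * exp (Cmod z) * (Cmod z ^ S n / INR (fact (S n))))
        with (2 * (Cmod z ^ S n * exp (Cmod z)) / INR (fact (S n))) by (unfold Rdiv; ring).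
      apply h.
      + intros j t _.
        apply (path_deriv_ext _ _ (z ^ j * (z * Cexp (t * z)))%C); [rewrite Cpow_S; ring|].
        apply path_deriv_scal. apply (path_deriv_exp (fun v => RtoC v * z)%C).
        split.
        * apply (is_derive_ext (fun v => v * Re z)); [intros; now rewrite re_scal_l|].
          auto_derive; auto; ring.
        * apply (is_derive_ext (fun v => v * Im z)); [intros; now rewrite im_scal_l|].
          auto_derive; auto; ring.
      + intros t Ht. rewrite Cmod_mult, Cmod_pow, Cmod_Cexp.
        apply Rmult_le_compat_l; [apply pow_le, Cmod_ge_0|].
        rewrite re_scal_l.
        assert (h1 := re_le_Cmod z). assert (h2 := Rle_abs (Re z)). assert (h3 := Cmod_ge_0 z).
        assert (h4 : t * Re z <= Cmod z) by nra.
        destruct h4 as [h4|h4]; [left; now apply exp_increasing|rewrite h4; lra].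
    - replace (0 * z)%C with (RtoC 0) by ring. replace (1 * z)%C with z by ring.
      rewrite Cexp_0, Cpow_0.
      rewrite (csum_ext _ (fun k => z ^ k / INR (fact k))%C).
      + ring.
      + intros k _. unfold Cdiv. ring. }
  destruct (cv_speed_pow_fact (Cmod z) (eps / (2 * exp (Cmod z)))) as [N HN].
  { apply Rdiv_lt_0_compat; auto. assert (h := exp_pos (Cmod z)). lra. }
  exists (S N). intros [|n] Hnn; [lia|]. eapply Rle_lt_trans; [apply Hn|].
  specialize (HN (S n) ltac:(lia)). unfold R_dist in HN. rewrite Rminus_0_r in HN.
  assert (h := Rle_abs (Cmod z ^ S n / INR (fact (S n)))).
  assert (h2 := exp_pos (Cmod z)).
  apply Rlt_le_trans with (2 * exp (Cmod z) * (eps / (2 * exp (Cmod z)))).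
  - apply Rmult_lt_compat_l; lra.
  - apply Req_le. field. lra.
Qed.

Lemma pser_Cexp (l a : C) r : 0 < r ->
  pser a r (fun k => Cexp (l * a) * (l ^ k / INR (fact k)))%C
    (Cmod (Cexp (l * a)) * exp (Cmod (l * r)%C)) (fun s => Cexp (l * s)).
Proof.
  intros Hr. split.
  - eapply bsum_le; [|exact (bsum_scal _ _ _ (proj2 (is_sum_Cexp (l * r)%C)))].
    intros k. apply Req_le. f_equal. unfold Cdiv. rewrite Cpow_mult_l. ring.
  - intros s Hs. replace (l * s)%C with (l * a + l * (s - a))%C by ring. rewrite Cexp_plus.
    eapply is_sum_ext; [|exact (is_sum_scal _ _ _ (proj1 (is_sum_Cexp (l * (s - a))%C)))].
    intros k. simpl. unfold Cdiv. rewrite Cpow_mult_l. ring.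
Qed.

Lemma entire_Cexp (l : C) : entire (fun s => Cexp (l * s)).
Proof. intros a r Hr. eexists _, _. now apply pser_Cexp. Qed.

Lemma has_deriv_Cexp (l a : C) : has_deriv (fun s => Cexp (l * s)) a (l * Cexp (l * a))%C.
Proof.
  replace (l * Cexp (l * a))%C with (Cexp (l * a) * (l ^ 1 / INR (fact 1)))%C by (simpl; field).
  apply (pser_has_deriv a 1 _ _ _ Rlt_0_1 (pser_Cexp l a 1 Rlt_0_1)).
Qed.

(** * Principal logarithm and powers in the right half-plane *)

Lemma Cmod_pos_Re z : 0 < Re z -> 0 < Cmod z.
Proof. intros H. assert (h := re_le_Cmod z). rewrite Rabs_pos_eq in h; lra. Qed.

Lemma Cneq0_Re z : 0 < Re z -> z <> RtoC 0.
Proof. intros H. now apply Cmod_gt_0, Cmod_pos_Re. Qed.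

Lemma Cmod_sqrt_Re z : 0 < Re z -> Cmod z = Re z * sqrt (1 + (Im z / Re z)²).
Proof.
  intros H. unfold Cmod. change (fst z) with (Re z). change (snd z) with (Im z).
  rewrite <- (sqrt_square (Re z)) at 2 by lra. rewrite <- sqrt_mult_alt by nra.
  f_equal. unfold Rsqr. field. lra.
Qed.

(** On the right half-plane, where the bases of all the powers lie, the two branches of [Carg] merge
    into one differentiable expression. *)
Lemma Carg_atan z : 0 < Re z -> Carg z = atan (Im z / Re z).
Proof.
  intros H. set (th := atan (Im z / Re z)).
  assert (Hb := atan_bound (Im z / Re z)). fold th in Hb.
  assert (Hsq : 0 < sqrt (1 + (Im z / Re z)²)).
  { apply sqrt_lt_R0. assert (h := Rle_0_sqr (Im z / Re z)). lra. }
  assert (Hc : Re z / Cmod z = cos th).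
  { unfold th. rewrite cos_atan, (Cmod_sqrt_Re z H). field. lra. }
  unfold Carg. rewrite Hc. assert (HPI := PI_RGT_0).
  destruct (Rle_dec 0 (Im z)) as [h|h].
  - apply acos_cos. split; [|lra]. unfold th. rewrite <- atan_0.
    destruct (Req_dec (Im z / Re z) 0) as [->|n]; [lra|].
    left. apply atan_increasing.
    assert (0 <= Im z / Re z); [|lra]. apply Rmult_le_pos; auto.
    left. now apply Rinv_0_lt_compat.
  - rewrite <- cos_neg, acos_cos; [lra|]. split; [|lra].
    assert (th < 0); [|lra]. unfold th. rewrite <- atan_0. apply atan_increasing.
    assert (hi := Rinv_0_lt_compat _ H). unfold Rdiv. nra.
Qed.

Lemma Carg_bound z : 0 < Re z -> Rabs (Carg z) <= PI.
Proof.
  intros H. rewrite Carg_atan by auto. assert (h := atan_bound (Im z / Re z)).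
  assert (HPI := PI_RGT_0). apply Rabs_le. lra.
Qed.

Lemma Cexp_Cln z : 0 < Re z -> Cexp (Cln z) = z.
Proof.
  intros H. unfold Cexp, Cln. assert (Hm := Cmod_pos_Re z H).
  unfold Re at 1 2, Im at 1 2. simpl. rewrite exp_ln, Carg_atan by auto.
  assert (Hsq : 0 < sqrt (1 + (Im z / Re z)²)).
  { apply sqrt_lt_R0. assert (h := Rle_0_sqr (Im z / Re z)). lra. }
  apply C_ext; [change (Cmod z * cos (atan (Im z / Re z)) = Re z)
    |change (Cmod z * sin (atan (Im z / Re z)) = Im z)].
  - rewrite cos_atan, (Cmod_sqrt_Re z H). field. lra.
  - rewrite sin_atan, (Cmod_sqrt_Re z H). field. lra.
Qed.

Lemma Cln_scal (r : R) z : 0 < r -> 0 < Re z -> Cln (RtoC r * z) = (ln r + Cln z)%C.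
Proof.
  intros Hr H. assert (Hm := Cmod_pos_Re z H).
  apply C_ext; [change (ln (Cmod (RtoC r * z)) = ln r + ln (Cmod z))
    |change (Carg (RtoC r * z) = 0 + Carg z)].
  - rewrite Cmod_mult, Cmod_R, Rabs_pos_eq, ln_mult by lra. reflexivity.
  - rewrite !Carg_atan; auto.
    + rewrite re_scal_l, im_scal_l, Rplus_0_l. f_equal. field. lra.
    + rewrite re_scal_l. now apply Rmult_lt_0_compat.
Qed.

Lemma Cln_R (r : R) : 0 < r -> Cln (RtoC r) = RtoC (ln r).
Proof.
  intros Hr. unfold Cln. rewrite Carg_atan by exact Hr.
  rewrite Cmod_R, Rabs_pos_eq by lra.
  replace (Im (RtoC r) / Re (RtoC r)) with 0; [now rewrite atan_0|].
  rewrite im_RtoC. unfold Rdiv. ring.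
Qed.

Lemma path_deriv_Cln w t : 0 < Re (w + RtoC t)%C ->
  path_deriv (fun v => Cln (w + RtoC v)) t (/ (w + RtoC t))%C.
Proof.
  intros H.
  assert (Hloc : locally t (fun v => 0 < Re (w + RtoC v)%C)).
  { apply (filter_imp (fun v => - Re w < v)).
    - intros v Hv. change (0 < Re w + v). lra.
    - apply (open_gt (- Re w)). change (0 < Re w + t) in H. lra. }
  change (0 < Re w + t) in H.
  assert (Hq : 0 < (Re w + t) ^ 2 + (Im w + 0) ^ 2) by nra.
  split.
  - change (is_derive (fun v => ln (sqrt ((Re w + v) ^ 2 + (Im w + 0) ^ 2))) t
      ((Re w + t) / ((Re w + t) ^ 2 + (Im w + 0) ^ 2))).
    assert (Hs := sqrt_lt_R0 _ Hq).
    auto_derive.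
    + simpl in *. repeat split; auto.
    + simpl in Hs, Hq |- *.
      set (q := (Re w + t) * ((Re w + t) * 1) + (Im w + 0) * ((Im w + 0) * 1)) in *.
      assert (E : sqrt q * sqrt q = q) by (apply sqrt_sqrt; lra).
      rewrite <- E at 3. field. lra.
  - apply (is_derive_ext_loc (fun v => atan ((Im w + 0) / (Re w + v)))).
    + apply (filter_imp (fun v => 0 < Re (w + RtoC v)%C)); auto.
      intros v Hv. unfold Im at 2, Cln. simpl. now rewrite Carg_atan.
    + change (is_derive (fun v => atan ((Im w + 0) / (Re w + v))) t
       (- (Im w + 0) / ((Re w + t) ^ 2 + (Im w + 0) ^ 2))).
      auto_derive; [lra|]. unfold Rsqr. field. repeat split; try nra.
Qed.

Lemma Cpower_plus w p q : Cpower w (p + q) = (Cpower w p * Cpower w q)%C.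
Proof. unfold Cpower. rewrite <- Cexp_plus. f_equal. ring. Qed.

Lemma Cpower_0 w : Cpower w 0 = RtoC 1.
Proof. unfold Cpower. replace (0 * Cln w)%C with (RtoC 0) by ring. apply Cexp_0. Qed.

Lemma Cpower_1 w : 0 < Re w -> Cpower w 1 = w.
Proof.
  intros H. unfold Cpower. replace (1 * Cln w)%C with (Cln w) by ring. now apply Cexp_Cln.
Qed.

Lemma Cpower_INR w n : 0 < Re w -> Cpower w (INR n) = (w ^ n)%C.
Proof. intros H. unfold Cpower. rewrite Cexp_INR. now rewrite Cexp_Cln. Qed.

Lemma Cpower_scal (r : R) w p : 0 < r -> 0 < Re w ->
  Cpower (RtoC r * w) p = (Cexp (p * ln r) * Cpower w p)%C.
Proof. intros Hr H. unfold Cpower. rewrite Cln_scal by auto. rewrite <- Cexp_plus. f_equal. ring.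
  Qed.

Lemma Cmod_Cpower w p : 0 < Re w ->
  Cmod (Cpower w p) <= exp (Re p * ln (Cmod w)) * exp (Rabs (Im p) * PI).
Proof.
  intros H. unfold Cpower. rewrite Cmod_Cexp, <- exp_plus.
  assert (h : Re (p * Cln w)%C <= Re p * ln (Cmod w) + Rabs (Im p) * PI).
  { change (Re p * ln (Cmod w) - Im p * Carg w <= Re p * ln (Cmod w) + Rabs (Im p) * PI).
    assert (h := Carg_bound w H).
    assert (h2 : Rabs (Im p * Carg w) <= Rabs (Im p) * PI).
    { rewrite Rabs_mult. apply Rmult_le_compat_l; auto. apply Rabs_pos. }
    assert (h3 := Rle_abs (- (Im p * Carg w))). rewrite Rabs_Ropp in h3. lra. }
  destruct h as [h|h]; [left; now apply exp_increasing|rewrite h; lra].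
Qed.

Lemma path_deriv_Cpower w p t : 0 < Re (w + RtoC t)%C ->
  path_deriv (fun v => Cpower (w + RtoC v) p) t (p * Cpower (w + RtoC t) (p - 1))%C.
Proof.
  intros H.
  apply (path_deriv_ext _ _ (p * / (w + RtoC t) * Cpower (w + RtoC t) p)%C).
  - replace p with (p - 1 + 1)%C at 2 by ring. rewrite Cpower_plus, Cpower_1 by auto.
    field. now apply Cneq0_Re.
  - apply (path_deriv_exp (fun v => p * Cln (w + RtoC v))%C). apply path_deriv_scal.
      now apply path_deriv_Cln.
Qed.

Lemma entire_Cpower w p : entire (fun s => Cpower w (p - s)).
Proof.
  apply (entire_ext (fun s => Cpower w p * Cexp (- Cln w * s))%C).
  - intros s. unfold Cpower. rewrite <- Cexp_plus. f_equal. ring.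
  - apply entire_mult; [apply entire_const|apply entire_Cexp].
Qed.

(** * Cauchy's estimate *)

Definition tau_i : C := (0, 2 * PI).

Lemma Cexp_2PI n : Cexp (INR n * tau_i) = RtoC 1.
Proof.
  rewrite Cexp_INR. replace (Cexp tau_i) with (RtoC 1); [apply Cpow_1_l|].
  unfold Cexp, tau_i, Re, Im. simpl. rewrite exp_0, cos_2PI, sin_2PI. apply C_ext; unfold Re, Im;
    simpl; ring.
Qed.

Definition root (n : nat) : C := Cexp (/ INR n * tau_i).

Lemma Cmod_root n k : Cmod (root n ^ k)%C = 1.
Proof.
  rewrite Cmod_pow. unfold root. rewrite Cmod_Cexp.
  replace (Re (/ INR n * tau_i)%C) with 0.
  - rewrite exp_0. apply pow1.
  - destruct n as [|n].
    + unfold Re; simpl. unfold Rdiv. ring.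
    + rewrite <- RtoC_inv by (rewrite S_INR; assert (h := pos_INR n); lra).
      rewrite re_scal_l. unfold Re; simpl. ring.
Qed.

(** With [a = PI * d / n], equality would give [cos (2 a) = 1], whereas [0 < a < PI] makes [sin a]
    positive. *)
Lemma root_neq_1 n d : (0 < d < n)%nat -> (root n ^ d)%C <> RtoC 1.
Proof.
  intros Hd e. unfold root in e. rewrite <- Cexp_INR in e.
  assert (Hn : 0 < INR n) by (apply lt_0_INR; lia).
  assert (hd : 0 < INR d < INR n) by (split; [apply lt_0_INR; lia|apply lt_INR; lia]).
  assert (E : (INR d * (/ INR n * tau_i))%C = (0, 2 * (INR d / INR n * PI))).
  { rewrite <- RtoC_inv by lra. apply C_ext; unfold Re, Im; simpl; unfold Rdiv; ring. }
  rewrite E in e. unfold Cexp in e. apply (f_equal fst) in e.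
  unfold Re, Im in e. simpl in e. rewrite exp_0, cos_2a_sin in e.
  assert (hq : 0 < INR d / INR n < 1).
  { split; [apply Rdiv_lt_0_compat; lra|].
    apply Rmult_lt_reg_r with (INR n); auto. unfold Rdiv. rewrite Rmult_assoc, Rinv_l; lra. }
  assert (HPI := PI_RGT_0).
  assert (hs : 0 < sin (INR d / INR n * PI)) by (apply sin_gt_0; nra).
  nra.
Qed.

Lemma root_pow_n n : (0 < n)%nat -> (root n ^ n)%C = RtoC 1.
Proof.
  intros Hn. unfold root. rewrite <- Cexp_INR.
  replace (INR n * (/ INR n * tau_i))%C with (INR 1 * tau_i)%C.
  - apply Cexp_2PI.
  - simpl. field. intros e. apply RtoC_inj in e. assert (h : 0 < INR n) by now apply lt_0_INR. lra.
Qed.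

Lemma root_neq_0 n k : (root n ^ k)%C <> RtoC 0.
Proof. apply Cmod_gt_0. rewrite Cmod_root. lra. Qed.

(** Orthogonality: a geometric sum whose ratio is an [n]-th root of unity different from 1. *)
Lemma csum_root n m k : (m < n)%nat -> (k < n)%nat -> m <> k ->
  csum (fun j => root n ^ (j * m) / root n ^ (j * k))%C (seq 0 n) = RtoC 0.
Proof.
  intros Hm Hk Hmk.
  set (z := (root n ^ m / root n ^ k)%C).
  rewrite (csum_ext _ (fun j => z ^ j)%C).
  - assert (Hz : z <> RtoC 1).
    { intros e. assert (E : (root n ^ m)%C = (root n ^ k)%C).
      { replace (root n ^ m)%C with (z * root n ^ k)%C by (unfold z; field; apply root_neq_0).
        rewrite e. ring. }
      destruct (Nat.lt_total m k) as [h|[h|h]]; [|contradiction|].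
      - apply (root_neq_1 n (k - m)); [lia|].
        replace (root n ^ (k - m))%C with (root n ^ k / root n ^ m)%C.
        + rewrite E. field. apply root_neq_0.
        + replace k with (m + (k - m))%nat at 1 by lia. rewrite Cpow_add_r. field. apply root_neq_0.
      - apply (root_neq_1 n (m - k)); [lia|].
        replace (root n ^ (m - k))%C with (root n ^ m / root n ^ k)%C.
        + rewrite E. field. apply root_neq_0.
        + replace m with (k + (m - k))%nat at 1 by lia. rewrite Cpow_add_r. field.
            apply root_neq_0. }
    rewrite csum_geom by auto.
    assert (Hn1 : (1 - z)%C <> RtoC 0).
    { intros e. apply Hz. symmetry. now apply Ceq_minus. }
    assert (E : (z ^ n)%C = RtoC 1).
    { unfold z, Cdiv. rewrite Cpow_mult_l, Cpow_inv by apply root_neq_0.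
      rewrite <- !Cpow_mult_r, !(Nat.mul_comm _ n), !Cpow_mult_r, root_pow_n by lia.
      rewrite !Cpow_1_l. field. }
    rewrite E. field. auto.
  - intros j _. unfold z, Cdiv. rewrite Cpow_mult_l, Cpow_inv by apply root_neq_0.
    rewrite <- !Cpow_mult_r. now rewrite !(Nat.mul_comm j).
Qed.

Lemma rsum_const {I : Type} (B : R) (J : list I) : rsum (fun _ => B) J = INR (length J) * B.
Proof.
  unfold rsum. induction J as [|i J IH]; [simpl; ring|].
  simpl length. rewrite S_INR. simpl. rewrite IH. ring.
Qed.

Lemma csum_const {I : Type} (B : C) (J : list I) : csum (fun _ => B) J = (INR (length J) * B)%C.
Proof.
  unfold csum. induction J as [|i J IH]; [simpl; ring|].
  simpl length. rewrite S_INR, RtoC_plus. simpl. rewrite IH. ring.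
Qed.

(* Averaging over the [n]-th roots of unity isolates [c k R ^ k], up to the
   coefficients of index at least [n]. *)
Lemma cauchy_estimate a r c M f B k : 0 < r -> pser a r c M f ->
  (forall s, Cmod (s - a) <= r -> Cmod (f s) <= B) -> Cmod (c k) * r ^ k <= B.
Proof.
  intros Hr [Hb H] HB. apply le_epsilon. intros eps Heps.
  set (t := fun m => (c m * RtoC r ^ m)%C).
  destruct (bsum_tail t M Hb eps Heps) as (J0 & Hn0 & HJ0).
  (* [n] exceeds [k] and every index of [J0]: indices below [n] other than [k] average to 0, and
     those from [n] on have total size at most [eps]. *)
  set (n := S (k + list_max J0)).
  assert (Hn : 0 < INR n) by (apply lt_0_INR; unfold n; lia).
  assert (HnC : RtoC (INR n) <> RtoC 0) by (intros e; apply RtoC_inj in e; lra).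
  set (p := fun j => (a + RtoC r * root n ^ j)%C).
  assert (Hp : forall j, Cmod (p j - a) <= r).
  { intros j. unfold p. replace (a + r * root n ^ j - a)%C with (r * root n ^ j)%C by ring.
    rewrite Cmod_mult, Cmod_root, Cmod_R, Rabs_pos_eq; lra. }
  assert (Hs : is_sum
     (fun m => csum (fun j => / root n ^ (j * k) * (c m * (p j - a) ^ m))%C (seq 0 n))
     (csum (fun j => / root n ^ (j * k) * f (p j))%C (seq 0 n))).
  { apply (is_sum_csum (fun j m => / root n ^ (j * k) * (c m * (p j - a) ^ m))%C
      (fun j => / root n ^ (j * k) * f (p j))%C).
    intros j _. apply is_sum_scal, H, Hp. }
  assert (E : forall m, csum (fun j => / root n ^ (j * k) * (c m * (p j - a) ^ m))%C (seq 0 n)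
     = (t m * csum (fun j => root n ^ (j * m) / root n ^ (j * k))%C (seq 0 n))%C).
  { intros m. rewrite <- csum_scal. apply csum_ext. intros j _. unfold t, p.
    replace (a + r * root n ^ j - a)%C with (r * root n ^ j)%C by ring.
    rewrite Cpow_mult_l, <- Cpow_mult_r. unfold Cdiv. ring. }
  apply (is_sum_ext _ _ _ E) in Hs.
  set (h := fun m => if prop_dec (m = k) then (INR n * t m)%C else RtoC 0).
  assert (Hh : is_sum h (INR n * t k)%C).
  { replace (INR n * t k)%C with (h k)
      by (unfold h; destruct (prop_dec _) as [_|ne]; [ring|now elim ne]).
    apply is_sum_single. intros m Hm. unfold h. now destruct (prop_dec _). }
  assert (H2 := is_sum_minus _ _ _ _ Hs Hh).
  set (A := csum (fun j => / root n ^ (j * k) * f (p j))%C (seq 0 n)) in *.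
  assert (HA : Cmod A <= INR n * B).
  { eapply Rle_trans; [apply Cmod_csum_le|].
    replace (INR n) with (INR (length (seq 0 n))) by now rewrite length_seq.
    rewrite <- rsum_const. apply rsum_le. intros j _.
    rewrite Cmod_mult, Cmod_inv, Cmod_root by apply root_neq_0.
    rewrite Rinv_1, Rmult_1_l. auto. }
  assert (Hd : Cmod (A - INR n * t k) <= INR n * eps).
  { eapply is_sum_le; [exact H2|].
    set (g := fun m => if prop_dec (In m J0) then RtoC 0 else t m).
    assert (Hg : bsum g eps).
    { intros J HJ. rewrite (rsum_without J0).
      - eapply Rle_trans; [apply rsum_le|apply (HJ0 (without J0 J))].
        + intros m _. unfold g. destruct (prop_dec _); [|lra]. rewrite Cmod_0. apply Cmod_ge_0.
        + now apply NoDup_filter.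
        + intros i h'. now apply without_In in h'.
      - intros m Hm. unfold g. destruct (prop_dec _); [apply Cmod_0|contradiction]. }
    rewrite <- (Rabs_pos_eq (INR n)), <- Cmod_R by lra.
    eapply bsum_le; [|exact (bsum_scal (RtoC (INR n)) g eps Hg)].
    intros m. cbv beta. unfold h, g.
    destruct (prop_dec (m = k)) as [->|hmk].
    - rewrite (csum_ext _ (fun _ => RtoC 1)).
      + rewrite csum_const, length_seq.
        replace (t k * (INR n * 1) - INR n * t k)%C with (RtoC 0) by ring.
        rewrite Cmod_0. apply Cmod_ge_0.
      + intros j _. field. apply root_neq_0.
    - destruct (lt_dec m n) as [hm|hm].
      + rewrite csum_root by (unfold n in *; lia).
        replace (t m * 0 - 0)%C with (RtoC 0) by ring. rewrite Cmod_0. apply Cmod_ge_0.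
      + destruct (prop_dec (In m J0)) as [hi|hi].
        * exfalso. assert (h' := proj1 (list_max_le J0 (list_max J0)) (le_n _)).
          rewrite Forall_forall in h'. specialize (h' m hi). unfold n in hm. lia.
        * match goal with |- Cmod (t m * ?S - RtoC 0)%C <= _ =>
            replace (t m * S - 0)%C with (t m * S)%C by ring end.
          rewrite !Cmod_mult, (Cmod_R (INR n)), Rabs_pos_eq by lra. rewrite Rmult_comm.
          apply Rmult_le_compat_r; [apply Cmod_ge_0|].
          eapply Rle_trans; [apply Cmod_csum_le|].
          rewrite (rsum_ext _ (fun _ => 1)).
          -- rewrite rsum_const, length_seq. lra.
          -- intros j _. rewrite Cmod_div, !Cmod_root by apply root_neq_0. field. }
  replace (Cmod (c k) * r ^ k) with (Cmod (t k))
    by (unfold t; rewrite Cmod_mult, Cmod_RtoC_pow; lra).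
  apply Rmult_le_reg_l with (INR n); auto.
  replace (INR n * Cmod (t k)) with (Cmod (INR n * t k)%C)
    by (rewrite Cmod_mult, Cmod_R, Rabs_pos_eq; lra).
  replace (INR n * t k)%C with (A + - (A - INR n * t k))%C by ring.
  eapply Rle_trans; [apply Cmod_triangle|]. rewrite Cmod_opp. lra.
Qed.

(** Replaces the uncontrolled coefficient bound [M] by the supremum [B] of the function. Cauchy's
    estimate bounds each term by [B], and at half the radius the factors [2 ^ (- k)] sum to 2. *)
Lemma pser_shrink a r c M f B : 0 < r -> pser a r c M f ->
  (forall s, Cmod (s - a) <= r -> Cmod (f s) <= B) -> pser a (r / 2) c (2 * B) f.
Proof.
  intros Hr Hf HB. split; [|intros s Hs; apply Hf; lra].
  assert (HB0 : 0 <= B).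
  { eapply Rle_trans; [apply Cmod_ge_0|]. apply (HB a).
    replace (a - a)%C with (RtoC 0) by ring. rewrite Cmod_0. lra. }
  destruct (is_sum_geom (RtoC (1 / 2))) as [_ hg].
  { rewrite Cmod_R, Rabs_pos_eq; lra. }
  apply (bsum_scal (RtoC B)) in hg.
  rewrite !Cmod_R, (Rabs_pos_eq (1 / 2)), (Rabs_pos_eq B) in hg by lra.
  replace (2 * B) with (B * / (1 - 1 / 2)) by field.
  eapply bsum_le; [|exact hg]. intros k. simpl.
  replace (RtoC (r / 2)) with (RtoC r * RtoC (1 / 2))%C by (rewrite <- RtoC_mult; f_equal; field).
  rewrite Cpow_mult_l, Cmult_assoc, !Cmod_mult. apply Rmult_le_compat_r; [apply Cmod_ge_0|].
  rewrite (Cmod_R B), Rabs_pos_eq, Cmod_RtoC_pow by lra.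
  eapply cauchy_estimate; eauto.
Qed.

(** Entire terms come with expansions whose bounds are not uniform; suprema on the disc take their
    place through [pser_shrink]. The last clause is termwise differentiation at the centre. *)
Lemma entire_series a r (f : nat -> C -> C) (B : nat -> R) (F : C -> C) M :
  0 < r -> (forall n, entire (f n)) ->
  (forall n s, Cmod (s - a) <= r -> Cmod (f n s) <= B n) ->
  (forall L, NoDup L -> rsum B L <= M) ->
  (forall s, Cmod (s - a) <= r / 2 -> is_sum (fun n => f n s) (F s)) ->
  exists c', pser a (r / 2) c' (2 * M) F /\
    forall d, (forall n, has_deriv (f n) a (d n)) -> is_sum d (c' 1%nat).
Proof.
  intros Hr Hf HB HM HF.
  assert (Hc : forall n, exists c, pser a (r / 2) c (2 * B n) (f n)).
  { intros n. destruct (Hf n a r Hr) as (c & M' & h). exists c.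
    apply (pser_shrink _ _ _ _ _ _ Hr h). auto. }
  set (c := fun n => proj1_sig (constructive_indefinite_description _ (Hc n))).
  assert (Hc' : forall n, pser a (r / 2) (c n) (2 * B n) (f n)).
  { intros n. unfold c. now destruct constructive_indefinite_description. }
  destruct (weierstrass_double_series a (r / 2) c (fun n => 2 * B n) f F (2 * M)) as
    (c' & h1 & h2); auto.
  - lra.
  - intros L HL. rewrite rsum_scal. apply Rmult_le_compat_l; [lra|auto].
  - exists c'. split; auto. intros d Hd.
    eapply is_sum_ext; [|apply (h2 1%nat)]. intros n.
    apply (has_deriv_unique (f n) a); auto. eapply pser_has_deriv; [|apply Hc']. lra.
Qed.

(** * Bernoulli numbers *)

(** Each value depends on all the preceding ones, hence the recursion on whole lists. It says that
    the generating series of these numbers is inverse to that of [(e^t - 1) / t]. *)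
Fixpoint blist (n : nat) : list R :=
  match n with
  | O => 1 :: nil
  | S m => blist m ++
      (- rsum (fun k => nth k (blist m) 0 / INR (fact (m + 2 - k))) (seq 0 (S m))) :: nil
  end.

(* [beta k = B_k / k!], with [B_1 = - 1 / 2]. *)
Definition beta (k : nat) : R := nth k (blist k) 0.

Lemma length_blist n : length (blist n) = S n.
Proof. induction n as [|n IH]; [reflexivity|]. simpl. rewrite length_app, IH. simpl. lia. Qed.

Lemma nth_blist n k : (k <= n)%nat -> nth k (blist n) 0 = beta k.
Proof.
  induction n as [|n IH]; intros Hk.
  - now replace k with O by lia.
  - destruct (Nat.eq_dec k (S n)) as [->|h]; [reflexivity|].
    simpl. rewrite app_nth1 by (rewrite length_blist; lia). apply IH. lia.
Qed.

Lemma beta_0 : beta 0 = 1.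
Proof. reflexivity. Qed.

Lemma rsum_seq_S (f : nat -> R) n : rsum f (seq 0 (S n)) = rsum f (seq 0 n) + f n.
Proof. rewrite seq_S, rsum_app. unfold rsum at 2. simpl. ring. Qed.

Lemma beta_rec m : (1 <= m)%nat ->
  rsum (fun k => beta k / INR (fact (S m - k))) (seq 0 (S m)) = 0.
Proof.
  destruct m as [|m]; intros Hm; [lia|].
  rewrite rsum_seq_S. replace (S (S m) - S m)%nat with 1%nat by lia.
  assert (E : beta (S m) = - rsum (fun k => beta k / INR (fact (S (S m) - k))) (seq 0 (S m))).
  { unfold beta at 1. simpl blist. rewrite app_nth2 by (rewrite length_blist; lia).
    rewrite length_blist, Nat.sub_diag. simpl nth. f_equal. apply rsum_ext.
    intros k Hk. apply in_seq in Hk. rewrite nth_blist by lia. do 3 f_equal. lia. }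
  rewrite E. change (INR (fact 1)) with 1. set (v := rsum _ _). field.
Qed.

Lemma beta_1 : beta 1 = - (1 / 2).
Proof.
  assert (h := beta_rec 1 (le_n _)). unfold rsum in h. simpl in h.
  rewrite beta_0 in h. lra.
Qed.

Lemma beta_2 : beta 2 = 1 / 12.
Proof.
  assert (h := beta_rec 2 ltac:(lia)). unfold rsum in h. simpl in h.
  rewrite beta_0, beta_1 in h. lra.
Qed.

Lemma beta_3 : beta 3 = 0.
Proof.
  assert (h := beta_rec 3 ltac:(lia)). unfold rsum in h. simpl in h.
  rewrite beta_0, beta_1, beta_2 in h. lra.
Qed.

(** * The Euler-Maclaurin correction *)

Fixpoint falling (p : C) (k : nat) : C :=
  match k with O => RtoC 1 | S j => (falling p j * (p - INR j))%C end.

Lemma falling_S p k : falling p (S k) = (falling p k * (p - INR k))%C.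
Proof. reflexivity. Qed.

(* [phi k s] is the [k]-th derivative of [w ^ (1 - s)]. *)
Definition phi (k : nat) (s w : C) : C := (falling (1 - s) k * Cpower w (1 - INR k - s))%C.

(** The asymptotic form of [(s - 1) zeta(s, w)] for large [w]. The term of index 0 is [w ^ (1 - s)],
    which for [Re s > 1] is [s - 1] times the integral of [u ^ (- s)] over [u = w + t], [t >= 0]. *)
Definition em_corr (J : nat) (s w : C) : C :=
  csum (fun k => beta k * phi k s w)%C (seq 0 (S J)).

Lemma path_deriv_phi k s w t : 0 < Re (w + RtoC t)%C ->
  path_deriv (fun v => phi k s (w + RtoC v)) t (phi (S k) s (w + RtoC t)).
Proof.
  intros H. unfold phi.
  apply (path_deriv_ext _ _ (falling (1 - s) k * ((1 - INR k - s)
    * Cpower (w + RtoC t) (1 - INR k - s - 1)))%C).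
  - rewrite S_INR, RtoC_plus. simpl falling.
    replace (1 - (INR k + 1) - s)%C with (1 - INR k - s - 1)%C by ring. ring.
  - apply path_deriv_scal. now apply path_deriv_Cpower.
Qed.

Lemma entire_opp_plus (u : C) : entire (fun s => u - s)%C.
Proof.
  apply (entire_ext (fun s => u + - (1) * s)%C); [intros; ring|].
  apply entire_plus; [apply entire_const|]. apply entire_mult; [apply entire_const|apply entire_id].
Qed.

Lemma entire_falling k : entire (fun s => falling (1 - s) k).
Proof.
  induction k as [|k IH]; [apply (entire_const (RtoC 1))|].
  apply (entire_mult (fun s => falling (1 - s) k) (fun s => 1 - s - INR k)%C); auto.
  apply (entire_ext (fun s => (1 - INR k) - s)%C); [intros; ring|apply entire_opp_plus].
Qed.

Lemma entire_phi k w : entire (fun s => phi k s w).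
Proof. unfold phi. apply entire_mult; [apply entire_falling|apply entire_Cpower]. Qed.

Lemma entire_em_corr J w : entire (fun s => em_corr J s w).
Proof.
  unfold em_corr. apply (entire_csum (fun k s => beta k * phi k s w)%C).
  intros k. apply entire_mult; [apply entire_const|apply entire_phi].
Qed.

Lemma csum_seq_S (f : nat -> C) n : csum f (seq 0 (S n)) = (csum f (seq 0 n) + f n)%C.
Proof. rewrite seq_S, csum_app. unfold csum at 2. simpl. ring. Qed.

Lemma csum_triangle (F : nat -> nat -> C) J :
  csum (fun k => csum (fun i => F k i) (seq 0 (S (J - k)))) (seq 0 (S J))
  = csum (fun m => csum (fun k => F k (m - k)%nat) (seq 0 (S m))) (seq 0 (S J)).
Proof.
  induction J as [|J IH]; [reflexivity|].
  rewrite (csum_seq_S _ (S J)), (csum_seq_S (fun m => csum _ (seq 0 (S m))) (S J)), <- IH.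
  rewrite (csum_seq_S (fun k => F k (S J - k)%nat) (S J)).
  rewrite (csum_ext (fun k => csum _ (seq 0 (S (S J - k))))
    (fun k => csum (fun i => F k i) (seq 0 (S (J - k))) + F k (S J - k)%nat)%C (seq 0 (S J))).
  - rewrite csum_plus, Nat.sub_diag.
    replace (csum (fun i => F (S J) i) (seq 0 1)) with (F (S J) O) by (unfold csum; simpl; ring).
    ring.
  - intros k Hk. apply in_seq in Hk. replace (S J - k)%nat with (S (J - k)) by lia.
    now rewrite csum_seq_S.
Qed.

Lemma csum_minus {I : Type} (f g : I -> C) J :
  csum (fun i => f i - g i)%C J = (csum f J - csum g J)%C.
Proof. unfold csum. induction J as [|i J IH]; simpl; [|rewrite IH]; ring. Qed.

Lemma RtoC_rsum {I : Type} (f : I -> R) J : RtoC (rsum f J) = csum (fun i => RtoC (f i)) J.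
Proof.
  unfold csum, rsum. induction J as [|i J IH]; simpl; [reflexivity|]. now rewrite RtoC_plus, IH.
Qed.

(** Collected by the order [m = k + i], the coefficients are the sums of [beta k / (m - k)!]. They
    are those of [e^t * t / (e^t - 1) = t / (e^t - 1) + t], so each is again [beta m], except for an
    extra 1 at [m = 1]. *)
Lemma em_corr_taylor J s w : (1 <= J)%nat ->
  csum (fun k => beta k * csum (fun i => / INR (fact i) * phi (k + i) s w)%C (seq 0 (S (J - k))))%C
    (seq 0 (S J)) = (em_corr J s w + phi 1 s w)%C.
Proof.
  intros HJ.
  rewrite (csum_ext _ (fun k => csum (fun i => beta k * (/ INR (fact i) * phi (k + i) s w))%C
     (seq 0 (S (J - k))))) by (intros; now rewrite csum_scal).
  rewrite (csum_triangle (fun k i => beta k * (/ INR (fact i) * phi (k + i) s w))%C J).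
  assert (E : forall m, csum (fun k => beta k * (/ INR (fact (m - k)) * phi (k + (m - k)) s w))%C
      (seq 0 (S m)) = (RtoC (beta m + (if Nat.eq_dec m 1 then 1 else 0)) * phi m s w)%C).
  { intros m.
    rewrite (csum_ext _ (fun k => phi m s w * RtoC (beta k / INR (fact (m - k))))%C).
    - rewrite csum_scal, <- RtoC_rsum, Cmult_comm. do 2 f_equal.
      destruct m as [|[|m]].
      + unfold rsum. simpl. field.
      + unfold rsum. simpl. rewrite beta_0. field.
      + rewrite rsum_seq_S, Nat.sub_diag.
        rewrite (beta_rec (S m)) by lia. simpl. field.
    - intros k Hk. apply in_seq in Hk. replace (k + (m - k))%nat with m by lia.
      rewrite RtoC_div by apply INR_fact_neq_0. unfold Cdiv. ring. }
  rewrite (csum_ext _ _ _ (fun m _ => E m)).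
  rewrite (csum_ext _ (fun m => beta m * phi m s w
     + (if Nat.eq_dec m 1 then phi 1 s w else RtoC 0))%C).
  - rewrite csum_plus. unfold em_corr. f_equal.
    destruct J as [|J]; [lia|]. clear HJ. induction J as [|J IH].
    + unfold csum. simpl. ring.
    + rewrite csum_seq_S, IH. destruct (Nat.eq_dec (S (S J)) 1); [lia|ring].
  - intros m _. destruct (Nat.eq_dec m 1) as [->|]; rewrite RtoC_plus; ring.
Qed.

Definition beta_const (J : nat) : R := 2 * rsum (fun k => Rabs (beta k)) (seq 0 (S J)).

Lemma beta_const_ge0 J : 0 <= beta_const J.
Proof.
  unfold beta_const. apply Rmult_le_pos; [lra|]. apply rsum_ge0. intros; apply Rabs_pos.
Qed.

(** Since [phi 1 s w = - (s - 1) w ^ (- s)], the Taylor polynomials of the terms at [w + 1] cancel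
    everything else, by [em_corr_taylor]. Expanding the [k]-th term to order [J - k] puts all the
    remainders in terms of the same derivative [phi (S J)]. *)
Lemma em_corr_step J s w B : (1 <= J)%nat -> 0 < Re w ->
  (forall t, 0 <= t <= 1 -> Cmod (phi (S J) s (w + RtoC t)) <= B) ->
  Cmod ((s - 1) * Cpower w (- s) + em_corr J s (w + 1) - em_corr J s w)%C <= beta_const J * B.
Proof.
  intros HJ Hw HB.
  assert (HB0 : 0 <= B) by (eapply Rle_trans; [apply Cmod_ge_0|apply (HB 0); lra]).
  replace ((s - 1) * Cpower w (- s) + em_corr J s (w + 1) - em_corr J s w)%C
    with (csum (fun k => beta k * (phi k s (w + 1)
       - csum (fun i => / INR (fact i) * phi (k + i) s w) (seq 0 (S (J - k)))))%C (seq 0 (S J))).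
  - eapply Rle_trans; [apply Cmod_csum_le|].
    unfold beta_const. replace (2 * rsum (fun k => Rabs (beta k)) (seq 0 (S J)) * B)
      with (2 * B * rsum (fun k => Rabs (beta k)) (seq 0 (S J))) by ring.
    rewrite <- rsum_scal. apply rsum_le. intros k Hk. apply in_seq in Hk.
    rewrite Cmod_mult, Cmod_R, Rmult_comm. apply Rmult_le_compat_r; [apply Rabs_pos|].
    assert (h := path_taylor (fun j t => phi (k + j) s (w + RtoC t)) (Re w) (J - k) B Hw).
    cbv beta in h. rewrite Nat.add_0_r in h.
    rewrite (csum_ext _ (fun i => / INR (fact i) * phi (k + i) s (w + 0))%C)
      by (intros; now replace (w + 0)%C with w by ring).
    eapply Rle_trans; [apply h|].
    + intros j t Ht. replace (k + S j)%nat with (S (k + j)) by lia. apply path_deriv_phi.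
      change (0 < Re w + t). lra.
    + intros t Ht. replace (k + S (J - k))%nat with (S J) by lia. auto.
    + rewrite <- (Rmult_1_r (2 * B)) at 2. unfold Rdiv.
      apply Rmult_le_compat_l; [lra|]. rewrite <- Rinv_1. apply Rinv_le_contravar; [lra|].
      apply (le_INR 1). apply (lt_O_fact (S (J - k))).
  - rewrite (csum_ext _ (fun k => beta k * phi k s (w + 1)
       - beta k * csum (fun i => / INR (fact i) * phi (k + i) s w) (seq 0 (S (J - k))))%C)
      by (intros; ring).
    rewrite csum_minus, em_corr_taylor by auto. unfold em_corr at 1.
    change (csum (fun k => beta k * phi k s (w + 1))%C (seq 0 (S J))) with (em_corr J s (w + 1)).
    assert (E : phi 1 s w = (- ((s - 1) * Cpower w (- s)))%C).
    { unfold phi. simpl falling. simpl INR. replace (1 - 1 - s)%C with (- s)%C by ring. ring. }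
    rewrite E. unfold em_corr. ring.
Qed.

(** * Decay of complex powers and convergence of the comparison series *)

Definition rising (A : R) (k : nat) : R := fold_right Rmult 1 (map (fun i => A + INR i) (seq 0 k)).

Lemma rising_S A k : rising A (S k) = rising A k * (A + INR k).
Proof.
  unfold rising. rewrite seq_S, map_app. generalize (map (fun i => A + INR i) (seq 0 k)).
  intros l. simpl. induction l as [|y l IH]; simpl; [ring|]. rewrite IH. ring.
Qed.

Lemma falling_bound p A k : Cmod p <= A -> Cmod (falling p k) <= rising A k.
Proof.
  intros H. assert (H0 := Cmod_ge_0 p). induction k as [|k IH].
  - simpl. rewrite Cmod_1. unfold rising. simpl. lra.
  - rewrite rising_S. simpl. rewrite Cmod_mult. apply Rmult_le_compat; auto using Cmod_ge_0.
    unfold Cminus. eapply Rle_trans; [apply Cmod_triangle|].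
    rewrite Cmod_opp, Cmod_R, Rabs_pos_eq by apply pos_INR. lra.
Qed.

Lemma exp_le_mono a b : a <= b -> exp a <= exp b.
Proof. intros [h| ->]; [left; now apply exp_increasing|lra]. Qed.

Lemma ln_le_mono a b : 0 < a -> a <= b -> ln a <= ln b.
Proof. intros Ha [h| ->]; [left; now apply ln_increasing|lra]. Qed.

(** Comes from [n + x0 >= min(1, x0) (n + 1)]: [Q] limits the negative power of [min(1, x0)], while
    [H * PI] pays for an imaginary exponent of size [H] against an argument of size at most [PI]. *)
Definition decay_const (x0 Q H : R) : R := exp (- Q * ln (Rmin 1 x0) + H * PI).

Lemma Cpower_decay x0 z p n rho Q H : 0 < x0 -> INR n + x0 <= Re z ->
  0 <= rho -> - Q <= Re p <= - rho -> Rabs (Im p) <= H ->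
  Cmod (Cpower z p) <= decay_const x0 Q H * Rpower (INR n + 1) (- rho).
Proof.
  intros Hx Hz Hrho Hp HH.
  assert (Hn := pos_INR n).
  assert (Hzp : 0 < Re z) by lra.
  assert (Hm : Re z <= Cmod z) by (rewrite <- (Rabs_pos_eq (Re z)) at 1 by lra; apply re_le_Cmod).
  set (c := Rmin 1 x0).
  assert (hc1 := Rmin_l 1 x0). assert (hc2 := Rmin_r 1 x0). fold c in hc1, hc2.
  assert (hc : 0 < c) by (apply Rmin_case; lra).
  assert (HPI := PI_RGT_0).
  eapply Rle_trans; [apply Cmod_Cpower; auto|].
  unfold decay_const, Rpower. rewrite <- !exp_plus. apply exp_le_mono. fold c.
  assert (h1 : Rabs (Im p) * PI <= H * PI) by (apply Rmult_le_compat_r; lra).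
  assert (h2 : ln c + ln (INR n + 1) <= ln (Cmod z)).
  { rewrite <- ln_mult by lra. apply ln_le_mono; nra. }
  assert (h3 : 0 <= ln (INR n + 1)) by (rewrite <- ln_1; apply ln_le_mono; lra).
  assert (h4 : ln c <= 0) by (rewrite <- ln_1; apply ln_le_mono; lra).
  assert (h5 : Re p * ln (Cmod z) <= Re p * (ln c + ln (INR n + 1))) by nra.
  nra.
Qed.

(** Integral comparison: by the mean value theorem a term is at most the drop of [t ^ (- q) / q]
    over the preceding unit interval, and these drops telescope. *)
Lemma Rpower_sum rho : 1 < rho -> exists M, forall n,
  rsum (fun k => Rpower (INR k + 1) (- rho)) (seq 0 n) <= M.
Proof.
  intros Hrho. set (q := rho - 1).
  assert (Hstep : forall n, Rpower (INR (S n) + 1) (- rho)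
     <= (Rpower (INR n + 1) (- q) - Rpower (INR (S n) + 1) (- q)) / q).
  { intros n. assert (Hn := pos_INR n). rewrite S_INR.
    destruct (MVT_cor2 (fun t => Rpower t (- q)) (fun t => - q * Rpower t (- q - 1))
      (INR n + 1) (INR n + 1 + 1)) as (c & E & Hc); [lra| |].
    - intros c Hc. apply derivable_pt_lim_power. lra.
    - apply Rmult_le_reg_r with q; [unfold q; lra|].
      unfold Rdiv. rewrite Rmult_assoc, Rinv_l, Rmult_1_r by (unfold q; lra).
      replace (Rpower (INR n + 1) (- q) - Rpower (INR n + 1 + 1) (- q))
        with (q * Rpower c (- q - 1)) by lra.
      rewrite Rmult_comm. apply Rmult_le_compat_l; [unfold q; lra|].
      replace (- q - 1) with (- rho) by (unfold q; ring).
      unfold Rpower. apply exp_le_mono.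
      assert (ln c <= ln (INR n + 1 + 1)) by (apply ln_le_mono; lra). nra. }
  assert (Hs : forall n, rsum (fun k => Rpower (INR k + 1) (- rho)) (seq 0 (S n))
     <= 1 + (1 - Rpower (INR n + 1) (- q)) / q).
  { induction n as [|n IH].
    - unfold rsum. simpl. rewrite Rplus_0_l. unfold Rpower. rewrite ln_1, !Rmult_0_r, exp_0.
      unfold Rdiv. ring_simplify. lra.
    - rewrite rsum_seq_S.
      specialize (Hstep n). unfold Rdiv in *. rewrite !Rmult_minus_distr_r in *. lra. }
  exists (1 + 1 / q). intros [|n].
  - unfold rsum. simpl. assert (0 < 1 / q) by (apply Rdiv_lt_0_compat; unfold q; lra). lra.
  - eapply Rle_trans; [apply Hs|]. unfold Rdiv. rewrite Rmult_minus_distr_r.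
    assert (0 <= Rpower (INR n + 1) (- q) * / q); [|lra].
    apply Rmult_le_pos; [left; apply exp_pos|]. left. apply Rinv_0_lt_compat. unfold q; lra.
Qed.

Lemma Rpower_lim rho : 0 < rho -> forall eps, 0 < eps -> exists N, forall n, (N <= n)%nat ->
  Rpower (INR n + 1) (- rho) < eps.
Proof.
  intros Hrho eps Heps. set (y := exp (- ln eps / rho)).
  destruct (nfloor_ex y) as [N HN]; [left; apply exp_pos|].
  exists N. intros n Hn. apply le_INR in Hn. assert (hn := pos_INR n).
  assert (h : - ln eps / rho < ln (INR n + 1)).
  { replace (- ln eps / rho) with (ln y) by (unfold y; apply ln_exp).
    apply ln_increasing; [apply exp_pos|lra]. }
  unfold Rpower. rewrite <- (exp_ln eps) by auto. apply exp_increasing.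
  assert (h2 : - ln eps / rho * rho < ln (INR n + 1) * rho) by (apply Rmult_lt_compat_r; auto).
  unfold Rdiv in h2. rewrite Rmult_assoc, Rinv_l in h2 by lra. lra.
Qed.

(** * The Hurwitz zeta function *)

Section Hurwitz.
Context (x : C) (Hx : 0 < Re x).

Lemma Re_shift n : Re (x + INR n)%C = INR n + Re x.
Proof. change (Re x + INR n = INR n + Re x). ring. Qed.

Lemma Re_shift_pos n : 0 < Re (x + INR n)%C.
Proof. rewrite Re_shift. assert (h := pos_INR n). lra. Qed.

Definition em_partial (J : nat) (s : C) (m : nat) : C :=
  ((s - 1) * csum (fun n => Cpower (x + INR n) (- s)) (seq 0 m) + em_corr J s (x + INR m))%C.

Lemma em_partial_step J s n : (em_partial J s (S n) - em_partial J s n)%C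
  = ((s - 1) * Cpower (x + INR n) (- s) + em_corr J s (x + INR n + 1) - em_corr J s (x + INR n))%C.
Proof.
  unfold em_partial. rewrite csum_seq_S, S_INR, RtoC_plus.
  replace (x + (INR n + 1))%C with (x + INR n + 1)%C by ring. ring.
Qed.

Lemma entire_em_partial J m : entire (fun s => em_partial J s m).
Proof.
  unfold em_partial. apply entire_plus; [|apply entire_em_corr].
  apply entire_mult.
  - apply (entire_ext (fun s => s + - (1))%C); [reflexivity|].
    apply entire_plus; [apply entire_id|apply entire_const].
  - apply (entire_csum (fun n s => Cpower (x + INR n) (- s))). intros n.
    apply (entire_ext (fun s => Cpower (x + INR n) (0 - s))); [|apply entire_Cpower].
    intros s. f_equal. ring.
Qed.

(** Uniform over [Cmod s <= A]: [rising (1 + A)] bounds the falling factorial in [phi (S J)], as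
    [Cmod (1 - s) <= 1 + A], and [decay_const] bounds its power. *)
Definition step_const (J : nat) (A : R) : R :=
  beta_const J * (rising (1 + A) (S J) * decay_const (Re x) (A + INR J) A).

Lemma step_const_ge0 J A : 0 <= A -> 0 <= step_const J A.
Proof.
  intros HA. unfold step_const. apply Rmult_le_pos; [apply beta_const_ge0|].
  apply Rmult_le_pos; [|left; apply exp_pos].
  eapply Rle_trans; [apply Cmod_ge_0|apply (falling_bound 0)]. rewrite Cmod_0. lra.
Qed.

Lemma Im_le_Cmod (z : C) : Rabs (Im z) <= Cmod z.
Proof. eapply Rle_trans; [apply Rmax_r|apply Rmax_Cmod]. Qed.

(** The power in [phi (S J)] has exponent [- s - J], of real part at most -2, so the increments are
    summable. *)
Lemma em_partial_step_bound J s A n : (1 <= J)%nat -> Cmod s <= A -> 2 <= Re s + INR J ->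
  Cmod (em_partial J s (S n) - em_partial J s n) <= step_const J A * Rpower (INR n + 1) (- (2)).
Proof.
  intros HJ HA Hs. rewrite em_partial_step.
  replace (step_const J A * Rpower (INR n + 1) (- (2))) with
    (beta_const J * (rising (1 + A) (S J) * (decay_const (Re x) (A + INR J) A * Rpower
      (INR n + 1) (- (2)))))
    by (unfold step_const; ring).
  apply em_corr_step; auto; [apply Re_shift_pos|].
  intros t Ht. unfold phi. rewrite Cmod_mult.
  assert (h1 := re_le_Cmod s). assert (h2 := Im_le_Cmod s).
  assert (h3 := Rle_abs (Re s)).
  apply Rmult_le_compat; auto using Cmod_ge_0.
  - apply falling_bound. unfold Cminus. eapply Rle_trans; [apply Cmod_triangle|].
    rewrite Cmod_1, Cmod_opp. lra.
  - assert (E : (1 - INR (S J) - s)%C = (- s - INR J)%C) by (rewrite S_INR, RtoC_plus; ring).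
    rewrite E. apply Cpower_decay; auto; try lra.
    + change (INR n + Re x <= Re x + INR n + t). lra.
    + change (- (A + INR J) <= - Re s - INR J <= - (2)). lra.
    + change (Rabs (- Im s - 0) <= A). replace (- Im s - 0) with (- Im s) by ring.
      rewrite Rabs_Ropp. lra.
Qed.

Lemma em_partial_sum J s : (1 <= J)%nat -> 2 <= Re s + INR J ->
  exists l, is_sum (fun n => em_partial J s (S n) - em_partial J s n)%C l.
Proof.
  intros HJ Hs. destruct (Rpower_sum 2) as [M HM]; [lra|].
  apply (is_sum_exists _ (step_const J (Cmod s) * M)).
  apply bsum_nat. intros n. eapply Rle_trans.
  - apply rsum_le. intros i _. apply (em_partial_step_bound J s (Cmod s)); auto. lra.
  - rewrite rsum_scal. apply Rmult_le_compat_l; [apply step_const_ge0, Cmod_ge_0|apply HM].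
Qed.

Lemma em_partial_telescope J s m : csum (fun n => em_partial J s (S n) - em_partial J s n)%C
  (seq 0 m) = (em_partial J s m - em_partial J s 0)%C.
Proof. induction m as [|m IH]; [unfold csum; simpl; ring|]. rewrite csum_seq_S, IH. ring. Qed.

Lemma em_partial_sum_clim J s l : is_sum (fun n => em_partial J s (S n) - em_partial J s n)%C l
  -> clim (em_partial J s) (em_partial J s 0 + l)%C.
Proof.
  intros H eps Heps. destruct (is_sum_nat _ _ H eps Heps) as [N HN].
  exists N. intros m Hm. specialize (HN m Hm). rewrite em_partial_telescope in HN.
  now replace (em_partial J s m - (em_partial J s 0 + l))%C with
    (em_partial J s m - em_partial J s 0 - l)%C by ring.
Qed.

Lemma phi_clim k s : 1 < Re s + INR k -> clim (fun m => phi k s (x + INR m)) (RtoC 0).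
Proof.
  intros Hs. unfold phi.
  replace (RtoC 0) with (falling (1 - s) k * 0)%C by ring. apply clim_scal.
  intros eps Heps. set (rho := Re s + INR k - 1).
  set (D := decay_const (Re x) rho (Rabs (Im s))).
  assert (HD : 0 < D) by apply exp_pos.
  destruct (Rpower_lim rho) with (eps := eps / D) as [N HN].
  - unfold rho. lra.
  - now apply Rdiv_lt_0_compat.
  - exists N. intros m Hm. specialize (HN m Hm).
    match goal with |- Cmod (?z - RtoC 0)%C < _ => replace (z - RtoC 0)%C with z by ring end.
    apply Rle_lt_trans with (D * Rpower (INR m + 1) (- rho)).
    + apply Cpower_decay; auto.
      * rewrite Re_shift. lra.
      * unfold rho. lra.
      * change (- rho <= 1 - INR k - Re s <= - rho). unfold rho. lra.
      * change (Rabs (0 - 0 - Im s) <= Rabs (Im s)). replace (0 - 0 - Im s) with (- Im s) by ring.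
        rewrite Rabs_Ropp. lra.
    + apply Rlt_le_trans with (D * (eps / D)); [now apply Rmult_lt_compat_l|].
      apply Req_le. field. lra.
Qed.

Lemma em_corr_S J s w : em_corr (S J) s w = (em_corr J s w + beta (S J) * phi (S J) s w)%C.
Proof. unfold em_corr. now rewrite csum_seq_S. Qed.

(** Raising the order adds one correction term, which tends to 0; the limit therefore does not
    depend on [J]. *)
Lemma em_partial_clim_S J s l : 0 < Re s + INR J -> clim (em_partial J s) l ->
  clim (em_partial (S J) s) l.
Proof.
  intros Hs H.
  apply (clim_ext (fun m => em_partial J s m + beta (S J) * phi (S J) s (x + INR m))%C).
  - intros m. unfold em_partial. rewrite em_corr_S. ring.
  - replace l with (l + beta (S J) * 0)%C by ring. apply clim_plus; auto.
    apply clim_scal, phi_clim. rewrite S_INR. lra.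
Qed.

Lemma em_partial_clim_le J K s l : 0 < Re s + INR J -> (J <= K)%nat -> clim (em_partial J s) l ->
  clim (em_partial K s) l.
Proof.
  intros Hs HJK H. induction HJK as [|K HJK IH]; auto.
  apply em_partial_clim_S; auto. apply le_INR in HJK. lra.
Qed.

(** Exceeds what convergence at [s] needs by 1, so that the same order works on the whole unit disc
    about [s]. *)
Definition em_order (s : C) : nat := S (Z.to_nat (up (3 - Re s))).

Lemma jj_ok s : (1 <= em_order s)%nat /\ 3 <= Re s + INR (em_order s).
Proof.
  split; [unfold em_order; lia|]. unfold em_order. rewrite S_INR.
  assert (h := proj1 (archimed (3 - Re s))).
  assert (h2 : IZR (up (3 - Re s)) <= INR (Z.to_nat (up (3 - Re s)))).
  { rewrite INR_IZR_INZ. apply IZR_le. lia. }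
  lra.
Qed.

(** Two admissible orders are compared at their sum. *)
Lemma em_partial_clim_ex s : exists l, forall J, (1 <= J)%nat -> 2 <= Re s + INR J ->
  clim (em_partial J s) l.
Proof.
  destruct (jj_ok s) as [h1 h2].
  destruct (em_partial_sum (em_order s) s h1 ltac:(lra)) as [l Hl]. apply em_partial_sum_clim in Hl.
  exists (em_partial (em_order s) s 0 + l)%C. intros J HJ Hs.
  destruct (em_partial_sum J s HJ Hs) as [l' Hl']. apply em_partial_sum_clim in Hl'.
  assert (E := clim_unique _ _ _ (em_partial_clim_le (em_order s) (em_order s + J) s _ ltac:(lra)
    ltac:(lia) Hl)
    (em_partial_clim_le J (em_order s + J) s _ ltac:(lra) ltac:(lia) Hl')).
  rewrite E. exact Hl'.
Qed.

(* [hurwitz s = (s - 1) * zeta(s, x)], which has no pole. *)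
Definition hurwitz (s : C) : C := proj1_sig (constructive_indefinite_description _
  (em_partial_clim_ex s)).

Lemma hurwitz_clim s J : (1 <= J)%nat -> 2 <= Re s + INR J -> clim (em_partial J s) (hurwitz s).
Proof. unfold hurwitz. destruct constructive_indefinite_description. auto. Qed.

(** The increments of [em_partial] are summed by [entire_series], and the initial term is added
    back. The second clause exchanges limit and derivative, which is how the derivative at -1 is
    later read off the partial sums. *)
Lemma hurwitz_pser a J : (1 <= J)%nat -> 3 <= Re a + INR J ->
  exists c M, pser a (1 / 2) c M hurwitz /\
    forall p, (forall m, has_deriv (fun s => em_partial J s m) a (p m)) -> clim p (c 1%nat).
Proof.
  intros HJ Ha. destruct (Rpower_sum 2) as [M HM]; [lra|].
  assert (Hre : forall s, Cmod (s - a) <= 1 -> 2 <= Re s + INR J).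
  { intros s Hs. assert (h := re_le_Cmod (s - a)%C). assert (h2 := Rle_abs (- Re (s - a)%C)).
    rewrite Rabs_Ropp in h2. change (Re (s - a)%C) with (Re s - Re a) in *. lra. }
  assert (HA : forall s, Cmod (s - a) <= 1 -> Cmod s <= Cmod a + 1).
  { intros s Hs. replace s with (a + (s - a))%C by ring.
    eapply Rle_trans; [apply Cmod_triangle|]. lra. }
  assert (HA0 := Cmod_ge_0 a).
  set (A := Cmod a + 1).
  destruct (entire_series a 1 (fun n s => em_partial J s (S n) - em_partial J s n)%C
    (fun n => step_const J A * Rpower (INR n + 1) (- (2)))
    (fun s => hurwitz s - em_partial J s 0)%C (step_const J A * M)) as (c & Hc & Hd).
  - lra.
  - intros n. apply (entire_ext (fun s => em_partial J s (S n) + - (1) * em_partial J s n)%C);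
      [intros; ring|].
    apply entire_plus; [apply entire_em_partial|]. apply entire_mult;
      [apply entire_const|apply entire_em_partial].
  - intros n s Hs. apply em_partial_step_bound; auto.
  - apply rsum_nat_bound.
    + intros n. apply Rmult_le_pos; [apply step_const_ge0; unfold A; lra|]. left. apply exp_pos.
    + intros n. rewrite rsum_scal.
      apply Rmult_le_compat_l; [apply step_const_ge0; unfold A; lra|apply HM].
  - intros s Hs. assert (h := Hre s ltac:(lra)).
    destruct (em_partial_sum J s HJ h) as [l Hl].
    assert (E := clim_unique _ _ _ (hurwitz_clim s J HJ h) (em_partial_sum_clim _ _ _ Hl)).
    rewrite E. now replace (em_partial J s 0 + l - em_partial J s 0)%C with l by ring.
  - destruct (entire_em_partial J 0 a (1 / 2)) as (c0 & M0 & H0); [lra|].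
    exists (fun k => c k + c0 k)%C, (2 * (step_const J A * M) + M0). split.
    + apply (pser_ext _ _ _ _ (fun s => (hurwitz s - em_partial J s 0) + em_partial J s 0)%C).
      * intros s _. ring.
      * now apply pser_plus.
    + intros p Hp. specialize (Hd (fun n => p (S n) - p n)%C).
      assert (Hs : is_sum (fun n => p (S n) - p n)%C (c 1%nat)).
      { apply Hd. intros n eps Heps.
        destruct (Hp (S n) (eps / 2)) as (e1 & He1 & H1); [lra|].
        destruct (Hp n (eps / 2)) as (e2 & He2 & H2); [lra|].
        exists (Rmin e1 e2). split; [apply Rmin_case; auto|]. intros s Hs.
        pose_rmin e1 e2.
        specialize (H1 s ltac:(lra)). specialize (H2 s ltac:(lra)).
        match goal with |- Cmod ?z <= _ => replace z with
          ((em_partial J s (S n) - em_partial J a (S n) - p (S n) * (s - a))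
            + - (em_partial J s n - em_partial J a n - p n * (s - a)))%C by ring end.
        eapply Rle_trans; [apply Cmod_triangle|]. rewrite Cmod_opp. lra. }
      rewrite <- (has_deriv_unique (fun s => em_partial J s 0) a (p O) (c0 1%nat)).
      * intros eps Heps. destruct (is_sum_nat _ _ Hs eps Heps) as [N HN].
        exists N. intros m Hm. specialize (HN m Hm).
        replace (csum (fun n => p (S n) - p n)%C (seq 0 m)) with (p m - p O)%C in HN.
        -- now replace (p m - (c 1%nat + p O))%C with (p m - p O - c 1%nat)%C by ring.
        -- clear. induction m as [|m IH]; [unfold csum; simpl; ring|].
           rewrite csum_seq_S, <- IH. ring.
      * apply Hp.
      * eapply pser_has_deriv; [|exact H0]. lra.
Qed.

Lemma hol_hurwitz a : hol hurwitz a.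
Proof.
  destruct (jj_ok a) as [h1 h2]. destruct (hurwitz_pser a (em_order a) h1 h2) as (c & M & H & _).
  exists (1 / 2), c, M. split; auto. lra.
Qed.

Lemma hurwitz_derive a J p : (1 <= J)%nat -> 3 <= Re a + INR J ->
  (forall m, has_deriv (fun s => em_partial J s m) a (p m)) ->
  exists d, has_deriv hurwitz a d /\ clim p d.
Proof.
  intros HJ Ha Hp. destruct (hurwitz_pser a J HJ Ha) as (c & M & H & Hd).
  exists (c 1%nat). split; auto. eapply pser_has_deriv; [|exact H]. lra.
Qed.

(** At [s = - j] the falling factorial of [1 + j] vanishes beyond order [j + 1]. The remainders are
    then zero, and [em_partial] is constant in [m], equal to its value at [m = 0]. *)
Lemma hurwitz_neg j J : (j + 3 <= J)%nat -> hurwitz (- INR j)%C = em_corr J (- INR j) x.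
Proof.
  intros HJ. assert (Hj := le_INR _ _ HJ). rewrite plus_INR in Hj. simpl in Hj.
  assert (hj := pos_INR j).
  assert (H := hurwitz_clim (- INR j)%C J ltac:(lia)).
  assert (Hre : Re (- INR j)%C = - INR j) by reflexivity.
  rewrite Hre in H. specialize (H ltac:(lra)).
  apply (clim_unique _ _ _ H).
  assert (Hff : forall k, (S (S j) <= k)%nat -> falling (1 - - INR j) k = RtoC 0).
  { intros k Hk. induction Hk as [|k Hk IH]; rewrite falling_S.
    - replace (1 - - INR j - INR (S j))%C with (RtoC 0); [ring|].
      rewrite S_INR, RtoC_plus. ring.
    - rewrite IH. ring. }
  apply (clim_ext (fun _ => em_corr J (- INR j) x)); [|apply clim_const].
  assert (HU : forall n, em_partial J (- INR j) (S n) = em_partial J (- INR j) n).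
  { intros n. apply Ceq_minus, Cmod_eq_0. apply Rle_antisym; [|apply Cmod_ge_0].
    rewrite em_partial_step. rewrite <- (Rmult_0_r (beta_const J)).
    apply em_corr_step; [lia|apply Re_shift_pos|].
    intros t _. unfold phi. rewrite Hff by lia. rewrite Cmult_0_l, Cmod_0. lra. }
  intros n. induction n as [|n IH].
  - unfold em_partial. change (csum (fun n => Cpower (x + INR n) (- - INR j)) (seq 0 0)) with
      (RtoC 0).
    change (INR 0) with 0. replace (x + 0)%C with x by ring. ring.
  - now rewrite HU.
Qed.

(** For [Re s > 1] order 1 already suffices, and both correction terms tend to 0. *)
Lemma hurwitz_series s : 1 < Re s -> is_sum (fun n => Cpower (x + INR n) (- s))
  (hurwitz s / (s - 1))%C /\
  exists M, bsum (fun n => Cpower (x + INR n) (- s)) M.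
Proof.
  intros Hs.
  assert (Hs1 : (s - 1)%C <> RtoC 0).
  { apply Cneq0_Re. change (0 < Re s - 1). lra. }
  destruct (Rpower_sum (Re s) Hs) as [M HM].
  assert (Hb : bsum (fun n => Cpower (x + INR n) (- s))
    (decay_const (Re x) (Re s) (Rabs (Im s)) * M)).
  { apply bsum_nat. intros n. eapply Rle_trans.
    - apply rsum_le. intros i _. apply (Cpower_decay (Re x) _ _ i (Re s) (Re s) (Rabs (Im s)));
        auto.
      + rewrite Re_shift. lra.
      + lra.
      + change (- Re s <= - Re s <= - Re s). lra.
      + change (Rabs (- Im s) <= Rabs (Im s)). rewrite Rabs_Ropp. lra.
    - rewrite rsum_scal. apply Rmult_le_compat_l; [left; apply exp_pos|apply HM]. }
  split; [|eexists; exact Hb].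
  destruct (is_sum_exists _ _ Hb) as [l Hl].
  replace (hurwitz s / (s - 1))%C with l; auto.
  assert (E : hurwitz s = ((s - 1) * l)%C); [|rewrite E; field; auto].
  apply (clim_unique (em_partial 1 s)); [apply hurwitz_clim; [lia|simpl; lra]|].
  replace ((s - 1) * l)%C with ((s - 1) * l + csum (fun k => beta k * 0)%C (seq 0 2))%C
    by (unfold csum; simpl; ring).
  unfold em_partial. apply clim_plus.
  - apply clim_scal. intros eps Heps. exact (is_sum_nat _ _ Hl eps Heps).
  - unfold em_corr. apply (clim_csum (fun k m => beta k * phi k s (x + INR m))%C).
    intros k Hk. apply clim_scal, phi_clim. assert (h := pos_INR k). lra.
Qed.

End Hurwitz.

(** * Binomial coefficients *)

(** This and the next lemmas state the binomial identities with the standard operations on [nat], in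
    which [lia] works. *)
Lemma bin_pascal n m : 'C(S n, S m) = ('C(n, S m) + 'C(n, m))%nat.
Proof. exact (binS n m). Qed.

Lemma bin_zero n : 'C(n, 0) = 1%nat.
Proof. exact (bin0 n). Qed.

Lemma bin_gt n m : (n < m)%nat -> 'C(n, m) = 0%nat.
Proof.
  revert m. induction n as [|n IH]; intros [|m] H; try lia; [reflexivity|].
  rewrite bin_pascal, !IH by lia. reflexivity.
Qed.

Lemma bin_diag n : 'C(n, n) = 1%nat.
Proof.
  induction n as [|n IH]; [reflexivity|]. rewrite bin_pascal, IH, bin_gt by lia. reflexivity.
Qed.

Lemma bin_absorb n m : (S m * 'C(S n, S m) = S n * 'C(n, m))%nat.
Proof. symmetry. exact (mul_bin_diag (S n) m). Qed.

(** * Sums over tuples *)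

(** A list of positive length either starts with 0 or arises by incrementing the head of one with
    smaller total. This dichotomy is Pascal's rule, so the count follows by the same double
    recursion. *)
Fixpoint compositions (n : nat) : nat -> list (list nat) :=
  match n with
  | O => fun k => match k with O => nil :: nil | S _ => nil end
  | S n' => fix aux k := map (cons O) (compositions n' k) ++
      match k with
      | O => nil
      | S k' => map (fun l => match l with nil => nil | a :: l' => S a :: l' end) (aux k')
      end
  end.

Lemma compositions_S0 n : compositions (S n) 0 = map (cons O) (compositions n 0).
Proof. simpl. apply app_nil_r. Qed.

Lemma compositions_SS n k : compositions (S n) (S k) = map (cons O) (compositions n (S k)) ++
  map (fun l => match l with nil => nil | a :: l' => S a :: l' end) (compositions (S n) k).
Proof. reflexivity. Qed.

Lemma compositions_In n : forall k l, In l (compositions n k) <-> length l = n /\ list_sum l = k.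
Proof.
  induction n as [|n IH].
  - intros [|k] l; simpl.
    + split; [intros [<-|[]]; auto|]. intros [h _]. left. destruct l; [auto|discriminate].
    + split; [easy|]. intros [h h']. destruct l; discriminate.
  - intros k. induction k as [|k IHk]; intros l.
    + rewrite compositions_S0, in_map_iff. split.
      * intros (l' & <- & h). apply IH in h. simpl. lia.
      * intros [h1 h2]. destruct l as [|a l]; [discriminate|]. simpl in *.
        exists l. split; [f_equal; lia|]. apply IH. lia.
    + rewrite compositions_SS, in_app_iff, !in_map_iff. split.
      * intros [(l' & <- & h)|(l' & <- & h)].
        -- apply IH in h. simpl. lia.
        -- apply IHk in h. destruct l' as [|a l']; simpl in *; lia.
      * intros [h1 h2]. destruct l as [|[|a] l]; [discriminate| |]; simpl in *.
        -- left. exists l. split; auto. apply IH. lia.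
        -- right. exists (a :: l). split; auto. apply IHk. simpl. lia.
Qed.

Lemma compositions_NoDup n : forall k, NoDup (compositions n k).
Proof.
  induction n as [|n IH].
  - intros [|k]; simpl; constructor; [easy|constructor].
  - intros k. induction k as [|k IHk].
    + rewrite compositions_S0. apply FinFun.Injective_map_NoDup; auto. intros a b e. congruence.
    + rewrite compositions_SS. apply NoDup_app_disj.
      * apply FinFun.Injective_map_NoDup; auto. intros a b e. congruence.
      * apply NoDup_map_NoDup_ForallPairs; auto.
        intros a b Ha Hb. apply compositions_In in Ha, Hb.
        destruct a, b; simpl in *; try lia. congruence.
      * intros l Hl Hl'. apply in_map_iff in Hl, Hl'.
        destruct Hl as (l1 & <- & h1). destruct Hl' as (l2 & e & h2).
        destruct l1; discriminate.
Qed.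

Lemma compositions_length n : forall k, length (compositions (S n) k) = 'C(k + n, n).
Proof.
  induction n as [|n IH]; intros k.
  - rewrite bin_zero. induction k as [|k IHk]; [reflexivity|].
    rewrite compositions_SS, length_app, !length_map, IHk. reflexivity.
  - induction k as [|k IHk].
    + rewrite compositions_S0, length_map, IH. simpl. now rewrite !bin_diag.
    + rewrite compositions_SS, length_app, !length_map, IH, IHk.
      replace (S k + S n)%nat with (S (k + S n)) by lia. rewrite bin_pascal.
      replace (S k + n)%nat with (k + S n)%nat by lia. lia.
Qed.

Lemma is_sum_tuple n (h : nat -> C) l M :
  bsum (fun m => INR 'C(m + n, n) * h m)%C M -> is_sum (fun m => INR 'C(m + n, n) * h m)%C l ->
  is_sum (fun t : (S n).-tuple nat => h (list_sum t)) l.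
Proof.
  intros Hb Hl.
  (* The sum is extended by zero to all lists, where the fibres of [list_sum] are enumerated by
     [compositions]; tuples re-enter at the end through the injection [tval]. *)
  set (F := fun l : list nat => if Nat.eq_dec (length l) (S n) then h (list_sum l) else RtoC 0).
  assert (Hfib : forall k, is_sum (fun l => if prop_dec (list_sum l = k) then F l else RtoC 0)
      (INR 'C(k + n, n) * h k)%C /\
     bsum (fun l => if prop_dec (list_sum l = k) then F l else RtoC 0)
       (Cmod (INR 'C(k + n, n) * h k)%C)).
  { intros k.
    assert (E : forall l, In l (compositions (S n) k) ->
      (if prop_dec (list_sum l = k) then F l else RtoC 0) = h k).
    { intros t Ht. apply compositions_In in Ht. destruct Ht as [h1 h2]. unfold F.
      destruct (prop_dec _); [|contradiction]. destruct (Nat.eq_dec _ _); [|contradiction].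
      now rewrite h2. }
    assert (E0 : forall l, ~ In l (compositions (S n) k) ->
      (if prop_dec (list_sum l = k) then F l else RtoC 0) = RtoC 0).
    { intros t Ht. rewrite compositions_In in Ht. unfold F.
      destruct (prop_dec _); auto. destruct (Nat.eq_dec _ _); auto. tauto. }
    split.
    - replace (INR 'C(k + n, n) * h k)%C with
        (csum (fun l => if prop_dec (list_sum l = k) then F l else RtoC 0) (compositions (S n) k)).
      + apply is_sum_finite; auto. apply compositions_NoDup.
      + rewrite (csum_ext _ _ _ E), csum_const. now rewrite compositions_length.
    - replace (Cmod (INR 'C(k + n, n) * h k)%C) with
        (rsum (fun l => Cmod (if prop_dec (list_sum l = k) then F l else RtoC 0))
          (compositions (S n) k)).
      + apply bsum_finite; auto. apply compositions_NoDup.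
      + rewrite (rsum_ext _ (fun _ => Cmod (h k))) by (intros t Ht; now rewrite E).
        rewrite rsum_const, compositions_length, Cmod_mult, Cmod_R, Rabs_pos_eq by apply pos_INR.
          ring. }
  assert (HbF : bsum F M).
  (* The bounds on the fibres are assembled on pairs (total, list) and pulled back along the graph
     of [list_sum]. *)
  { assert (h2 := bsum_prod (fun q : nat * list nat =>
        if prop_dec (list_sum (snd q) = fst q) then F (snd q) else RtoC 0)
      (fun k => Cmod (INR 'C(k + n, n) * h k)%C) M (fun k => proj2 (Hfib k)) Hb).
    assert (h3 := bsum_comp (fun t : list nat => (list_sum t, t)) _ _
      (fun a b (e : (list_sum a, a) = (list_sum b, b)) => f_equal snd e) h2).
    eapply bsum_le; [|exact h3]. intros t. simpl. destruct (prop_dec _) as [_|ne];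
      [lra|now elim ne]. }
  destruct (is_sum_exists F M HbF) as [l' Hl'].
  destruct (is_sum_partition list_sum F _ l' M HbF Hl' (fun k => proj1 (Hfib k))) as [h1 _].
  rewrite (is_sum_unique _ _ _ Hl h1).
  assert (Hinj : forall a b : (S n).-tuple nat, tval a = tval b -> a = b).
  { intros a b e. exact (eqtype.val_inj e). }
  assert (Hlen : forall t : (S n).-tuple nat, length (tval t) = S n).
  { intros t. exact (size_tuple t). }
  assert (E : forall t : (S n).-tuple nat, h (list_sum t) = F (tval t)).
  { intros t. unfold F. destruct (Nat.eq_dec _ _) as [_|ne]; [reflexivity|].
    elim ne. apply Hlen. }
  assert (Hbt := bsum_comp (fun t : (S n).-tuple nat => tval t) F M Hinj HbF).
  destruct (is_sum_exists _ _ Hbt) as [l2 Hl2].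
  assert (h2 : is_sum F l2).
  { apply (is_sum_image (fun t : (S n).-tuple nat => tval t) F l2 Hinj); auto.
    intros t Ht. unfold F. destruct (Nat.eq_dec _ _) as [e|]; auto.
    assert (He : is_true (eqtype.eq_op (seq.size t) (S n)))
      by exact (ssrbool.introT eqtype.eqP e).
    now elim (Ht (Tuple He)). }
  rewrite (is_sum_unique _ _ _ Hl' h2).
  eapply is_sum_ext; [|exact Hl2]. intros t. symmetry. apply E.
Qed.

(** * The Barnes zeta function *)

(** Total in [x], so that [barnes] can be defined by recursion without carrying a proof of
    [0 < Re x]. *)
Definition hurwitz_at (x s : C) : C :=
  match prop_dec (0 < Re x) with left H => hurwitz x H s | right _ => RtoC 0 end.

(* [barnes x n] is [zeta_(n+1)(., x)]: it continues
   [sum_m 'C(m + n, n) (x + m) ^ (- s)].  The recursion comes from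
   [(n + 1) 'C(m + n + 1, n + 1) = ((x + m) + (n + 1 - x)) 'C(m + n, n)]. *)
Fixpoint barnes (x : C) (n : nat) (s : C) : C :=
  match n with
  | O => (hurwitz_at x s * / (s - 1))%C
  | S n' => (/ INR n * (barnes x n' (s - 1) + (INR n - x) * barnes x n' s))%C
  end.

Lemma barnes_S x n s : barnes x (S n) s = (/ INR (S n) *
  (barnes x n (s - 1) + (INR (S n) - x) * barnes x n s))%C.
Proof. reflexivity. Qed.

Lemma INR_S_neq_0 n : RtoC (INR (S n)) <> RtoC 0.
Proof. intros e. apply RtoC_inj in e. assert (h := pos_INR n). rewrite S_INR in e. lra. Qed.

Lemma barnes_series x n s : 0 < Re x -> INR n + 1 < Re s ->
  is_sum (fun m => INR 'C(m + n, n) * Cpower (x + INR m) (- s))%C (barnes x n s) /\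
  exists M, bsum (fun m => INR 'C(m + n, n) * Cpower (x + INR m) (- s))%C M.
Proof.
  intros Hx. revert s. induction n as [|n IH]; intros s Hs.
  - simpl barnes. unfold hurwitz_at. destruct (prop_dec _) as [H|]; [|contradiction].
    destruct (hurwitz_series x H s) as [h1 [M h2]]; [simpl in Hs; lra|].
    assert (E : forall m, (INR 'C(m + 0, 0) * Cpower (x + INR m) (- s))%C =
      Cpower (x + INR m) (- s)).
    { intros m. rewrite bin_zero. simpl. ring. }
    split.
    + eapply is_sum_ext; [|exact h1]. intros m. now rewrite E.
    + exists M. eapply bsum_le; [|exact h2]. intros m. rewrite E. lra.
  - rewrite S_INR in Hs.
    destruct (IH (s - 1)%C) as [h1 [M1 b1]]; [change (Re (s - 1)%C) with (Re s - 1); lra|].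
    destruct (IH s) as [h2 [M2 b2]]; [lra|].
    set (u := (/ INR (S n))%C). set (v := (INR (S n) - x)%C).
    assert (E : forall m, (u * (INR 'C(m + n, n) * Cpower (x + INR m) (- (s - 1))
         + v * (INR 'C(m + n, n) * Cpower (x + INR m) (- s))))%C
       = (INR 'C(m + S n, S n) * Cpower (x + INR m) (- s))%C).
    { intros m. replace (- (s - 1))%C with (- s + 1)%C by ring.
      rewrite Cpower_plus, Cpower_1 by (rewrite Re_shift; assert (h := pos_INR m); lra).
      assert (e := bin_absorb (m + n) n). apply (f_equal INR) in e. rewrite !mult_INR in e.
      replace (S (m + n)) with (m + S n)%nat in e by lia.
      apply (f_equal RtoC) in e. rewrite !RtoC_mult in e.
      replace (RtoC (INR 'C(m + S n, S n))) with (u * (INR (S n) * INR 'C(m + S n, S n)))%C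
        by (unfold u; field; apply INR_S_neq_0).
      rewrite e, plus_INR, RtoC_plus. unfold u, v. ring. }
    split.
    + rewrite barnes_S. fold u v. eapply is_sum_ext; [exact E|].
      apply is_sum_scal, is_sum_plus; auto. now apply is_sum_scal.
    + exists (Cmod u * (M1 + Cmod v * M2)).
      eapply bsum_le; [|exact (bsum_scal u _ _ (bsum_plus _ _ _ _ b1 (bsum_scal v _ _ b2)))].
      intros m. rewrite <- E. lra.
Qed.

Lemma barnes_mer x n a : 0 < Re x -> mer (barnes x n) a.
Proof.
  intros Hx. revert a. induction n as [|n IH]; intros a.
  - destruct (prop_dec (a = RtoC 1)) as [->|ne].
    + exists 1%nat, (hurwitz_at x), 1. split; [lra|]. split.
      * unfold hurwitz_at. destruct (prop_dec _) as [H|]; [apply hol_hurwitz|contradiction].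
      * intros s Hs. simpl. field. apply Cmod_gt_0. lra.
    + apply hol_mer, hol_mult.
      * unfold hurwitz_at. destruct (prop_dec _) as [H|]; [apply hol_hurwitz|contradiction].
      * apply hol_inv. congruence.
  - change (mer (fun s => / INR (S n) * (barnes x n (s - 1) + (INR (S n) - x) * barnes x n s))%C a).
    apply mer_mult; [apply hol_mer, entire_hol, entire_const|].
    apply mer_plus; [apply mer_shift, IH|].
    apply mer_mult; auto. apply hol_mer, entire_hol, entire_const.
Qed.

(** The half-plane [Re s < 1] avoids the pole of the Hurwitz function and is stable under the shift
    [s - 1] of the recursion. *)
Lemma barnes_hol x n a : 0 < Re x -> Re a < 1 -> hol (barnes x n) a.
Proof.
  intros Hx. revert a. induction n as [|n IH]; intros a Ha.
  - apply hol_mult.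
    + unfold hurwitz_at. destruct (prop_dec _) as [H|]; [apply hol_hurwitz|contradiction].
    + apply hol_inv. intros <-. simpl in Ha. lra.
  - change (hol (fun s => / INR (S n) * (barnes x n (s - 1) + (INR (S n) - x) * barnes x n s))%C a).
    apply hol_mult; [apply entire_hol, entire_const|].
    apply hol_plus; [apply hol_shift, IH; change (Re a - 1 < 1); lra|].
    apply hol_mult; auto. apply entire_hol, entire_const.
Qed.

(** * The coefficient identity [(1 + t)^(n+1) (1 - t^2)^(-n-1) = (1 - t)^(-n-1)] *)

(** The coefficient of [t^m] in [c(t) d(t^2)], for sequences read as generating series. *)
Definition conv2 (c d : nat -> R) (m : nat) : R :=
  rsum (fun l => c (m - 2 * l)%nat * d l) (seq 0 (S (Nat.div2 m))).

(** Multiplication of a generating series by [t]. *)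
Definition delay (c : nat -> R) (j : nat) : R := match j with O => 0 | S i => c i end.

Lemma conv2_0 c d : conv2 c d 0 = c O * d O.
Proof. unfold conv2, rsum. simpl. ring. Qed.

Lemma conv2_1 c d : conv2 c d 1 = c 1%nat * d O.
Proof. unfold conv2, rsum. simpl. ring. Qed.

Lemma rsum_seq_shift (f : nat -> R) n : rsum f (seq 0 (S n)) =
  f O + rsum (fun i => f (S i)) (seq 0 n).
Proof. unfold rsum. simpl. rewrite <- seq_shift, map_map. reflexivity. Qed.

Lemma conv2_SS c d m : conv2 c d (S (S m)) = c (S (S m)) * d O + conv2 c (fun l => d (S l)) m.
Proof.
  unfold conv2. simpl Nat.div2. rewrite rsum_seq_shift. f_equal.
  apply rsum_ext. intros l _. do 2 f_equal. lia.
Qed.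

Lemma conv2_plus_l c c' d m : conv2 (fun j => c j + c' j) d m = conv2 c d m + conv2 c' d m.
Proof.
  unfold conv2. rewrite <- rsum_plus. apply rsum_ext. intros. ring.
Qed.

Lemma conv2_plus_r c d d' m : conv2 c (fun j => d j + d' j) m = conv2 c d m + conv2 c d' m.
Proof.
  unfold conv2. rewrite <- rsum_plus. apply rsum_ext. intros. ring.
Qed.

Lemma conv2_ext c c' d d' m : (forall j, c j = c' j) -> (forall j, d j = d' j) ->
  conv2 c d m = conv2 c' d' m.
Proof. intros H H'. unfold conv2. apply rsum_ext. intros. now rewrite H, H'. Qed.

Lemma conv2_delay_l c d m : conv2 (delay c) d (S m) = conv2 c d m.
Proof.
  (* [conv2_SS] advances by two and shifts [d]; hence two consecutive indices are treated together,
     for all [d]. *)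
  assert (H : forall d, conv2 (delay c) d (S m) = conv2 c d m
     /\ conv2 (delay c) d (S (S m)) = conv2 c d (S m)).
  { clear d. induction m as [|m IH]; intros d.
    - split; [now rewrite conv2_0, conv2_1|].
      rewrite conv2_SS, conv2_1, conv2_0. simpl. ring.
    - destruct (IH d) as [_ h]. split; auto.
      rewrite (conv2_SS (delay c)), (conv2_SS c). simpl.
      now rewrite (proj1 (IH _)). }
  apply H.
Qed.

Lemma conv2_delay_r c d m : conv2 c (delay d) (S (S m)) = conv2 c d m.
Proof. rewrite conv2_SS. simpl. ring_simplify. apply conv2_ext; auto. Qed.

(** The coefficients of [(1 + t)^N]; those of [(1 - t)^(- n - 1)] follow. *)
Definition binom_row (N j : nat) : R := INR 'C(N, j).
Definition binom_diag (n l : nat) : R := INR 'C(l + n, n).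

Lemma binom_row_S N j : binom_row (S N) j = binom_row N j + delay (binom_row N) j.
Proof.
  unfold binom_row, delay. destruct j as [|j]; [rewrite !bin_zero; simpl; ring|].
  now rewrite bin_pascal, plus_INR.
Qed.

Lemma binom_diag_S n l : binom_diag (S n) l = delay (binom_diag (S n)) l + binom_diag n l.
Proof.
  unfold binom_diag, delay. destruct l as [|l]; [simpl; rewrite !bin_diag; simpl; ring|].
  replace (S l + S n)%nat with (S (l + S n)) by lia. rewrite bin_pascal, plus_INR.
  now replace (l + S n)%nat with (S l + n)%nat at 2 by lia.
Qed.

(** With [P_n = (1 + t)^(n+1) (1 - t^2)^(- n - 1)], this is the coefficient form of
    [P_(n+1) = t P_(n+1) + P_n]. *)
Lemma conv2_step n m : conv2 (binom_row (S (S n))) (binom_diag (S n)) (S m)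
  = conv2 (binom_row (S (S n))) (binom_diag (S n)) m + conv2 (binom_row (S n)) (binom_diag n) (S m).
Proof.
  assert (H : forall m, conv2 (binom_row (S (S n))) (binom_diag (S n)) m
    = conv2 (binom_row (S n)) (binom_diag (S n)) m + conv2 (delay (binom_row (S n)))
      (binom_diag (S n)) m).
  { intros k. rewrite <- conv2_plus_l. apply conv2_ext; auto. intros; apply binom_row_S. }
  assert (H' : forall m, conv2 (binom_row (S n)) (binom_diag (S n)) m
    = conv2 (binom_row (S n)) (delay (binom_diag (S n))) m + conv2 (binom_row (S n))
      (binom_diag n) m).
  { intros k. rewrite <- conv2_plus_r. apply conv2_ext; auto. intros; apply binom_diag_S. }
  rewrite !H, conv2_delay_l, (H' (S m)). destruct m as [|m].
  - rewrite !conv2_1, !conv2_0. simpl. ring.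
  - rewrite conv2_delay_r, conv2_delay_l. ring.
Qed.

(** The series here is [1 / (1 - t^2)]; multiplied by [1 + t] it becomes [1 / (1 - t)]. *)
Lemma conv2_even m : conv2 (binom_row 0) (binom_diag 0) m + delay
  (conv2 (binom_row 0) (binom_diag 0)) m = 1.
Proof.
  assert (E : forall m, conv2 (binom_row 0) (binom_diag 0) (S (S m)) =
    conv2 (binom_row 0) (binom_diag 0) m).
  { intros k. rewrite conv2_SS. unfold binom_row at 1. rewrite bin_gt by lia. simpl INR.
    ring_simplify. apply conv2_ext; auto. intros j. unfold binom_diag. now rewrite !bin_zero. }
  assert (H : conv2 (binom_row 0) (binom_diag 0) m + delay (conv2 (binom_row 0) (binom_diag 0)) m
    = 1
     /\ conv2 (binom_row 0) (binom_diag 0) (S m) + conv2 (binom_row 0) (binom_diag 0) m = 1);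
       [|apply H].
  induction m as [|m [IH1 IH2]].
  - simpl. rewrite conv2_0, conv2_1. unfold binom_row, binom_diag. rewrite !bin_zero, bin_gt by
      lia. simpl. lra.
  - split; [simpl; lra|]. rewrite E. lra.
Qed.

Lemma conv2_id n : forall m, conv2 (binom_row (S n)) (binom_diag n) m = binom_diag n m.
Proof.
  induction n as [|n IH]; intros m.
  - rewrite (conv2_ext _ (fun j => binom_row 0 j + delay (binom_row 0) j) _ (binom_diag 0)) by
      (auto using binom_row_S).
    rewrite conv2_plus_l. replace (binom_diag 0 m) with 1 by
      (unfold binom_diag; now rewrite bin_zero).
    rewrite <- (conv2_even m). f_equal. destruct m as [|m].
    + rewrite conv2_0. simpl. ring.
    + apply conv2_delay_l.
  - induction m as [|m IHm].
    + rewrite conv2_0. unfold binom_row, binom_diag. rewrite bin_zero. simpl. ring.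
    + rewrite conv2_step, IH, IHm, (binom_diag_S n (S m)). simpl. ring.
Qed.

Lemma m1_pow_even m l : (2 * l <= m)%nat -> ((- (1)) ^ (m - 2 * l))%C = ((- (1)) ^ m)%C.
Proof.
  intros H. replace m with (2 * l + (m - 2 * l))%nat at 2 by lia.
  rewrite Cpow_add_r, Cpow_mult_r. replace ((- (1)) ^ 2)%C with (RtoC 1) by (simpl; ring).
  rewrite Cpow_1_l. ring.
Qed.

(** * The alternating Barnes zeta function *)

Definition alt_coef (n k : nat) : C := ((- (1)) ^ k * INR 'C(S n, k))%C.

Definition altz (x : C) (n : nat) (s : C) : C :=
  (Cexp (- ln 2 * s) * csum (fun k => alt_coef n k * barnes ((INR k + x) / 2) n s)
    (seq 0 (S (S n))))%C.

Lemma Re_half k x : 0 < Re x -> 0 < Re ((INR k + x) / 2)%C.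
Proof.
  intros Hx. replace ((INR k + x) / 2)%C with (RtoC (/ 2) * (INR k + x))%C
    by (rewrite RtoC_inv by lra; unfold Cdiv; ring).
  rewrite re_scal_l. change (0 < / 2 * (INR k + Re x)). assert (h := pos_INR k). lra.
Qed.

(** Here [k] counts the odd summation indices, chosen in [C(n + 1, k)] ways, and [m = k + 2 l] is
    the total. Pairs [(k, l)] are regrouped by [m]: the sign depends only on the parity of [m], and
    the multiplicities combine by [conv2_id]. *)
Lemma altz_series x n s : 0 < Re x -> INR n + 1 < Re s ->
  is_sum (fun m => (- (1)) ^ m * INR 'C(m + n, n) * Cpower (x + INR m) (- s))%C (altz x n s) /\
  exists M, bsum (fun m => (- (1)) ^ m * INR 'C(m + n, n) * Cpower (x + INR m) (- s))%C M.
Proof.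
  intros Hx Hs.
  set (f := fun m => Cpower (x + INR m) (- s)).
  assert (Hrow : forall k, exists M,
     is_sum (fun l => alt_coef n k * (INR 'C(l + n, n) * f (k + 2 * l)%nat))%C
       (alt_coef n k * (Cexp (- ln 2 * s) * barnes ((INR k + x) / 2) n s))%C /\
     bsum (fun l => INR 'C(l + n, n) * f (k + 2 * l)%nat)%C M).
  { intros k. destruct (barnes_series _ n s (Re_half k x Hx) Hs) as [h1 [M h2]].
    assert (E : forall l, (Cexp (- ln 2 * s)
        * (INR 'C(l + n, n) * Cpower ((INR k + x) / 2 + INR l) (- s)))%C
      = (INR 'C(l + n, n) * f (k + 2 * l)%nat)%C).
    { intros l. unfold f.
      replace (x + INR (k + 2 * l))%C with (RtoC 2 * ((INR k + x) / 2 + INR l))%C.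
      - rewrite Cpower_scal; [|lra|].
        + replace (- s * ln 2)%C with (- ln 2 * s)%C by ring. ring.
        + assert (h := Re_half k x Hx).
          change (0 < Re ((INR k + x) / 2)%C + INR l). assert (h' := pos_INR l). lra.
      - rewrite plus_INR, mult_INR, RtoC_plus, RtoC_mult. simpl (INR 2).
        replace (RtoC (1 + 1)) with (RtoC 2) by (f_equal; ring). field. }
    exists (Cmod (Cexp (- ln 2 * s)) * M). split.
    - apply is_sum_scal. eapply is_sum_ext; [exact E|]. now apply is_sum_scal.
    - eapply bsum_le; [|exact (bsum_scal _ _ _ h2)]. intros l. rewrite <- E. lra. }
  set (Mk := fun k => proj1_sig (constructive_indefinite_description _ (Hrow k))).
  assert (HM : forall k, is_sum (fun l => alt_coef n k * (INR 'C(l + n, n) * f (k + 2 * l)%nat))%C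
       (alt_coef n k * (Cexp (- ln 2 * s) * barnes ((INR k + x) / 2) n s))%C /\
     bsum (fun l => INR 'C(l + n, n) * f (k + 2 * l)%nat)%C (Mk k)).
  { intros k. unfold Mk. now destruct constructive_indefinite_description. }
  assert (H0 : forall k, ~ In k (seq 0 (S (S n))) -> alt_coef n k = RtoC 0).
  { intros k Hk. rewrite in_seq in Hk. unfold alt_coef. rewrite bin_gt by lia. simpl. ring. }
  assert (HMk : forall k, 0 <= Mk k) by (intros k; eapply bsum_ge0; apply HM).
  assert (Hb : bsum (fun q : nat * nat =>
      alt_coef n (fst q) * (INR 'C(snd q + n, n) * f (fst q + 2 * snd q)%nat))%C
      (rsum (fun k => Cmod (alt_coef n k * RtoC (Mk k))%C) (seq 0 (S (S n))))).
  { apply (bsum_prod _ (fun k => Cmod (alt_coef n k * RtoC (Mk k))%C)).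
    - intros k. rewrite Cmod_mult, Cmod_R, Rabs_pos_eq by auto. simpl.
      apply bsum_scal, HM.
    - apply (bsum_finite (fun k => alt_coef n k * RtoC (Mk k))%C); [apply seq_NoDup|].
      intros k Hk. rewrite H0 by auto. ring. }
  destruct (is_sum_exists _ _ Hb) as [l Hl].
  destruct (is_sum_prod _ _ l _ Hb Hl (fun k => proj1 (HM k))) as [h1 _].
  assert (El : l = altz x n s).
  { assert (h2 := is_sum_finite (fun k => alt_coef n k *
      (Cexp (- ln 2 * s) * barnes ((INR k + x) / 2) n s))%C
      (seq 0 (S (S n))) (seq_NoDup _ _)).
    rewrite (is_sum_unique _ _ _ h1 (h2 ltac:(intros k Hk; cbv beta; rewrite H0 by auto; ring))).
    unfold altz. rewrite <- csum_scal. apply csum_ext. intros; ring. }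
  rewrite <- El.
  destruct (is_sum_partition (fun q : nat * nat => (fst q + 2 * snd q)%nat) _
    (fun m => (- (1)) ^ m * INR 'C(m + n, n) * f m)%C l _ Hb Hl) as [h2 h3].
  - intros m. cbv beta.
    set (F := fun q : nat * nat => if prop_dec ((fst q + 2 * snd q)%nat = m)
       then (alt_coef n (fst q) * (INR 'C(snd q + n, n) * f (fst q + 2 * snd q)%nat))%C
       else RtoC 0).
    set (L := map (fun l => ((m - 2 * l)%nat, l)) (seq 0 (S (Nat.div2 m)))).
    assert (Hdiv : forall l, (2 * l <= m)%nat <-> (l <= Nat.div2 m)%nat).
    { intros j. assert (h := Nat.div2_odd m). destruct (Nat.odd m); simpl in h; lia. }
    replace ((- (1)) ^ m * INR 'C(m + n, n) * f m)%C with (csum F L).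
    + apply (is_sum_finite F).
      * apply FinFun.Injective_map_NoDup; [|apply seq_NoDup]. intros i j e. congruence.
      * intros [i j] Hij. unfold F. destruct (prop_dec _) as [e|]; auto. elim Hij.
        simpl in e. apply in_map_iff. exists j. split; [f_equal; lia|].
        apply in_seq. assert (h := proj1 (Hdiv j)). lia.
    + unfold L. unfold csum. rewrite map_map.
      change (csum (fun l => F ((m - 2 * l)%nat, l)) (seq 0 (S (Nat.div2 m)))
        = ((- (1)) ^ m * INR 'C(m + n, n) * f m)%C).
      change (INR 'C(m + n, n)) with (binom_diag n m). rewrite <- conv2_id. unfold conv2.
      rewrite RtoC_rsum.
      replace ((- (1)) ^ m * csum (fun i => RtoC (binom_row (S n) (m - 2 * i) * binom_diag n i))
         (seq 0 (S (Nat.div2 m))) * f m)%C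
        with ((- (1)) ^ m * f m * csum (fun i => RtoC
          (binom_row (S n) (m - 2 * i) * binom_diag n i))
         (seq 0 (S (Nat.div2 m))))%C by ring.
      rewrite <- csum_scal. apply csum_ext. intros j Hj. apply in_seq in Hj.
      assert (hj := proj2 (Hdiv j) ltac:(lia)).
      unfold F. cbn [fst snd]. destruct (prop_dec _) as [e|ne]; [|elim ne; lia].
      rewrite e. unfold alt_coef. rewrite m1_pow_even by auto.
      unfold binom_row, binom_diag. rewrite RtoC_mult. ring.
  - split; eauto.
Qed.

Lemma altz_mer x n a : 0 < Re x -> mer (altz x n) a.
Proof.
  intros Hx. apply mer_mult; [apply hol_mer, entire_hol, entire_Cexp|].
  apply (mer_csum (fun k s => alt_coef n k * barnes ((INR k + x) / 2) n s)%C). intros k.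
  apply mer_mult; [apply hol_mer, entire_hol, entire_const|]. now apply barnes_mer, Re_half.
Qed.

Lemma altz_hol x n a : 0 < Re x -> Re a < 1 -> hol (altz x n) a.
Proof.
  intros Hx Ha. apply hol_mult; [apply entire_hol, entire_Cexp|].
  apply (hol_csum (fun k s => alt_coef n k * barnes ((INR k + x) / 2) n s)%C). intros k.
  apply hol_mult; [apply entire_hol, entire_const|]. apply barnes_hol; auto. now apply Re_half.
Qed.

(** * Polynomial dependence on the parameter *)

(* A substitute for "polynomial of degree less than [d]" that is easy to propagate. *)
Fixpoint diff_nilp (h : R) (d : nat) (f : C -> C) : Prop :=
  match d with
  | O => forall y, 0 < Re y -> f y = RtoC 0
  | S d' => diff_nilp h d' (fun y => f (y + h) - f y)%C
  end.

Section Nilp.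
Context (h : R) (Hh : 0 <= h).

Lemma Re_plus_h y : 0 < Re y -> 0 < Re (y + RtoC h)%C.
Proof. intros Hy. change (0 < Re y + h). lra. Qed.

Lemma diff_nilp_ext d f g : (forall y, 0 < Re y -> f y = g y) -> diff_nilp h d f -> diff_nilp h d g.
Proof.
  revert f g. induction d as [|d IH]; intros f g E H; simpl in *.
  - intros y Hy. rewrite <- E; auto.
  - eapply IH; [|exact H]. intros y Hy. cbv beta. rewrite !E; auto. now apply Re_plus_h.
Qed.

Lemma diff_nilp_plus d f g : diff_nilp h d f -> diff_nilp h d g ->
  diff_nilp h d (fun y => f y + g y)%C.
Proof.
  revert f g. induction d as [|d IH]; intros f g Hf Hg; simpl in *.
  - intros y Hy. rewrite Hf, Hg by auto. ring.
  - eapply diff_nilp_ext; [|exact (IH _ _ Hf Hg)]. intros y _. cbv beta. ring.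
Qed.

Lemma diff_nilp_scal d f u : diff_nilp h d f -> diff_nilp h d (fun y => u * f y)%C.
Proof.
  revert f. induction d as [|d IH]; intros f Hf; simpl in *.
  - intros y Hy. rewrite Hf by auto. ring.
  - eapply diff_nilp_ext; [|exact (IH _ Hf)]. intros y _. cbv beta. ring.
Qed.

Lemma diff_nilp_shift d f : diff_nilp h d f -> diff_nilp h d (fun y => f (y + h))%C.
Proof.
  revert f. induction d as [|d IH]; intros f Hf; simpl in *.
  - intros y Hy. now apply Hf, Re_plus_h.
  - exact (IH _ Hf).
Qed.

Lemma diff_nilp_S d f : diff_nilp h d f -> diff_nilp h (S d) f.
Proof.
  intros H. change (diff_nilp h d (fun y => f (y + h) - f y)%C).
  apply (diff_nilp_ext d (fun y => f (y + h) + - (1) * f y)%C); [intros; ring|].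
  apply diff_nilp_plus; [now apply diff_nilp_shift|now apply diff_nilp_scal].
Qed.

Lemma diff_nilp_le d d' f : (d <= d')%nat -> diff_nilp h d f -> diff_nilp h d' f.
Proof. induction 1; auto using diff_nilp_S. Qed.

(** The discrete Leibniz rule: the difference of [y f(y)] is [y] times the difference of [f], plus
    [h f(y + h)]. *)
Lemma diff_nilp_mul_id d f : diff_nilp h d f -> diff_nilp h (S d) (fun y => y * f y)%C.
Proof.
  revert f. induction d as [|d IH]; intros f Hf.
  - simpl in *. intros y Hy. rewrite !Hf; auto; [ring|]. now apply Re_plus_h.
  - change (diff_nilp h (S d) (fun y => (y + h) * f (y + h) - y * f y)%C).
    apply (diff_nilp_ext _ (fun y => y * (f (y + h) - f y) + h * f (y + h))%C).
    + intros y _. ring.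
    + apply diff_nilp_plus; [exact (IH _ Hf)|].
      apply (diff_nilp_scal _ (fun y => f (y + h))%C). now apply diff_nilp_shift.
Qed.

Definition poly_like (f : C -> C) : Prop := exists d, diff_nilp h d f.

Lemma poly_like_ext f g : (forall y, 0 < Re y -> f y = g y) -> poly_like f -> poly_like g.
Proof. intros E [d H]. exists d. now apply (diff_nilp_ext d f). Qed.

Lemma poly_like_plus f g : poly_like f -> poly_like g -> poly_like (fun y => f y + g y)%C.
Proof.
  intros [d H] [d' H']. exists (d + d')%nat.
  apply diff_nilp_plus; (eapply diff_nilp_le; [|eassumption]); lia.
Qed.

Lemma poly_like_scal f u : poly_like f -> poly_like (fun y => u * f y)%C.
Proof. intros [d H]. exists d. now apply diff_nilp_scal. Qed.

Lemma poly_like_const u : poly_like (fun _ => u).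
Proof. exists 1%nat. simpl. intros; ring. Qed.

Lemma poly_like_mul_id f : poly_like f -> poly_like (fun y => y * f y)%C.
Proof. intros [d H]. exists (S d). now apply diff_nilp_mul_id. Qed.

Lemma poly_like_pow m : poly_like (fun y => y ^ m)%C.
Proof.
  induction m as [|m IH]; [apply (poly_like_const (RtoC 1))|].
  apply (poly_like_ext (fun y => y * y ^ m)%C); [reflexivity|]. now apply poly_like_mul_id.
Qed.

Lemma poly_like_csum {I : Type} (f : I -> C -> C) (L : list I) :
  (forall i, In i L -> poly_like (f i)) -> poly_like (fun y => csum (fun i => f i y) L).
Proof.
  induction L as [|i L IH]; intros H; [apply (poly_like_const (RtoC 0))|].
  apply (poly_like_plus (f i) (fun y => csum (fun i => f i y) L)); [apply H; now left|].
  apply IH. intros; apply H; now right.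
Qed.

(** The difference of an antiperiodic [f] is [- 2 f], again antiperiodic and killed by one
    difference fewer; by induction it vanishes, hence so does [f]. *)
Lemma poly_like_antiperiodic f : poly_like f -> (forall y, 0 < Re y -> f (y + h)%C = (- f y)%C) ->
  forall y, 0 < Re y -> f y = RtoC 0.
Proof.
  intros [d H]. revert f H. induction d as [|d IH]; intros f H Ha; [exact H|].
  assert (H2 := IH _ H). intros y Hy. cbv beta in H2.
  assert (E : (f (y + h) - f y)%C = RtoC 0).
  { apply H2; auto. intros z Hz. rewrite (Ha z Hz), (Ha (z + h)%C), (Ha z Hz); [ring|].
    now apply Re_plus_h. }
  rewrite Ha in E by auto.
  replace (f y) with (- / 2 * (- f y - f y))%C by field. rewrite E. ring.
Qed.

End Nilp.

(** All [s = - j] are treated at once because the recursion passes from [s] to [s - 1]. The step is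
    1/2 because moving [x] by 1 moves [(k + x) / 2] by 1/2. *)
Lemma barnes_poly_like n j : poly_like (1 / 2) (fun y => barnes y n (- INR j)).
Proof.
  assert (Hh : 0 <= 1 / 2) by lra.
  revert j. induction n as [|n IH]; intros j.
  - apply (poly_like_ext _ Hh (fun y => / (- INR j - 1) * em_corr (j + 3) (- INR j) y)%C).
    + intros y Hy. simpl. unfold hurwitz_at. destruct (prop_dec _) as [H|]; [|contradiction].
      rewrite (hurwitz_neg y H j (j + 3)) by lia. ring.
    + apply poly_like_scal; auto. unfold em_corr.
      apply (poly_like_csum _ Hh (fun k y => beta k * phi k (- INR j) y)%C).
      intros k _. apply poly_like_scal; auto. unfold phi.
      (* Up to [k = j + 1] the exponent is a natural number; beyond, the falling factorial is
         zero. *)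
      destruct (le_lt_dec k (S j)) as [hk|hk].
      * apply (poly_like_ext _ Hh (fun y => falling (1 - - INR j) k * y ^ (S j - k))%C).
        -- intros y Hy. f_equal.
           replace (1 - INR k - - INR j)%C with (RtoC (INR (S j - k))).
           ++ symmetry. now apply Cpower_INR.
           ++ rewrite minus_INR, S_INR, RtoC_minus, RtoC_plus by auto. ring.
        -- apply poly_like_scal; auto. now apply poly_like_pow.
      * apply (poly_like_ext _ Hh (fun _ => RtoC 0)); [|now apply poly_like_const].
        intros y _. replace (falling (1 - - INR j) k) with (RtoC 0); [ring|].
        symmetry. induction hk as [|k hk IHk]; rewrite falling_S.
        -- replace (1 - - INR j - INR (S j))%C with (RtoC 0); [ring|].
           rewrite S_INR, RtoC_plus. ring.
        -- rewrite IHk. ring.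
  - apply (poly_like_ext _ Hh (fun y => / INR (S n) *
      (barnes y n (- INR (S j)) + (INR (S n) * barnes y n (- INR j)
       + - (1) * (y * barnes y n (- INR j)))))%C).
    + intros y _. rewrite barnes_S. rewrite (S_INR j), RtoC_plus.
      replace (- INR j - 1)%C with (- (INR j + 1))%C by ring. ring.
    + apply poly_like_scal; auto. apply poly_like_plus; auto. apply poly_like_plus; auto.
      * apply poly_like_scal; auto.
      * apply poly_like_scal; auto. now apply poly_like_mul_id.
Qed.

Lemma diff_nilp_half d k f : diff_nilp (1 / 2) d f ->
  diff_nilp 1 d (fun x => f ((INR k + x) / 2)%C).
Proof.
  revert f. induction d as [|d IH]; intros f Hf; simpl in *.
  - intros y Hy. now apply Hf, Re_half.
  - eapply (diff_nilp_ext 1); [lra| |exact (IH _ Hf)]. intros y _. cbv beta. f_equal. f_equal.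
    rewrite RtoC_div by lra. field.
Qed.

Lemma altz_poly_like n : poly_like 1 (fun x => altz x n 0).
Proof.
  assert (Hh : 0 <= 1) by lra. unfold altz. apply poly_like_scal; auto.
  apply (poly_like_csum _ Hh (fun k x => alt_coef n k * barnes ((INR k + x) / 2) n 0)%C).
  intros k _. apply poly_like_scal; auto.
  destruct (barnes_poly_like n 0) as [d H]. exists d.
  replace (- INR 0)%C with (RtoC 0) in H by (simpl; ring).
  exact (diff_nilp_half d k (fun y => barnes y n 0) H).
Qed.

(** * The value of the alternating zeta function at [0] *)

(** In generating series [b] is [1 + t] times [a]. This lowers the order of the alternating
    coefficients, which are those of [(1 + t)^(- n - 1)], by one. *)
Lemma is_sum_pair_shift (a b f : nat -> C) l l' l'' :
  is_sum (fun m => a m * f m)%C l -> is_sum (fun m => a m * f (S m))%C l' ->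
  is_sum (fun m => b m * f m)%C l'' ->
  b O = a O -> (forall m, b (S m) = a (S m) + a m)%C -> (l + l')%C = l''.
Proof.
  intros H1 H2 H3 H0 HS. apply is_sum_shift in H1, H3.
  assert (H4 := is_sum_plus _ _ _ _ H1 H2).
  assert (E : (l - a O * f O + l')%C = (l'' - b O * f O)%C).
  { apply (is_sum_unique _ _ _ H4). eapply is_sum_ext; [|exact H3].
    intros m. cbv beta. rewrite HS. ring. }
  rewrite H0 in E.
  replace (l + l')%C with (l - a O * f O + l' + a O * f O)%C by ring. rewrite E. ring.
Qed.

Lemma identity_at_0 (F G : C -> C) sigma : (forall a, mer F a) -> hol F 0 ->
  (forall a, mer G a) -> hol G 0 -> (forall s, sigma < Re s -> F s = G s) -> F 0 = G 0.
Proof.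
  intros F1 F2 G1 G2 H.
  destruct (identity_near_0 F G sigma F1 F2 G1 G2 H) as (r & Hr & E).
  apply E. now rewrite Cmod_0.
Qed.

Lemma Cpower_shift x m s : Cpower (x + 1 + INR m) (- s) = Cpower (x + INR (S m)) (- s).
Proof. f_equal. rewrite S_INR, RtoC_plus. ring. Qed.

Lemma Re_plus_1 x : 0 < Re x -> 0 < Re (x + 1)%C.
Proof. intros H. change (0 < Re x + 1). lra. Qed.

(** The base case: with no summation index left, the right-hand side is [x ^ (- s)], whose value at
    0 is 1. *)
Lemma altz_rec_0 x : 0 < Re x -> (altz x 0 0 + altz (x + 1) 0 0)%C = RtoC 1.
Proof.
  intros Hx. assert (Hx1 := Re_plus_1 x Hx).
  transitivity (Cpower x (- 0));
    [|replace (- 0)%C with (RtoC 0) by ring; apply Cpower_0].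
  apply (identity_at_0 (fun s => altz x 0 s + altz (x + 1) 0 s)%C (fun s => Cpower x (- s)) 1).
  - intros a. apply mer_plus; now apply altz_mer.
  - apply hol_plus; apply altz_hol; auto; simpl; lra.
  - intros a. apply hol_mer, entire_hol.
    apply (entire_ext (fun s => Cpower x (0 - s))); [|apply entire_Cpower].
    intros s. f_equal. ring.
  - apply entire_hol. apply (entire_ext (fun s => Cpower x (0 - s))); [|apply entire_Cpower].
    intros s. f_equal. ring.
  - intros s Hs.
    destruct (altz_series x 0 s Hx) as [h1 _]; [simpl; lra|].
    destruct (altz_series (x + 1) 0 s Hx1) as [h2 _]; [simpl; lra|].
    apply (is_sum_pair_shift (fun m => (- (1)) ^ m * INR 'C(m + 0, 0))%C
      (fun m => match m with O => RtoC 1 | S _ => RtoC 0 end)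
      (fun m => Cpower (x + INR m) (- s)) _ _ _ h1).
    + eapply is_sum_ext; [|exact h2]. intros m. cbv beta. now rewrite Cpower_shift.
    + set (F := fun m => (match m with O => RtoC 1 | S _ => RtoC 0 end * Cpower (x + INR m)
        (- s))%C).
      replace (Cpower x (- s)) with (F O).
      * apply is_sum_single. intros [|m] Hm; [easy|]. unfold F. ring.
      * unfold F. simpl. replace (x + 0)%C with x by ring. ring.
    + rewrite bin_zero. simpl. ring.
    + intros m. rewrite !bin_zero, Cpow_S. simpl. ring.
Qed.

Lemma altz_rec x n : 0 < Re x -> (altz x (S n) 0 + altz (x + 1) (S n) 0)%C = altz x n 0.
Proof.
  intros Hx. assert (Hx1 := Re_plus_1 x Hx).
  apply (identity_at_0 (fun s => altz x (S n) s + altz (x + 1) (S n) s)%C (fun s => altz x n s)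
    (INR (S n) + 1)).
  - intros a. apply mer_plus; now apply altz_mer.
  - apply hol_plus; apply altz_hol; auto; simpl; lra.
  - intros a. now apply altz_mer.
  - apply altz_hol; auto. simpl. lra.
  - intros s Hs.
    destruct (altz_series x (S n) s Hx Hs) as [h1 _].
    destruct (altz_series (x + 1) (S n) s Hx1 Hs) as [h2 _].
    destruct (altz_series x n s Hx) as [h3 _]; [rewrite S_INR in Hs; lra|].
    apply (is_sum_pair_shift (fun m => (- (1)) ^ m * INR 'C(m + S n, S n))%C
      (fun m => (- (1)) ^ m * INR 'C(m + n, n))%C
      (fun m => Cpower (x + INR m) (- s)) _ _ _ h1).
    + eapply is_sum_ext; [|exact h2]. intros m. cbv beta. now rewrite Cpower_shift.
    + exact h3.
    + simpl plus. now rewrite !bin_diag.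
    + intros m. replace (S m + S n)%nat with (S (m + S n)) by lia.
      rewrite bin_pascal, plus_INR, RtoC_plus, Cpow_S.
      replace (S m + n)%nat with (m + S n)%nat by lia. ring.
Qed.

Lemma Cpow2_neq_0 n : (RtoC 2 ^ n)%C <> RtoC 0.
Proof. apply Cpow_nz. intros e. apply RtoC_inj in e. lra. Qed.

(* By [altz_rec], the difference of the two sides is antiperiodic in [x]; it is also a
   polynomial in [x]. *)
Lemma altz_0 n x : 0 < Re x -> altz x n 0 = (/ 2 ^ S n)%C.
Proof.
  assert (Hh : 0 <= 1) by lra.
  revert x. induction n as [|n IH]; intros x Hx.
  - apply Ceq_minus.
    apply (poly_like_antiperiodic 1 Hh (fun x => altz x 0 0 - / 2 ^ 1)%C); auto.
    + apply (poly_like_plus 1 Hh (fun x => altz x 0 0) (fun _ => - / 2 ^ 1)%C);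
        [apply altz_poly_like|now apply poly_like_const].
    + intros y Hy.
      replace (altz (y + 1) 0 0) with (altz y 0 0 + altz (y + 1) 0 0 - altz y 0 0)%C by ring.
      rewrite altz_rec_0 by auto. simpl. field.
  - apply Ceq_minus.
    apply (poly_like_antiperiodic 1 Hh (fun x => altz x (S n) 0 - / 2 ^ S (S n))%C); auto.
    + apply (poly_like_plus 1 Hh (fun x => altz x (S n) 0) (fun _ => - / 2 ^ S (S n))%C);
        [apply altz_poly_like|now apply poly_like_const].
    + intros y Hy.
      replace (altz (y + 1) (S n) 0) with (altz y (S n) 0 + altz (y + 1) (S n) 0 - altz y (S n)
        0)%C by ring.
      rewrite altz_rec, IH by auto.
      rewrite !Cpow_S. field. apply Cpow2_neq_0.
Qed.

(** * Rules for complex derivatives *)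

Lemma hol_has_deriv f a : hol f a -> exists d, has_deriv f a d.
Proof. intros (r & c & M & Hr & H). exists (c 1%nat). eapply pser_has_deriv; eauto. Qed.

Lemma has_deriv_ext f g a d : (forall s, f s = g s) -> has_deriv f a d -> has_deriv g a d.
Proof. intros E. apply has_deriv_local. exists 1. split; [lra|auto]. Qed.

Lemma has_deriv_plus f g a d d' : has_deriv f a d -> has_deriv g a d' ->
  has_deriv (fun s => f s + g s)%C a (d + d')%C.
Proof.
  intros H H' eps Heps.
  destruct (H (eps / 2)) as (e1 & He1 & H1); [lra|].
  destruct (H' (eps / 2)) as (e2 & He2 & H2); [lra|].
  exists (Rmin e1 e2). split; [apply Rmin_case; auto|]. intros s Hs.
  pose_rmin e1 e2.
  specialize (H1 s ltac:(lra)). specialize (H2 s ltac:(lra)).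
  replace (f s + g s - (f a + g a) - (d + d') * (s - a))%C
    with ((f s - f a - d * (s - a)) + (g s - g a - d' * (s - a)))%C by ring.
  eapply Rle_trans; [apply Cmod_triangle|]. lra.
Qed.

Lemma has_deriv_const u a : has_deriv (fun _ => u) a 0.
Proof.
  intros eps Heps. exists 1. split; [lra|]. intros s _.
  replace (u - u - 0 * (s - a))%C with (RtoC 0) by ring. rewrite Cmod_0.
  apply Rmult_le_pos; [lra|apply Cmod_ge_0].
Qed.

Lemma has_deriv_id a : has_deriv (fun s => s) a 1.
Proof.
  intros eps Heps. exists 1. split; [lra|]. intros s _.
  replace (s - a - 1 * (s - a))%C with (RtoC 0) by ring. rewrite Cmod_0.
  apply Rmult_le_pos; [lra|apply Cmod_ge_0].
Qed.

Lemma has_deriv_shift f a j d : has_deriv f (a - j)%C d -> has_deriv (fun s => f (s - j)%C) a d.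
Proof.
  intros H eps Heps. destruct (H eps Heps) as (e & He & H1).
  exists e. split; auto. intros s Hs.
  replace (s - a)%C with (s - j - (a - j))%C in * by ring. auto.
Qed.

(** Read off the coefficient of index 1 in the Cauchy product. *)
Lemma has_deriv_mult f g a d d' : hol f a -> hol g a -> has_deriv f a d -> has_deriv g a d' ->
  has_deriv (fun s => f s * g s)%C a (d * g a + f a * d')%C.
Proof.
  intros (r & c & M & Hr & H) (r' & c' & M' & Hr' & H') Hd Hd'.
  pose_rmin r r'.
  assert (h3 : 0 < Rmin r r') by (apply Rmin_case; lra).
  apply (pser_mono _ _ (Rmin r r')) in H; [|lra]. apply (pser_mono _ _ (Rmin r r')) in H'; [|lra].
  rewrite (has_deriv_unique _ _ _ _ Hd (pser_has_deriv _ _ _ _ _ h3 H)).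
  rewrite (has_deriv_unique _ _ _ _ Hd' (pser_has_deriv _ _ _ _ _ h3 H')).
  rewrite (pser_at _ _ _ _ _ (Rlt_le _ _ h3) H), (pser_at _ _ _ _ _ (Rlt_le _ _ h3) H').
  assert (h := pser_has_deriv _ _ _ _ _ h3 (pser_mult _ _ _ _ _ _ _ _ (Rlt_le _ _ h3) H H')).
  unfold csum in h. simpl in h.
  replace (c 1%nat * c' 0%nat + c 0%nat * c' 1%nat)%C
    with (c 0%nat * c' 1%nat + (c 1%nat * c' 0%nat + 0))%C by ring.
  exact h.
Qed.

Lemma has_deriv_scal f a d u : hol f a -> has_deriv f a d ->
  has_deriv (fun s => u * f s)%C a (u * d)%C.
Proof.
  intros H Hd. replace (u * d)%C with (0 * f a + u * d)%C by ring.
  apply has_deriv_mult; auto; [apply entire_hol, entire_const|apply has_deriv_const].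
Qed.

Lemma has_deriv_csum {I : Type} (f : I -> C -> C) (d : I -> C) a (L : list I) :
  (forall i, In i L -> has_deriv (f i) a (d i)) ->
    has_deriv (fun s => csum (fun i => f i s) L) a (csum d L).
Proof.
  induction L as [|i L IH]; intros H; [apply (has_deriv_const (RtoC 0))|].
  apply (has_deriv_plus (f i) (fun s => csum (fun i => f i s) L)); [apply H; now left|].
  apply IH. intros; apply H; now right.
Qed.

Lemma has_deriv_inv p a : p <> a -> has_deriv (fun s => / (s - p))%C a
  (- (/ (p - a) * / (p - a)))%C.
Proof.
  intros Hp.
  assert (H : 0 < Cmod (p - a)).
  { apply Cmod_gt_0. intros e. apply Hp. now apply Ceq_minus. }
  destruct (pser_inv a p (Cmod (p - a) / 2)) as (M & h); [lra|].
  apply pser_has_deriv in h; [|lra].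
  replace (- (/ (p - a) * / (p - a)))%C with (- / (p - a) * (/ (p - a)) ^ 1)%C by (simpl; ring).
  exact h.
Qed.

(** * Identification of the chosen continuations *)

(** The explicit [G] shows that [epsilon] has something to choose, and uniqueness near 0 carries its
    derivative over to the choice. The abstract [P] covers both a fixed half-plane and the
    unspecified one in [zeta_prod]. *)
Lemma derive_continuation (P : (C -> C) -> Prop) (D : C -> C -> Prop) G d :
  (forall s v w, D s v -> D s w -> v = w) -> P G ->
  (forall F, P F -> exists sigma, is_continuation D sigma F) ->
  has_deriv G 0 d -> C_derive (continuation P) 0 = d.
Proof.
  intros HD HG HP Hd. apply has_deriv_C_derive. apply (has_deriv_local G); auto.
  assert (HF : P (continuation P)) by (unfold continuation; apply epsilon_spec; now exists G).
  destruct (HP _ HG) as [sigma h1]. destruct (HP _ HF) as [tau h2].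
  destruct (is_continuation_unique D sigma tau G _ HD h1 h2) as (r & Hr & E).
  exists r. split; auto. intros s Hs. apply E. now replace s with (s - 0)%C by ring.
Qed.

Lemma barnes_continuation n x : 0 < Re x ->
  is_continuation (zeta_series (S n) x) (INR (S n)) (barnes x n).
Proof.
  intros Hx. split; [|split].
  - intros a. now apply mer_meromorphic, barnes_mer.
  - apply hol_analytic, barnes_hol; auto. simpl. lra.
  - intros s Hs. rewrite S_INR in Hs. destruct (barnes_series x n s Hx Hs) as [h1 [M h2]].
    exact (is_sum_tuple n (fun m => Cpower (x + INR m) (- s)) _ M h2 h1).
Qed.

Lemma altz_continuation n x : 0 < Re x ->
  is_continuation (zetaE_series (S n) x) (INR (S n)) (altz x n).
Proof.
  intros Hx. split; [|split].
  - intros a. now apply mer_meromorphic, altz_mer.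
  - apply hol_analytic, altz_hol; auto. simpl. lra.
  - intros s Hs. rewrite S_INR in Hs. destruct (altz_series x n s Hx Hs) as [h1 [M h2]].
    assert (E : forall m, ((- (1)) ^ m * INR 'C(m + n, n) * Cpower (x + INR m) (- s))%C
      = (INR 'C(m + n, n) * ((- (1)) ^ m * Cpower (x + INR m) (- s)))%C) by (intros; ring).
    apply (is_sum_tuple n (fun m => (- (1)) ^ m * Cpower (x + INR m) (- s))%C _ M).
    + eapply bsum_le; [|exact h2]. intros m. cbv beta. rewrite E. lra.
    + eapply is_sum_ext; [exact E|exact h1].
Qed.

Lemma logGamma_has_deriv n x : 0 < Re x -> has_deriv (barnes x n) 0 (logGamma (S n) x).
Proof.
  intros Hx. destruct (hol_has_deriv (barnes x n) 0) as [d Hd];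
    [apply barnes_hol; auto; simpl; lra|].
  replace (logGamma (S n) x) with d; auto. symmetry. unfold logGamma, zeta.
  apply (derive_continuation _ (zeta_series (S n) x) (barnes x n)); auto.
  - intros s v w. apply is_sum_unique.
  - now apply barnes_continuation.
  - eauto.
Qed.

Definition altz_deriv0 (n : nat) (x : C) : C :=
  (csum (fun k => alt_coef n k * logGamma (S n) ((INR k + x) / 2)) (seq 0 (S (S n)))
    - / 2 ^ S n * ln 2)%C.

Lemma altz_has_deriv n x : 0 < Re x -> has_deriv (altz x n) 0 (altz_deriv0 n x).
Proof.
  intros Hx.
  set (B := fun s => csum (fun k => alt_coef n k * barnes ((INR k + x) / 2) n s)%C
    (seq 0 (S (S n)))).
  assert (HB : hol B 0).
  { apply (hol_csum (fun k s => alt_coef n k * barnes ((INR k + x) / 2) n s)%C). intros k.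
    apply hol_mult; [apply entire_hol, entire_const|].
    apply barnes_hol; [now apply Re_half|simpl; lra]. }
  assert (HdB : has_deriv B 0 (csum (fun k => alt_coef n k * logGamma (S n) ((INR k + x) / 2))%C
    (seq 0 (S (S n))))).
  { apply has_deriv_csum. intros k _. apply has_deriv_scal.
    - apply barnes_hol; [now apply Re_half|simpl; lra].
    - now apply logGamma_has_deriv, Re_half. }
  assert (H := has_deriv_mult _ _ _ _ _ (entire_hol _ 0 (entire_Cexp (- ln 2)%C)) HB
    (has_deriv_Cexp (- ln 2)%C 0) HdB).
  assert (E0 : Cexp (- ln 2 * 0) = RtoC 1).
  { replace (- ln 2 * 0)%C with (RtoC 0) by ring. apply Cexp_0. }
  (* The factor [2 ^ (- s)] equals 1 at 0, so the bare sum has the value of [altz] there; this value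
     multiplies [- ln 2] in the product rule. *)
  assert (EB : B 0 = (/ 2 ^ S n)%C).
  { rewrite <- (altz_0 n x Hx). unfold altz. rewrite E0. unfold B. ring. }
  cbv beta in H. rewrite !E0, EB in H. unfold altz_deriv0.
  match goal with |- has_deriv _ _ ?z => match type of H with has_deriv _ _ ?z' =>
    replace z with z' by ring end end.
  exact H.
Qed.

Lemma barGamma_altz n x : 0 < Re x -> barGamma (S n) x = Cexp (altz_deriv0 n x).
Proof.
  intros Hx. unfold barGamma. f_equal. unfold zetaE.
  apply (derive_continuation _ (zetaE_series (S n) x) (altz x n)).
  - intros s v w. apply is_sum_unique.
  - now apply altz_continuation.
  - eauto.
  - now apply altz_has_deriv.
Qed.

Lemma IZR_m1_pow n : RtoC (IZR ((-1) ^ Z.of_nat n)) = ((- (1)) ^ n)%C.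
Proof.
  induction n as [|n IH]; [reflexivity|].
  rewrite Nat2Z.inj_succ, Z.pow_succ_r by lia. rewrite mult_IZR, RtoC_mult, IH, Cpow_S.
  replace (RtoC (-1)) with (- (1))%C by (rewrite <- RtoC_opp; reflexivity). reflexivity.
Qed.

Lemma zeta_prod_altz n x : 0 < Re x ->
  zeta_prod (fun m => INR m + x)%C
    (fun m => ((-1) ^ Z.of_nat (m + 1) * Z.of_nat 'C(m + S n - 1, S n - 1))%Z) =
      Cexp (altz_deriv0 n x).
Proof.
  intros Hx. unfold zeta_prod. cbv zeta. f_equal.
  match goal with |- C_derive (continuation (fun G => exists sigma, is_continuation ?D _ _)) _ =
    _ =>
    set (D0 := D) end.
  assert (E : forall s m, (IZR (- ((-1) ^ Z.of_nat (m + 1) * Z.of_nat 'C(m + S n - 1, S n - 1)))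
      * Cpower (INR m + x) (- s))%C
    = ((- (1)) ^ m * INR 'C(m + n, n) * Cpower (x + INR m) (- s))%C).
  { intros s m. replace (INR m + x)%C with (x + INR m)%C by ring.
    replace (m + S n - 1)%nat with (m + n)%nat by lia.
    replace (S n - 1)%nat with n by lia.
    rewrite opp_IZR, mult_IZR, <- INR_IZR_INZ, RtoC_opp, RtoC_mult, IZR_m1_pow.
    replace (m + 1)%nat with (S m) by lia. rewrite Cpow_S. ring. }
  apply (derive_continuation _ D0 (altz x n)).
  - intros s v w Hv Hw.
    apply (clim_unique (fun m => csum (fun i => (IZR (- ((-1) ^ Z.of_nat (i + 1)
       * Z.of_nat 'C(i + S n - 1, S n - 1))) * Cpower (INR i + x) (- s))%C) (seq 0 m))).
    + exact (is_series_clim _ _ Hv).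
    + exact (is_series_clim _ _ Hw).
  (* The coefficients grow like [m ^ n], so [n + 1] is an abscissa of absolute convergence. *)
  - exists (INR n + 1). split; [|split].
    + intros a. now apply mer_meromorphic, altz_mer.
    + apply hol_analytic, altz_hol; auto. simpl. lra.
    + intros s Hs. destruct (altz_series x n s Hx Hs) as [h1 _].
      apply is_sum_series. eapply is_sum_ext; [|exact h1]. intros m. symmetry. apply E.
  - auto.
  - now apply altz_has_deriv.
Qed.

Lemma CpowerZ_Cexp z n : CpowerZ (Cexp z) n = Cexp (IZR n * z).
Proof.
  destruct n as [|p|p]; simpl.
  - replace (0 * z)%C with (RtoC 0) by ring. now rewrite Cexp_0.
  - rewrite <- Cexp_INR, INR_IZR_INZ, positive_nat_Z. reflexivity.
  - rewrite <- Cexp_INR, INR_IZR_INZ, positive_nat_Z, <- Cexp_opp. f_equal.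
    change (IZR (Z.neg p)) with (IZR (- Z.pos p)). rewrite opp_IZR, RtoC_opp. ring.
Qed.

Lemma Cprod_n_Cexp (f : nat -> C) N : Cprod_n (fun k => Cexp (f k)) N = Cexp (csum f (seq 0 (S N))).
Proof.
  induction N as [|N IH].
  - simpl. unfold csum. simpl. f_equal. ring.
  - rewrite csum_seq_S, Cexp_plus, <- IH. reflexivity.
Qed.

Lemma Cprod_n_ext (f g : nat -> C) N : (forall k, f k = g k) -> Cprod_n f N = Cprod_n g N.
Proof. intros E. induction N as [|N IH]; simpl; rewrite ?IH, E; reflexivity. Qed.

Lemma RtoC_inv_pow2 N : RtoC (/ 2 ^ N) = (/ 2 ^ N)%C.
Proof. rewrite RtoC_inv, RtoC_pow; auto. apply pow_nonzero. lra. Qed.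

Lemma Cexp_altz_deriv0 n x : Cexp (altz_deriv0 n x) =
  (Rpower 2 (- / 2 ^ S n) * Cprod_n (fun k => CpowerZ (Gamma (S n) ((INR k + x) / 2))
     ((-1) ^ Z.of_nat k * Z.of_nat 'C(S n, k))) (S n))%C.
Proof.
  unfold Rpower. rewrite <- Cexp_R.
  rewrite (Cprod_n_ext _ (fun k => Cexp (alt_coef n k * logGamma (S n) ((INR k + x) / 2)))).
  - rewrite Cprod_n_Cexp, <- Cexp_plus. f_equal. unfold altz_deriv0.
    rewrite RtoC_mult, RtoC_opp, RtoC_inv_pow2. ring.
  - intros k. unfold Gamma. rewrite CpowerZ_Cexp. f_equal. f_equal.
    rewrite mult_IZR, <- INR_IZR_INZ, RtoC_mult, IZR_m1_pow. reflexivity.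
Qed.

(** * The derivative of the Riemann zeta function at [-1] *)

Fixpoint falling_deriv (a : C) (k : nat) : C :=
  match k with
  | O => RtoC 0
  | S j => (falling_deriv a j * (1 - a - INR j) + falling (1 - a) j * - (1))%C
  end.

Lemma has_deriv_lin (u : C) a : has_deriv (fun s => u - s)%C a (- (1))%C.
Proof.
  intros eps Heps. exists 1. split; [lra|]. intros s _.
  replace (u - s - (u - a) - - (1) * (s - a))%C with (RtoC 0) by ring. rewrite Cmod_0.
  apply Rmult_le_pos; [lra|apply Cmod_ge_0].
Qed.

Lemma has_deriv_ff a k : has_deriv (fun s => falling (1 - s) k) a (falling_deriv a k).
Proof.
  induction k as [|k IH]; [apply (has_deriv_const (RtoC 1))|].
  apply (has_deriv_ext (fun s => falling (1 - s) k * (1 - INR k - s))%C).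
  - intros s. rewrite falling_S. f_equal. ring.
  - simpl falling_deriv. replace (1 - a - INR k)%C with (1 - INR k - a)%C by ring.
    apply (has_deriv_mult (fun s => falling (1 - s) k) (fun s => 1 - INR k - s)%C); auto.
    + apply entire_hol, entire_falling.
    + apply entire_hol, entire_opp_plus.
    + apply has_deriv_lin.
Qed.

Lemma has_deriv_Cpower w p a : has_deriv (fun s => Cpower w (p - s)) a
  (- Cln w * Cpower w (p - a))%C.
Proof.
  apply (has_deriv_ext (fun s => Cpower w p * Cexp (- Cln w * s))%C).
  - intros s. unfold Cpower. rewrite <- Cexp_plus. f_equal. ring.
  - replace (- Cln w * Cpower w (p - a))%C
      with (Cpower w p * (- Cln w * Cexp (- Cln w * a)))%C.
    + apply has_deriv_scal; [apply entire_hol, entire_Cexp|apply has_deriv_Cexp].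
    + replace (p - a)%C with (p + - a)%C by ring. rewrite Cpower_plus.
      unfold Cpower. replace (- a * Cln w)%C with (- Cln w * a)%C by ring. ring.
Qed.

Lemma has_deriv_phi k w a : has_deriv (fun s => phi k s w) a
  (falling_deriv a k * Cpower w (1 - INR k - a)
   + falling (1 - a) k * (- Cln w * Cpower w (1 - INR k - a)))%C.
Proof.
  unfold phi. apply (has_deriv_mult (fun s => falling (1 - s) k)
    (fun s => Cpower w (1 - INR k - s))).
  - apply entire_hol, entire_falling.
  - apply entire_hol, entire_Cpower.
  - apply has_deriv_ff.
  - apply has_deriv_Cpower.
Qed.

Lemma has_deriv_tsum J w a : has_deriv (fun s => em_corr J s w) a
  (csum (fun k => beta k * (falling_deriv a k * Cpower w (1 - INR k - a)
   + falling (1 - a) k * (- Cln w * Cpower w (1 - INR k - a))))%C (seq 0 (S J))).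
Proof.
  apply (has_deriv_csum (fun k s => beta k * phi k s w)%C). intros k _.
  apply has_deriv_scal; [apply entire_hol, entire_phi|apply has_deriv_phi].
Qed.

Lemma Cpower_opp w p : Cpower w (- p) = (/ Cpower w p)%C.
Proof. unfold Cpower. rewrite <- Cexp_opp. f_equal. ring. Qed.

Ltac to_R := repeat (rewrite <- RtoC_plus || rewrite <- RtoC_mult || rewrite <- RtoC_opp
  || rewrite <- RtoC_minus).

(** The derivative at [s = -1] of [em_partial 1 4 s m], with [v = 1 + m] the base point of the
    correction. Order 4 is the least that [hurwitz_derive] admits at -1; [beta 4] is left
    unevaluated because its term tends to 0. *)
Definition em_deriv (m : nat) : R := let v := INR m + 1 in
  rsum (fun n => (INR n + 1) * (1 + 2 * ln (INR n + 1))) (seq 0 m)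
  - v ^ 2 * ln v + v / 2 + v * ln v - 1 / 4 - ln v / 6 + 2 * beta 4 * / v ^ 2.

Lemma em_partial_has_deriv m : has_deriv (fun s => em_partial 1 4 s m) (- (1))%C
  (RtoC (em_deriv m)).
Proof.
  set (v := INR m + 1). assert (Hv : 0 < v) by (unfold v; assert (h := pos_INR m); lra).
  assert (Ew : (1 + INR m)%C = RtoC v) by (unfold v; to_R; f_equal; ring).
  assert (HvR : 0 < Re (RtoC v)) by exact Hv.
  (* At [s = -1] the exponents are [2 - k]; the case [k = 3] is skipped because [beta 3 = 0]. *)
  assert (P0 : Cpower v (1 - INR 0 - - (1)) = RtoC (v ^ 2)).
  { replace (1 - INR 0 - - (1))%C with (RtoC (INR 2)) by (simpl; to_R; f_equal; ring).
    rewrite Cpower_INR by auto. now rewrite <- RtoC_pow. }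
  assert (P1 : Cpower v (1 - INR 1 - - (1)) = RtoC v).
  { replace (1 - INR 1 - - (1))%C with (RtoC 1) by (simpl; to_R; f_equal; ring).
    now rewrite Cpower_1. }
  assert (P2 : Cpower v (1 - INR 2 - - (1)) = RtoC 1).
  { replace (1 - INR 2 - - (1))%C with (RtoC 0) by (simpl; to_R; f_equal; ring).
    apply Cpower_0. }
  assert (P4 : Cpower v (1 - INR 4 - - (1)) = RtoC (/ v ^ 2)).
  { replace (1 - INR 4 - - (1))%C with (- INR 2)%C by (simpl; to_R; f_equal; ring).
    rewrite Cpower_opp, Cpower_INR by auto. rewrite <- RtoC_pow, RtoC_inv; auto.
    apply pow_nonzero. lra. }
  assert (HT := has_deriv_tsum 4 v (- (1))%C).
  rewrite (Cln_R v Hv) in HT. unfold csum in HT. cbn [seq map fold_right] in HT.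
  rewrite P0, P1, P2, P4, beta_0, beta_1, beta_2, beta_3 in HT.
  cbn [falling_deriv falling] in HT. rewrite !Cmult_0_l in HT.
  match type of HT with has_deriv _ _ ?z => replace z with
     (RtoC (- (v ^ 2 * ln v) + v / 2 + ln v * v - 1 / 4 - ln v / 6 + 2 * beta 4 * / v ^ 2)) in HT
     by (simpl INR; set (q := / v ^ 2); to_R; f_equal; field) end.
  assert (HS := has_deriv_csum (fun n s => Cpower (1 + INR n) (0 - s))
    (fun n => RtoC (- ln (INR n + 1) * (INR n + 1))) (- (1))%C (seq 0 m)).
  assert (En : forall n, (1 + INR n)%C = RtoC (INR n + 1)) by (intros; to_R; f_equal; ring).
  assert (Ep : forall n, Cpower (1 + INR n) (0 - - (1)) = RtoC (INR n + 1)).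
  { intros n. replace (0 - - (1))%C with (RtoC 1) by ring. rewrite En. apply Cpower_1.
    change (0 < INR n + 1). assert (h := pos_INR n). lra. }
  assert (HS' : has_deriv (fun s => csum (fun n => Cpower (1 + INR n) (0 - s)) (seq 0 m)) (- (1))%C
    (csum (fun n => RtoC (- ln (INR n + 1) * (INR n + 1))) (seq 0 m))).
  { apply HS. intros n _. rewrite RtoC_mult. rewrite <- (Ep n).
    rewrite RtoC_opp, <- Cln_R by (assert (h := pos_INR n); lra). rewrite <- En.
    apply has_deriv_Cpower. }
  apply (has_deriv_ext (fun s => (s + - (1)) * csum (fun n => Cpower (1 + INR n) (0 - s)) (seq 0 m)
     + em_corr 4 s v)%C).
  { intros s. unfold em_partial. rewrite Ew. f_equal. f_equal. apply csum_ext. intros n _.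
      f_equal. ring. }
  assert (H := has_deriv_plus _ _ _ _ _ (has_deriv_mult _ _ _ _ _
    (entire_hol _ (- (1))%C (entire_plus _ _ entire_id (entire_const (- (1))%C)))
    (entire_hol _ (- (1))%C (entire_csum (fun n s => Cpower (1 + INR n) (0 - s)) (seq 0 m)
       (fun n => entire_Cpower (1 + INR n) 0)))
    (has_deriv_plus _ _ _ _ _ (has_deriv_id (- (1))%C) (has_deriv_const (- (1))%C (- (1))%C))
      HS') HT).
  cbv beta in H.
  rewrite (csum_ext _ (fun n => RtoC (INR n + 1)) _ (fun n _ => Ep n)), <- !RtoC_rsum in H.
  replace (RtoC (em_deriv m)) with
    ((1 + 0) * RtoC (rsum (fun n => INR n + 1)%R (seq 0 m))
      + (- (1) + - (1)) * RtoC (rsum (fun n => - ln (INR n + 1) * (INR n + 1))%R (seq 0 m))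
      + RtoC (- (v ^ 2 * ln v) + v / 2 + ln v * v - 1 / 4 - ln v / 6 + 2 * beta 4 * / v ^ 2))%C;
    [exact H|].
  unfold em_deriv. fold v.
  rewrite (rsum_ext (fun n => (INR n + 1) * (1 + 2 * ln (INR n + 1)))
    (fun n => (INR n + 1) + (-2) * (- ln (INR n + 1) * (INR n + 1)))) by (intros; ring).
  rewrite (rsum_plus (fun n => INR n + 1) (fun n => (-2) * (- ln (INR n + 1) * (INR n + 1)))),
    (rsum_scal (-2) (fun n => - ln (INR n + 1) * (INR n + 1))).
  to_R. f_equal. ring.
Qed.

Definition ln_glaisher (n : nat) : R :=
  rsum (fun k => INR k * ln (INR k)) (seq 0 (S n))
  - (INR n ^ 2 / 2 + INR n / 2 + 1 / 12) * ln (INR n) + INR n ^ 2 / 4.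

Lemma em_deriv_ln_glaisher m : em_deriv m = 2 * ln_glaisher (S m) - 1 / 4 + 2 * beta 4 * /
  (INR m + 1) ^ 2.
Proof.
  assert (H : rsum (fun n => (INR n + 1) * (1 + 2 * ln (INR n + 1))) (seq 0 m)
    = INR m * (INR m + 1) / 2 + 2 * rsum (fun k => INR k * ln (INR k)) (seq 0 (S m))).
  { induction m as [|m IH].
    - unfold rsum. simpl. field.
    - rewrite rsum_seq_S, IH, (rsum_seq_S _ (S m)), S_INR. field. }
  unfold em_deriv, ln_glaisher. cbv zeta. rewrite H, (rsum_seq_S _ (S m)), S_INR.
  assert (h := pos_INR m). field. lra.
Qed.

Lemma one_Re : 0 < Re (RtoC 1).
Proof. simpl. lra. Qed.

(** The derivative of [(s - 1) zeta(s)] at -1 is [zeta(-1) - 2 zeta'(-1)]. With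
    [zeta(-1) = - 1 / 12] its value [2 l - 1 / 4] says [l = 1 / 12 - zeta'(-1)], the logarithm of
    the Glaisher constant. Convergence of the sequence is obtained along the way. *)
Lemma hurwitz_ln_glaisher : exists l, is_lim_seq (fun m => ln_glaisher (S m)) (Finite l) /\
  has_deriv (hurwitz 1 one_Re) (- (1))%C (RtoC (2 * l - 1 / 4)).
Proof.
  destruct (hurwitz_derive 1 one_Re (- (1))%C 4 (fun m => RtoC (em_deriv m))) as (d & Hd & Hl).
  - lia.
  - simpl. lra.
  - apply em_partial_has_deriv.
  - assert (Hre : forall z : C, Rabs (Re z) <= Cmod z) by apply re_le_Cmod.
    assert (Hi : Im d = 0).
    { destruct (Req_dec (Im d) 0) as [e|ne]; auto.
      destruct (Hl (Rabs (Im d))) as [N HN]; [now apply Rabs_pos_lt|].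
      specialize (HN N (le_n _)). assert (h := Im_le_Cmod (RtoC (em_deriv N) - d)%C).
      change (Im (RtoC (em_deriv N) - d)%C) with (0 + - Im d) in h.
      rewrite Rplus_0_l, Rabs_Ropp in h. lra. }
    assert (HP : is_lim_seq em_deriv (Finite (Re d))).
    { apply is_lim_seq_spec. intros eps. destruct (Hl eps (cond_pos eps)) as [N HN].
      exists N. intros n Hn. specialize (HN n Hn). specialize (Hre (RtoC (em_deriv n) - d)%C).
      change (Re (RtoC (em_deriv n) - d)%C) with (em_deriv n - Re d) in Hre. lra. }
    assert (Hv : is_lim_seq (fun m => / (INR m + 1)) (Finite 0)).
    { apply (is_lim_seq_inv (fun m => INR m + 1) p_infty); [|discriminate].
      apply (is_lim_seq_ext (fun m => INR (S m))); [intros; apply S_INR|].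
      apply (is_lim_seq_incr_1 INR), is_lim_seq_INR. }
    exists ((Re d + 1 / 4) / 2). split.
    + apply (is_lim_seq_ext (fun m => (/ 2) * (em_deriv m + 1 / 4)
        - beta 4 * (/ (INR m + 1) * / (INR m + 1)))).
      * intros m. rewrite em_deriv_ln_glaisher. assert (h := pos_INR m). field. lra.
      * replace ((Re d + 1 / 4) / 2) with (/ 2 * (Re d + 1 / 4) - beta 4 * (0 * 0)) by field.
        apply is_lim_seq_minus'.
        -- apply (is_lim_seq_scal_l _ (/ 2) (Finite (Re d + 1 / 4))).
           apply is_lim_seq_plus'; auto. apply is_lim_seq_const.
        -- apply (is_lim_seq_scal_l _ (beta 4) (Finite (0 * 0))).
           now apply is_lim_seq_mult'.
    + replace (RtoC (2 * ((Re d + 1 / 4) / 2) - 1 / 4)) with d; auto.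
      apply C_ext; simpl; [field|exact Hi].
Qed.

Lemma prod_pow_exp n : prod_f_R0 (fun k => INR k ^ k) n
  = exp (rsum (fun k => INR k * ln (INR k)) (seq 0 (S n))).
Proof.
  induction n as [|n IH].
  - unfold rsum. simpl. rewrite Rmult_0_l, Rplus_0_l, exp_0. reflexivity.
  - rewrite rsum_seq_S, exp_plus, <- IH.
    change (prod_f_R0 (fun k => INR k ^ k) (S n))
      with (prod_f_R0 (fun k => INR k ^ k) n * INR (S n) ^ S n). f_equal.
    rewrite <- Rpower_pow by (apply lt_0_INR; lia). reflexivity.
Qed.

Lemma Glaisher_exp l : is_lim_seq (fun m => ln_glaisher (S m)) (Finite l) -> Glaisher = exp l.
Proof.
  intros H. unfold Glaisher.
  rewrite (is_lim_seq_unique _ (Finite (exp l))); [reflexivity|].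
  apply is_lim_seq_incr_1.
  apply (is_lim_seq_ext (fun m => exp (ln_glaisher (S m)))).
  - intros m. unfold ln_glaisher. rewrite prod_pow_exp. unfold Rdiv, Rpower at 1.
    rewrite <- exp_Ropp, <- !exp_plus. f_equal.
  - apply (is_lim_seq_continuous exp); auto.
    apply derivable_continuous_pt, derivable_pt_exp.
Qed.

(** In other words [-2 * zeta(-1)]. *)
Lemma hurwitz_m1 : hurwitz 1 one_Re (- (1))%C = RtoC (1 / 6).
Proof.
  assert (H := hurwitz_neg 1 one_Re 1 4 ltac:(lia)). simpl INR in H. rewrite H.
  unfold em_corr, csum, phi. simpl map. simpl fold_right.
  assert (P : forall p, Cpower 1 p = RtoC 1).
  { intros p. unfold Cpower. rewrite Cln_R, ln_1 by lra.
    replace (p * 0)%C with (RtoC 0) by ring. apply Cexp_0. }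
  rewrite !P, beta_0, beta_1, beta_2, beta_3. simpl INR. to_R. f_equal. field.
Qed.

(** * The case [N = 2], [x = 1] *)

Lemma m1_pow_odd m : ((- (1)) ^ m)%C = (if Nat.odd m then - (1) else RtoC 1)%C.
Proof.
  induction m as [|m IH]; [reflexivity|].
  rewrite Cpow_S, IH, Nat.odd_succ, <- Nat.negb_odd. destruct (Nat.odd m); simpl; ring.
Qed.

Definition altz11 (s : C) : C :=
  ((1 + - (4) * Cexp (- ln 2 * s)) * (hurwitz 1 one_Re (s - 1) * / (s - 2)))%C.

Lemma Cexp_ln2 : Cexp (ln 2) = RtoC 2.
Proof. rewrite Cexp_R, exp_ln; auto. lra. Qed.

(** The terms are [(-1)^m (m + 1)^(1 - s)]. Subtracting twice those with [m] odd from the full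
    series does it, and for [m = 2 l + 1] the base is [2 (l + 1)]. *)
Lemma altz_11 s : 2 < Re s -> altz 1 1 s = altz11 s.
Proof.
  intros Hs.
  destruct (altz_series 1 1 s one_Re) as [h1 _]; [simpl; lra|].
  destruct (hurwitz_series 1 one_Re (s - 1)%C) as [h2 _]; [change (1 < Re s - 1); lra|].
  set (Z := (hurwitz 1 one_Re (s - 1) / (s - 1 - 1))%C) in *.
  set (t := fun m : nat => Cpower (1 + INR m) (- (s - 1))) in *.
  set (g := fun m => if Nat.odd m then t m else RtoC 0).
  assert (Hg : is_sum g (Cexp (- (s - 1) * ln 2) * Z)%C).
  { apply (is_sum_image (fun l => (2 * l + 1)%nat)).
    - intros a b e. lia.
    - intros m Hm. unfold g. destruct (Nat.odd m) eqn:E; auto.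
      apply Nat.odd_spec in E. destruct E as [k Hk]. elim (Hm k). lia.
    - eapply is_sum_ext; [|exact (is_sum_scal (Cexp (- (s - 1) * ln 2))%C _ _ h2)].
      intros l. cbv beta. unfold g.
      replace (Nat.odd (2 * l + 1)) with true
        by (symmetry; apply Nat.odd_spec; now exists l).
      unfold t. replace (1 + INR (2 * l + 1))%C with (RtoC 2 * (1 + INR l))%C.
      + rewrite Cpower_scal; [reflexivity|lra|].
        change (0 < 1 + INR l). assert (h := pos_INR l). lra.
      + rewrite plus_INR, mult_INR. simpl INR. to_R. f_equal. ring. }
  assert (E : altz 1 1 s = (Z + - (2) * (Cexp (- (s - 1) * ln 2) * Z))%C).
  { apply (is_sum_unique _ _ _ h1).
    eapply is_sum_ext; [|exact (is_sum_plus _ _ _ _ h2 (is_sum_scal (- (2))%C _ _ Hg))].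
    intros m. cbv beta.
    assert (Et : t m = (INR 'C(m + 1, 1) * Cpower (1 + INR m) (- s))%C).
    { unfold t. replace (- (s - 1))%C with (- s + 1)%C by ring.
      rewrite Cpower_plus, Cpower_1.
      - replace ('C(m + 1, 1)) with (m + 1)%nat by (symmetry; exact (bin1 (m + 1))).
        rewrite plus_INR, RtoC_plus. simpl (INR 1). ring.
      - change (0 < 1 + INR m). assert (h := pos_INR m). lra. }
    rewrite <- Cmult_assoc, <- Et, m1_pow_odd. unfold g. destruct (Nat.odd m); ring. }
  rewrite E. unfold altz11, Z.
  replace (- (s - 1) * ln 2)%C with (ln 2 + - ln 2 * s)%C by ring.
  rewrite Cexp_plus, Cexp_ln2. unfold Cdiv.
  replace (s - 1 - 1)%C with (s - 2)%C; [ring|].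
  replace (RtoC 2) with (RtoC 1 + RtoC 1)%C by (to_R; f_equal; ring). ring.
Qed.

Lemma altz11_factor_entire : entire (fun s => 1 + - (4) * Cexp (- ln 2 * s))%C.
Proof.
  apply entire_plus; [apply entire_const|].
  apply entire_mult; [apply entire_const|apply entire_Cexp].
Qed.

Lemma mer_inv p a : mer (fun s => / (s - p))%C a.
Proof.
  destruct (prop_dec (p = a)) as [->|ne]; [|now apply hol_mer, hol_inv].
  exists 1%nat, (fun _ => RtoC 1), 1. split; [lra|]. split; [apply entire_hol, entire_const|].
  intros s Hs. simpl. field. apply Cmod_gt_0. lra.
Qed.

Lemma two_neq_0 : RtoC 2 <> RtoC 0.
Proof. intros e. apply RtoC_inj in e. lra. Qed.

(** The product rule for three factors. At 0 their values are -3, 1/6 and -1/2, and their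
    derivatives are [4 ln 2], [2 l - 1 / 4] and -1/4. *)
Lemma altz_deriv0_11 l : has_deriv (hurwitz 1 one_Re) (- (1))%C (RtoC (2 * l - 1 / 4)) ->
  altz_deriv0 1 1 = RtoC (- ln 2 / 3 + 3 * l - 1 / 4).
Proof.
  intros Hl.
  destruct (identity_near_0 (altz 1 1) altz11 2) as (r & Hr & E).
  - intros a. now apply altz_mer, one_Re.
  - apply altz_hol; [apply one_Re|simpl; lra].
  - intros a. apply mer_mult; [apply hol_mer, entire_hol, altz11_factor_entire|].
    apply mer_mult; [|apply mer_inv]. apply hol_mer, hol_shift, hol_hurwitz.
  - apply hol_mult; [apply entire_hol, altz11_factor_entire|].
    apply hol_mult; [apply hol_shift, hol_hurwitz|apply hol_inv, two_neq_0].
  - apply altz_11.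
  - assert (Hd : has_deriv altz11 0 (altz_deriv0 1 1)).
    { apply (has_deriv_local (altz 1 1)); [|apply altz_has_deriv, one_Re].
      exists r. split; auto. intros s Hs. apply E. now replace s with (s - 0)%C by ring. }
    apply (has_deriv_unique _ _ _ _ Hd).
    assert (H1 : has_deriv (fun s => 1 + - (4) * Cexp (- ln 2 * s))%C 0 (RtoC (4 * ln 2))).
    { replace (RtoC (4 * ln 2)) with (0 + - (4) * (- ln 2 * Cexp (- ln 2 * 0)))%C.
      - apply has_deriv_plus; [apply has_deriv_const|].
        apply has_deriv_scal; [apply entire_hol, entire_Cexp|apply has_deriv_Cexp].
      - replace (- ln 2 * 0)%C with (RtoC 0) by ring. rewrite Cexp_0. to_R. f_equal. ring. }
    assert (H2 : has_deriv (fun s => hurwitz 1 one_Re (s - 1)) 0 (RtoC (2 * l - 1 / 4))).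
    { apply has_deriv_shift. now replace (0 - 1)%C with (- (1))%C by ring. }
    assert (H3 := has_deriv_inv 2 0 two_neq_0).
    assert (H23 := has_deriv_mult _ _ _ _ _ (hol_shift _ _ _ (hol_hurwitz 1 one_Re _))
      (hol_inv 2 0 two_neq_0) H2 H3).
    assert (H := has_deriv_mult _ _ _ _ _ (entire_hol _ _ altz11_factor_entire)
      (hol_mult _ _ _ (hol_shift _ _ _ (hol_hurwitz 1 one_Re _)) (hol_inv 2 0 two_neq_0)) H1 H23).
    cbv beta in H.
    match type of H with has_deriv _ _ ?z => replace (RtoC (- ln 2 / 3 + 3 * l - 1 / 4)) with z end;
      [exact H|].
    replace (- ln 2 * 0)%C with (RtoC 0) by ring. rewrite Cexp_0.
    replace (0 - 1)%C with (- (1))%C by ring. rewrite hurwitz_m1.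
    replace (/ (0 - 2))%C with (RtoC (- / 2)).
    + replace (/ (2 - 0))%C with (RtoC (/ 2)).
      * to_R. f_equal. field.
      * replace (2 - 0)%C with (RtoC 2) by ring. apply RtoC_inv. lra.
    + replace (0 - 2)%C with (- (2))%C by ring. rewrite RtoC_opp, RtoC_inv by lra.
      field.
Qed.

Lemma Gamma_neq_0 N x : Gamma N x <> RtoC 0.
Proof. apply Cexp_neq_0. Qed.

Theorem theorem3p8 :
  (forall (N : nat) (x : C), (1 <= N)%nat -> 0 < Re x ->
     barGamma N x
     = Cexp (sum_n (fun k => (- (1)) ^ k * INR 'C(N, k) * logGamma N ((INR k + x) / 2)) N
             - / 2 ^ N * ln 2)%C
     /\
     zeta_prod (fun n => INR n + x)%C
               (fun n => ((-1) ^ Z.of_nat (n + 1) * Z.of_nat 'C(n + N - 1, N - 1))%Z)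
     = (Rpower 2 (- / 2 ^ N)
        * Cprod_n (fun k => CpowerZ (Gamma N ((INR k + x) / 2))
                                    ((-1) ^ Z.of_nat k * Z.of_nat 'C(N, k))%Z) N)%C)
  /\
  (barGamma 2 (RtoC 1)
   = zeta_prod (fun n => INR n + 1)%C
               (fun n => ((-1) ^ Z.of_nat (n + 1) * Z.of_nat (n + 1))%Z)
   /\
   zeta_prod (fun n => INR n + 1)%C
             (fun n => ((-1) ^ Z.of_nat (n + 1) * Z.of_nat (n + 1))%Z)
   = (Gamma 2 (RtoC (1 / 2)) * Gamma 2 (RtoC (3 / 2))
      / (Rpower 2 (1 / 4) * Gamma 2 (RtoC 1) ^ 2))%C)
  /\
  (Gamma 2 (RtoC (1 / 2)) * Gamma 2 (RtoC (3 / 2))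
   = Rpower 2 (- (1 / 12)) * exp (- (1 / 4)) * Glaisher ^ 3 * Gamma 2 (RtoC 1) ^ 2)%C.
Proof.
  assert (Hmain : forall n x, 0 < Re x -> barGamma (S n) x
     = Cexp (sum_n (fun k => (- (1)) ^ k * INR 'C(S n, k) * logGamma (S n) ((INR k + x) / 2)) (S n)
             - / 2 ^ S n * ln 2)%C).
  { intros n x Hx. rewrite barGamma_altz by auto. unfold altz_deriv0. rewrite <- sum_n_csum.
      reflexivity. }
  assert (Hz : zeta_prod (fun n => INR n + 1)%C
               (fun n => ((-1) ^ Z.of_nat (n + 1) * Z.of_nat (n + 1))%Z) = Cexp (altz_deriv0 1 1)).
  { rewrite <- (zeta_prod_altz 1 1 one_Re). f_equal.
    apply functional_extensionality. intros n. do 2 f_equal.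
    replace (n + 2 - 1)%nat with (n + 1)%nat by lia.
    replace (2 - 1)%nat with 1%nat by lia. symmetry. exact (bin1 (n + 1)). }
  assert (Hv : RtoC (Rpower 2 (1 / 4)) <> RtoC 0).
  { intros e. apply RtoC_inj in e. assert (h := exp_pos (1 / 4 * ln 2)). unfold Rpower in e. lra. }
  assert (Hprod : Cexp (altz_deriv0 1 1) = (Gamma 2 (RtoC (1 / 2)) * Gamma 2 (RtoC (3 / 2))
      / (Rpower 2 (1 / 4) * Gamma 2 (RtoC 1) ^ 2))%C).
  { rewrite Cexp_altz_deriv0. cbn [Cprod_n].
    replace ((INR 0 + 1) / 2)%C with (RtoC (1 / 2))
      by (rewrite RtoC_div by lra; simpl; to_R; do 2 f_equal; ring).
    replace ((INR 1 + 1) / 2)%C with (RtoC 1) by (simpl; field; apply two_neq_0).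
    replace ((INR 2 + 1) / 2)%C with (RtoC (3 / 2))
      by (rewrite RtoC_div by lra; simpl; to_R; do 2 f_equal; ring).
    change (Z.mul ((-1) ^ Z.of_nat 0) (Z.of_nat 'C(2, 0))) with 1%Z.
    change (Z.mul ((-1) ^ Z.of_nat 1) (Z.of_nat 'C(2, 1))) with (-2)%Z.
    change (Z.mul ((-1) ^ Z.of_nat 2) (Z.of_nat 'C(2, 2))) with 1%Z.
    cbn [CpowerZ]. change (Pos.to_nat 2) with 2%nat. change (Pos.to_nat 1) with 1%nat.
    replace (- / 2 ^ 2) with (- (1 / 4)) by field.
    rewrite Rpower_Ropp, RtoC_inv by (intros e; apply Hv; now rewrite e).
    rewrite !Cpow_1_r. field. split; [apply Gamma_neq_0|auto]. }
  split; [|split].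
  - intros [|n] x HN Hx; [lia|]. split; [now apply Hmain|].
    rewrite zeta_prod_altz by auto. apply Cexp_altz_deriv0.
  - split; [|now rewrite Hz].
    rewrite Hz. apply barGamma_altz, one_Re.
  - destruct hurwitz_ln_glaisher as (l & Hl & Hd).
    (* The Gamma quotient and [2 ^ (- 1 / 3) e ^ (- 1 / 4) A ^ 3] are two values of the same
       exponential; clearing the denominator adds 1/4 to the exponent of 2, giving -1/12. *)
    rewrite (Glaisher_exp l Hl). rewrite (altz_deriv0_11 l Hd), Cexp_R in Hprod.
    assert (Hg := Gamma_neq_0 2 (RtoC 1)).
    replace (Gamma 2 (RtoC (1 / 2)) * Gamma 2 (RtoC (3 / 2)))%C
      with (Gamma 2 (RtoC (1 / 2)) * Gamma 2 (RtoC (3 / 2))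
      / (Rpower 2 (1 / 4) * Gamma 2 (RtoC 1) ^ 2)
      * (Rpower 2 (1 / 4) * Gamma 2 (RtoC 1) ^ 2))%C by (field; split; auto).
    rewrite <- Hprod, <- RtoC_pow, Cmult_assoc. f_equal.
    to_R. f_equal. unfold Rpower.
    replace (exp l ^ 3) with (exp (3 * l)).
    + rewrite <- !exp_plus. f_equal. field.
    + replace (3 * l) with (l + (l + (l + 0))) by ring. rewrite !exp_plus, exp_0. simpl. ring.
Qed.
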